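(* There exists a constant $c>0$ such that for all positive integers $n$, if $G_n$ is an $n\times n$ complex Ginibre matrix with eigenvalues $\lambda_1(G_n),\ldots,\lambda_n(G_n)$, then $$\mathbb{E}\sum_{i=1}^n\kappa\left(\lambda_i(G_n)\right)^2\ge cn^2.$$
   Context: A complex Ginibre matrix is an $n\times n$ random matrix $G_n=(g_{ij})$ whose entries are i.i.d. complex Gaussians $N(0,1_{\mathbb{C}}/n)$, i.e. the real and imaginary parts of all entries are independent real Gaussians with mean $0$ and variance $1/(2n)$; it has distinct eigenvalues with probability one. For a matrix $M\in\mathbb{C}^{n\times n}$ with distinct eigenvalues $\lambda_1,\ldots,\lambda_n$, write $M=\sum_{i=1}^n\lambda_iv_iw_i^*=VDV^{-1}$, where the right and left eigenvectors $v_i$ and $w_i^*$ are the columns of $V$ and the rows of $V^{-1}$, respectively, normalized so that $w_i^*v_i=1$. The eigenvalue condition number of $\lambda_i$ is $\kappa(\lambda_i)=\|v_iw_i^*\|=\|v_i\|\,\|w_i\|$ (operator norm for matrices, Euclidean norm for vectors). *)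

(* Defs.v *)
From HB Require Import structures.
From mathcomp Require Import all_boot all_order all_algebra complex.
From mathcomp Require Import all_classical all_reals all_analysis.
Set Implicit Arguments.
Unset Strict Implicit.
Unset Printing Implicit Defensive.
Import Order.TTheory GRing.Theory Num.Theory.
Local Open Scope classical_set_scope.
Local Open Scope ring_scope.
Local Open Scope complex_scope.

Section EigenvalueConditionNumber.
Variables (R : realType) (n : nat).
Implicit Types (M V : 'M[R[i]]_n) (D : 'rV[R[i]]_n) (l : R[i]) (i : 'I_n).

Definition euclidean_norm (v : 'cV[R[i]]_n) : R :=
  Num.sqrt (\sum_(k < n) ComplexField.Normc.normc (v k 0) ^+ 2).

Definition right_eigvec V i : 'cV[R[i]]_n := col i V.

(* The left eigenvector is w_i^*, the i-th row of V^-1; this is w_i. *)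
Definition left_eigvec V i : 'cV[R[i]]_n :=
  (map_mx (@conjc R) (row i (invmx V)))^T.

Definition distinct_eigendecomposition M V D : Prop :=
  [/\ V \in unitmx, injective (D 0) & M = V *m diag_mx D *m invmx V].

(* The value does not depend on the decomposition (eigencondE below); it is 0
   if M does not have n distinct eigenvalues or if l is not one of them. *)
Definition eigencond M l : R :=
  xget (0 : R) [set k : R | exists V D i,
    [/\ distinct_eigendecomposition M V D, D 0 i = l &
        k = euclidean_norm (right_eigvec V i) *
            euclidean_norm (left_eigvec V i)]].

(* The roots of the characteristic polynomial with multiplicity, in an
   arbitrary order. *)
Definition eigenvalues M : seq R[i] :=
  sval (closed_field_poly_normal (char_poly M)).

Lemma char_poly_eigenvalues M :
  char_poly M = \prod_(l <- eigenvalues M) ('X - l%:P).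
Proof.
rewrite /eigenvalues; case: closed_field_poly_normal => r /= {1}->.
by rewrite (monicP (char_poly_monic M)) scale1r.
Qed.

Lemma size_eigenvalues M : size (eigenvalues M) = n.
Proof.
have := size_char_poly M.
by rewrite char_poly_eigenvalues size_prod_XsubC => -[].
Qed.

Lemma euclidean_normZ (a : R[i]) (v : 'cV[R[i]]_n) :
  euclidean_norm (a *: v) = ComplexField.Normc.normc a * euclidean_norm v.
Proof.
have a0 : 0 <= ComplexField.Normc.normc a by case: a => x y; rewrite sqrtr_ge0.
rewrite /euclidean_norm.
under eq_bigr do rewrite mxE ComplexField.Normc.normcM exprMn.
by rewrite -big_distrr sqrtrM ?sqr_ge0//= sqrtr_sqr ger0_norm.
Qed.

Lemma left_eigvecE V i : euclidean_norm (left_eigvec V i) =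
  euclidean_norm (row i (invmx V))^T.
Proof.
rewrite /euclidean_norm; congr Num.sqrt; apply: eq_bigr => k _.
by rewrite !mxE; case: (invmx V i k) => x y /=; rewrite sqrrN.
Qed.

Lemma eigencondE M V D i : distinct_eigendecomposition M V D ->
  eigencond M (D 0 i) =
  euclidean_norm (right_eigvec V i) * euclidean_norm (left_eigvec V i).
Proof.
move=> dM; rewrite /eigencond; case: xgetP => [k -> /= [V' [D' [j]]]|/= no].
  case=> dM' DD ->; rewrite !left_eigvecE.
  case: dM dM' => Vu Di MV [V'u D'i MV'].
  have [A [V'E VE AE]] : exists A, [/\ V' = V *m A, invmx V = A *m invmx V' &
      A *m diag_mx D' = diag_mx D *m A].
    exists (invmx V *m V'); split; rewrite ?mulKVmx ?mulmxK //.
    have E : M *m V' = V' *m diag_mx D' by rewrite MV' mulmxKV.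
    by rewrite -mulmxA -E MV -!mulmxA mulKmx.
  have A0 p q : D' 0 q != D 0 p -> A p q = 0.
    move=> ne; have /matrixP/(_ p q) := AE.
    rewrite mul_mx_diag mul_diag_mx !mxE => E; apply/eqP.
    have /eqP : A p q * (D' 0 q - D 0 p) = 0.
      by rewrite mulrBr [A p q * D 0 p]mulrC E subrr.
    by rewrite mulf_eq0 subr_eq0 (negPf ne) orbF.
  have vE : right_eigvec V' j = A i j *: right_eigvec V i.
    apply/colP => p; rewrite V'E !mxE (bigD1 i)//= big1 ?addr0 1?mulrC //.
    move=> q qi; rewrite A0 ?mulr0// DD; apply/negP => /eqP /Di E.
    by rewrite E eqxx in qi.
  have wE : (row i (invmx V))^T = A i j *: (row j (invmx V'))^T.
    apply/colP => p; rewrite VE !mxE (bigD1 j)//= big1 ?addr0 //.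
    move=> q qj; rewrite A0 ?mul0r// -DD; apply/negP => /eqP /D'i E.
    by rewrite E eqxx in qj.
  by rewrite vE wE !euclidean_normZ mulrCA mulrA.
by exfalso; apply: (no (euclidean_norm (right_eigvec V i) *
  euclidean_norm (left_eigvec V i))); exists V, D, i.
Qed.

End EigenvalueConditionNumber.

Section ComplexGinibre.
Context d (Omega : measurableType d) (R : realType) (P : probability Omega R).

Definition mutually_independent (I : finType) (X : I -> {RV P >-> R}) : Prop :=
  forall (J : {set I}) (A : I -> set R),
    (forall k, k \in J -> measurable (A k)) ->
    P (\bigcap_(k in [set` J]) (X k @^-1` A k)) =
    (\prod_(k in J) P (X k @^-1` A k))%E.

(* The second argument of normal_prob is the standard deviation. *)
Definition complex_ginibre n (G : Omega -> 'M[R[i]]_n) : Prop :=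
  exists X : 'I_n * 'I_n * bool -> {RV P >-> R},
    [/\ forall w, G w = \matrix_(i, j) (X (i, j, false) w +i* X (i, j, true) w),
        forall k (A : set R), measurable A ->
          distribution P (X k) A = normal_prob 0 (Num.sqrt (2 * n%:R)^-1) A &
        mutually_independent X].

End ComplexGinibre.

(* Main.v *)
(** Kac-Rice lower bound. Let chi = det(x - G), let q_jk be the (j,k) cofactor of
    x - G and W = chi' q_jk - chi q_jk'. For distinct eigenvalues the sum of the
    kappa(lambda_l)^2 is the sum over l, j, k of |q_jk / chi'|^2 at lambda_l. For a
    point x uniform in a small fixed square, the event
      |chi(x)| < eps |q_jk(x)|, |chi'(x)| > delta |q_jk(x)|
    has conditional probability given G of at most about
    eps^2 / r^2 times the sum over l of |q_jk / chi'|^2 at lambda_l, so reverse Fatou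
    in eps -> 0 turns lower bounds on its probability into lower bounds on the
    moment. In the other order, fix x and everything except the entry z = g_jk:
    q_jk and W do not depend on z, and chi(x) = q_jk(x) (R - z) with R independent of
    z, so the event contains a disc of radius eps around R as soon as
    |W(x)| > delta (|q_jk(x)| + |q_jk'(x)|) |q_jk(x)|, and its probability is at least
    eps^2 (n / 4e) exp(-2 n |R|^2). As delta -> 0 the condition on W becomes generic.

    It remains to see that, for each row j, the sum over k of E exp(-2 n |R_jk|^2) is
    bounded below. Here q_jk R_jk is a Gaussian combination of the entries of
    row j, shifted by x q_jj, with coefficients the cofactors of row j, and
    integrating row j out gives at least half the expectation of
    exp(-2 n |x|^2 u^2), where u = |q_jj| / |(q_jk)_k|. The bound
    E u <= const / sqrt n follows by induction on the size of principal
    submatrices: for l <> j, the cofactors q_jl and q_jj are up to sign combinations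
    of columns j and l of x - G whose coefficients are the cofactors of column l in
    the principal minor without row and column j. *)


Require Import Defs.
From HB Require Import structures.
From mathcomp Require Import all_boot all_order all_algebra complex.
From mathcomp Require Import separable.
From mathcomp Require Import all_classical all_reals all_analysis.
From mathcomp Require Import measurable_realfun measurable_fun_approximation lebesgue_integral_fubini.
From mathcomp Require Import ring lra zify.
Set Implicit Arguments.
Unset Strict Implicit.
Unset Printing Implicit Defensive.
Import Order.TTheory GRing.Theory Num.Theory.
Import numFieldNormedType.Exports.
Local Open Scope classical_set_scope.
Local Open Scope ring_scope.
Local Open Scope complex_scope.

(** * Integrals *)

(** No measurability of the sum of squared condition numbers is established: [eigencond] picks its
    value by [xget]. The sum is therefore only compared from below, through the simple functions
    under it. This dictates the role of the condition |chi'| > delta |q_jk|: it confines the event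
    to discs of radius n eps / delta around the eigenvalues, hence a domination uniform in G for eps
    -> 0 with delta fixed; Fatou handles delta -> 0.

    Independence enters only as invariance under redrawing one coordinate ([resampling]), which any
    submatrix inherits. Gaussian sums are integrated out variable by variable through Laplace
    transforms, even for the inverse moment E 1/|X|, dominated by a dyadic sum of Gaussians.

    The point x stays in a small square because the recursion for E u multiplies the previous bound
    by [ratio_const] |x| sqrt(n / m) with m of order n, a contraction for small |x|. The order n^2
    comes from n rows, each contributing a constant, times the factor n of the Gaussian density. *)

Section integral_generalities.
Context d (T : measurableType d) (R : realType).
Local Open Scope ereal_scope.
Import HBNNSimple.

(** The integral of a nonnegative function is a supremum over the simple functions below it, so
    monotonicity holds for arbitrary functions. This lets sums of [eigencond] be integrated without
    a measurability proof. *)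
Lemma ge0_le_integral_nomeas (mu : {measure set T -> \bar R}) (f g : T -> \bar R) :
  (forall x, 0 <= f x) -> (forall x, f x <= g x) ->
  \int[mu]_x f x <= \int[mu]_x g x.
Proof.
move=> f0 fg.
have g0 x : 0 <= g x by exact: le_trans (f0 x) (fg x).
rewrite !ge0_integralTE//; apply: ereal_sup_le => _ [h hf <-].
by exists h => //= x; exact: le_trans (hf x) (fg x).
Qed.

Lemma ge0_integral_density (mu nu : {measure set T -> \bar R}) (p : T -> R)
    (f : T -> \bar R) :
  (forall x, (0 <= p x)%R) -> measurable_fun setT p ->
  (forall A, measurable A -> nu A = \int[mu]_(x in A) (p x)%:E) ->
  measurable_fun setT f -> (forall x, 0 <= f x) ->
  \int[nu]_x f x = \int[mu]_x (f x * (p x)%:E).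
Proof.
move=> p0 mp nuE mf f0.
have indic A : measurable A ->
    \int[nu]_x (\1_A x)%:E = \int[mu]_x ((\1_A x)%:E * (p x)%:E).
  move=> mA; rewrite integral_indic// setIT nuE// integral_mkcond.
  apply: eq_integral => x _; rewrite patchE indicE.
  by case: ifPn => xA; rewrite ?mul1e ?mul0e.
pose f_ := nnsfun_approx measurableT mf.
have simple (g : {nnsfun T >-> R}) :
    \int[nu]_x (g x)%:E = \int[mu]_x ((g x)%:E * (p x)%:E).
  under [LHS]eq_integral do rewrite fimfunE -fsumEFin//.
  rewrite ge0_integral_fsum//; last 2 first.
    by move=> r; exact/measurable_EFinP/measurableT_comp.
    by move=> n x _; rewrite EFinM nnfun_muleindic_ge0.
  under [RHS]eq_integral => x _.
    rewrite fimfunE -fsumEFin// muleC ge0_mule_fsumr; last first.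
      by move=> r; rewrite EFinM nnfun_muleindic_ge0.
    over.
  rewrite ge0_integral_fsum//; last 2 first.
    move=> r; apply: emeasurable_funM; first exact/measurable_EFinP.
    exact/measurable_EFinP/measurableT_comp.
    by move=> r x _; apply: mule_ge0; [rewrite lee_fin|rewrite EFinM nnfun_muleindic_ge0].
  apply: eq_fsbigr => r _; under eq_integral do rewrite EFinM.
  rewrite integralZl_indic_nnsfun// indic//.
  have [r0|r0] := leP 0%R r.
    rewrite -ge0_integralZl//.
    - by apply: eq_integral => x _; rewrite EFinM [RHS]muleC muleA.
    - apply: emeasurable_funM; last exact/measurable_EFinP.
      exact/measurable_EFinP/measurable_indic.
    - by move=> x _; rewrite mule_ge0 ?lee_fin.
  rewrite preimage_nnfun0//; under eq_integral do rewrite indic0 mul0e.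
  by under [in RHS]eq_integral do rewrite indic0 mulr0 mule0; rewrite !integral0 mule0.
transitivity (limn (fun n => \int[nu]_x (f_ n x)%:E)).
  rewrite -monotone_convergence//=.
  - apply: eq_integral => ? /[!inE] xD; apply/esym/cvg_lim => //=.
    exact: cvg_nnsfun_approx.
  - by move=> n; exact/measurable_EFinP/measurable_funTS.
  - by move=> n ? _; rewrite lee_fin.
  - by move=> ? _ ? ? mn; rewrite lee_fin; exact/lefP/nd_nnsfun_approx.
transitivity (limn (fun n => \int[mu]_x ((f_ n x)%:E * (p x)%:E))).
  by apply: congr_lim; apply/funext => n; exact: simple.
rewrite -monotone_convergence//=.
- apply: eq_integral => x _; apply/cvg_lim => //=.
  apply: cvgeZr => //; apply: cvg_nnsfun_approx => //.
- move=> n; apply: emeasurable_funM; last exact/measurable_EFinP.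
  exact/measurable_EFinP/measurable_funTS.
- by move=> n x _; rewrite mule_ge0 ?lee_fin.
- move=> x _ m n mn; rewrite lee_wpmul2r ?lee_fin//.
  exact/lefP/nd_nnsfun_approx.
Qed.

End integral_generalities.

(** * Laplace transforms of Gaussian laws *)

Section normal_laplace.
Variable R : realType.
Implicit Types s b x sigma : R.

Lemma integral_normal_prob sigma (f : R -> \bar R) :
  measurable_fun setT f -> (forall x, 0 <= f x)%E ->
  (\int[normal_prob 0 sigma]_x f x =
   \int[lebesgue_measure]_x (f x * (normal_pdf 0 sigma x)%:E))%E.
Proof.
move=> mf f0; apply: ge0_integral_density => //.
- by move=> x; exact: normal_pdf_ge0.
- exact: measurable_normal_pdf.
Qed.

(** Completing the square: the integrand is a constant times the normal density of mean [m'] and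
    deviation [sig']. Negative s is allowed as long as D > 0; that case later controls a first
    absolute moment. *)
Lemma integral_normal_expR sigma s b : 0 < sigma -> 0 < 1 + 2 * s * sigma ^+ 2 ->
  (\int[normal_prob 0 sigma]_x (expR (- (s * (x - b) ^+ 2)))%:E =
  ((Num.sqrt (1 + 2 * s * sigma ^+ 2))^-1 *
   expR (- (s * b ^+ 2 / (1 + 2 * s * sigma ^+ 2))))%:E)%E.
Proof.
move=> sig0 D0; set D := 1 + _.
have mf : measurable_fun setT (fun x => expR (- (s * (x - b) ^+ 2))).
  apply: measurableT_comp => //; apply: measurableT_comp => //.
  apply: measurable_funM => //; apply: measurable_funX.
  exact: measurable_funB.
rewrite integral_normal_prob; [|exact/measurable_EFinP|by move=> x; rewrite lee_fin expR_ge0].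
have sD0 : 0 < Num.sqrt D by rewrite sqrtr_gt0.
pose m' := 2 * s * sigma ^+ 2 * b / D; pose sig' := sigma / Num.sqrt D.
have sig'0 : 0 < sig' by rewrite divr_gt0.
set C := (X in _ = X%:E).
have E x : expR (- (s * (x - b) ^+ 2)) * normal_pdf 0 sigma x =
    C * normal_pdf m' sig' x.
  rewrite !normal_pdfE ?gt_eqF// /C /normal_fun /normal_peak.
  rewrite [sig' ^+ 2]expr_div_n sqr_sqrtr ?ltW//.
  have -> : Num.sqrt (sigma ^+ 2 / D * pi *+ 2) =
            Num.sqrt (sigma ^+ 2 * pi *+ 2) / Num.sqrt D.
    rewrite -sqrtrV ?ltW// -sqrtrM ?mulrn_wge0 ?(mulr_ge0 (sqr_ge0 _)) ?pi_ge0 ?invr_ge0 ?ltW//.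
    by congr Num.sqrt; rewrite mulrAC mulrnAl.
  rewrite invf_div mulrCA -expRD.
  have E4 (a c e f : R) : c != 0 -> c^-1 * e * (c / a * f) = a^-1 * (e * f).
    by move=> c0; move: a^-1 => a'; field.
  rewrite E4 ?gt_eqF//.
  rewrite -expRD; congr (_ * expR _).
  by rewrite /m' /D; field; rewrite ?gt_eqF//= mulr_gt0 ?exprn_gt0.
under eq_integral => x _ do rewrite -EFinM E EFinM.
rewrite integralZl//; last exact: integrable_normal_pdf.
by rewrite integral_normal_pdf mule1.
Qed.

End normal_laplace.

(** * Independent Gaussian coordinates *)

Section real_line.
Variable R : realType.

(* [normal_prob] and [uniform_prob] live on [measurableTypeR R], whose measure
   display differs from that of [R]; this identity transports them to [R]. *)
Definition toR (x : measurableTypeR R) : R := x.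

Lemma measurable_toR : measurable_fun setT toR.
Proof. by move=> _ A mA; rewrite setTI. Qed.

HB.instance Definition _ := isMeasurableFun.Build _ _ _ _ toR measurable_toR.

Definition gauss (sigma : R) : probability R R :=
  distribution (normal_prob 0 sigma) toR.

Lemma ge0_integral_gauss sigma (f : R -> \bar R) :
  measurable_fun setT f -> (forall x, 0 <= f x)%E ->
  (\int[gauss sigma]_x f x = \int[normal_prob 0 sigma]_x f x)%E.
Proof. by move=> mf f0; rewrite ge0_integral_distribution. Qed.

End real_line.
Arguments gauss : simpl never.

Section state_space.
Variables (R : realType) (I : finType).

(** The product space is carried by functions on I, so that a coordinate can be overwritten by
    [upd]; the boxes are a generating system closed under intersection, on which finite measures are
    compared. *)
Definition rectangles : set (set (I -> R)) :=
  [set A | exists B : I -> set R,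
     (forall i, measurable (B i)) /\ A = [set t | forall i, B i (t i)]].

Definition state : Type := g_sigma_algebraType rectangles.

HB.instance Definition _ := Measurable.on state.

Lemma measurable_state_proj i : measurable_fun [set: state] (fun t : state => t i).
Proof.
move=> _ A mA; rewrite setTI; apply: sub_sigma_algebra.
exists (fun j => if j == i then A else setT); split.
  by move=> j; case: ifP.
apply/seteqP; split => [t /= At j|t /= /(_ i)]; last by rewrite eqxx.
by case: eqP => // ->.
Qed.

Lemma measurable_to_state d (D : measurableType d) (f : D -> state) :
  (forall i, measurable_fun setT (fun x => f x i)) -> measurable_fun setT f.
Proof.
move=> mf; apply: (@measurability _ _ D state setT f rectangles) => //.
move=> _ [_ [B [mB ->] <-]]; rewrite setTI.
rewrite (_ : _ @^-1` _ = \bigcap_(i in [set: I]) ((fun x => f x i) @^-1` B i)).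
  apply: fin_bigcap_measurable => [|i _]; first exact: finite_finset.
  by rewrite -[X in measurable X]setTI; exact: mf.
by apply/seteqP; split => x /= h; [move=> i _; exact: h|move=> i; exact: h].
Qed.

Definition upd (i : I) (x : R) (t : state) : state :=
  fun j => if j == i then x else t j.

Lemma measurable_upd d (D : measurableType d) i (f : D -> R) (g : D -> state) :
  measurable_fun setT f -> measurable_fun setT g ->
  measurable_fun setT (fun x => upd i (f x) (g x)).
Proof.
move=> mf mg; apply: measurable_to_state => j; rewrite /upd.
case: eqP => _ //.
exact: (measurableT_comp (measurable_state_proj j) mg).
Qed.

Lemma state_measure_unique (m1 m2 : {measure set state -> \bar R}) :
  (m1 setT < +oo)%E ->
  (forall B : I -> set R, (forall i, measurable (B i)) ->
    m1 [set t | forall i, B i (t i)] = m2 [set t | forall i, B i (t i)]) ->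
  forall A, measurable A -> m1 A = m2 A.
Proof.
move=> m1oo m12; apply: (@measure_unique _ R state rectangles (fun=> setT)) => //.
- move=> _ _ [B [mB ->]] [C [mC ->]]; exists (fun i => B i `&` C i); split.
    by move=> i; exact: measurableI.
  by apply/seteqP; split => [t /= [h1 h2] i|t /= h]; split => // i; case: (h i).
- move=> _; exists (fun=> setT); split => //.
  by apply/seteqP; split.
- by rewrite bigcup_const.
- by move=> _ [B [mB ->]]; exact: m12.
Qed.

End state_space.

Section resampling.
Context (R : realType) (I : finType) (sigma : R).
Local Open Scope ereal_scope.

(** Invariance of mu under replacing one coordinate by a fresh Gaussian. This is the only trace of
    independence kept by the later arguments; iterating it integrates out any finite set of
    coordinates. *)
Definition resampling (mu : {measure set (state R I) -> \bar R}) : Prop :=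
  forall (i : I) (F : state R I -> \bar R),
    measurable_fun setT F -> (forall t, 0 <= F t) ->
  \int[mu]_t F t = \int[mu]_t \int[gauss sigma]_x F (upd i x t).

Context d (Omega : measurableType d) (P : probability Omega R).
Variable X : I -> {RV P >-> R}.
Hypothesis X_law : forall k (A : set R), measurable A ->
  distribution P (X k) A = normal_prob 0%R sigma A.
Hypothesis X_indep : mutually_independent X.

Definition joint (w : Omega) : state R I := fun i => X i w.

Lemma measurable_joint : measurable_fun setT joint.
Proof. by apply: measurable_to_state => i; exact: measurable_funP. Qed.

HB.instance Definition _ := isMeasurableFun.Build _ _ _ _ joint measurable_joint.

Lemma joint_rect (B : I -> set R) : (forall i, measurable (B i)) ->
  P [set w | forall i, B i (X i w)] = \prod_(i : I) gauss sigma (B i).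
Proof.
move=> mB; have := X_indep (J := [set: I]%SET) (fun k _ => mB k).
rewrite (_ : \bigcap_(k in _) _ = [set w | forall i, B i (X i w)]); last first.
  by apply/seteqP; split => w /= h; [move=> i; apply: h; rewrite /= inE|move=> i _; exact: h].
move=> ->; apply: eq_big => [i|i _]; first by rewrite inE.
exact: X_law.
Qed.

(** By independence, the law of X and the law of X with coordinate i redrawn agree on boxes, hence
    everywhere; Fubini then separates the fresh variable. *)
Lemma resampling_joint : resampling (distribution P joint).
Proof.
move=> i F mF F0.
pose phi (p : R * Omega) : state R I := upd i p.1 (joint p.2).
have mphi : measurable_fun setT phi.
  apply: measurable_upd => //.
  exact: (measurableT_comp measurable_joint measurable_snd).
pose phi' : {mfun _ >-> _} := HB.pack phi (isMeasurableFun.Build _ _ _ _ _ mphi).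
pose N := gauss sigma.
pose mu2 : {measure set state R I -> \bar R} := distribution (N \x P) phi'.
have E A : measurable A -> distribution P joint A = mu2 A.
  apply: state_measure_unique.
    exact: (le_lt_trans (probability_le1 (distribution P joint) measurableT) (ltry _)).
  move=> B mB.
  transitivity (P [set w | forall i, B i (X i w)]) => //.
  transitivity ((N \x P) (phi @^-1` [set t | forall i, B i (t i)])) => //.
  (* The fresh variable carries the constraint [B i], so the old coordinate i is left
     unconstrained. *)
  pose B' j := if j == i then setT else B j.
  rewrite joint_rect// (_ : phi @^-1` _ = B i `*`
      [set w | forall j, B' j (X j w)]); last first.
    apply/seteqP; split => [[x w] /= h|[x w] [/= h1 h2] j]; last first.
      by have := h2 j; rewrite /B' /phi /upd /=; case: eqP => [->|].
    split; first by have := h i; rewrite /phi /upd /= eqxx.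
    by move=> j; have := h j; rewrite /B' /phi /upd /=; case: eqP.
  have mB' j : measurable (B' j) by rewrite /B'; case: ifP.
  rewrite product_measure1E//; last first.
    rewrite (_ : [set _ | _] = \bigcap_(j in [set: I]) (X j @^-1` B' j)).
      apply: fin_bigcap_measurable => [|j _]; first exact: finite_finset.
      by rewrite -[Y in measurable Y]setTI; exact: measurable_funP.
    by apply/seteqP; split => [x h j _|x h j]; [exact: (h j)|exact: (h j Logic.I)].
  rewrite [X in _ = _ * X](joint_rect mB') (bigD1 i)//= [in RHS](bigD1 i)//=.
  rewrite (_ : B' i = setT) ?probability_setT ?mul1e; last by rewrite /B' eqxx.
  by congr (_ * _); apply: eq_bigr => j /negbTE; rewrite /B' => ->.
rewrite (eq_measure_integral mu2); last by move=> A mA _; exact: E.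
have mFphi : measurable_fun setT (F \o phi) by exact: measurableT_comp.
transitivity (\int[N \x P]_p (F \o phi) p).
  by rewrite ge0_integral_distribution.
rewrite (fubini_tonelli2 (F \o phi))//; last by move=> p; exact: F0.
rewrite ge0_integral_distribution//=.
- apply: (measurable_fun_fubini_tonelli_F (fun p => F (upd i p.2 p.1))) => //.
  by apply: measurableT_comp => //; exact: measurable_upd.
- by move=> t; apply: integral_ge0.
Qed.

End resampling.

(** * Complex-valued measurable functions *)

Notation nrm := ComplexField.Normc.normc.

Section complex_modulus.
Variable R : realType.
Implicit Types (z w : R[i]).

Lemma nrm_ge0 z : 0 <= nrm z.
Proof. by case: z => a b; exact: sqrtr_ge0. Qed.

Lemma nrm_sqr z : nrm z ^+ 2 = complex.Re z ^+ 2 + complex.Im z ^+ 2.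
Proof. by case: z => a b /=; rewrite sqr_sqrtr// addr_ge0 ?sqr_ge0. Qed.

Lemma nrm_eq0 z : (nrm z == 0) = (z == 0).
Proof.
apply/eqP/eqP => [/ComplexField.Normc.eq0_normc//|->].
exact: ComplexField.Normc.normc0.
Qed.

Lemma nrm_gt0 z : (0 < nrm z) = (z != 0).
Proof. by rewrite lt_def nrm_ge0 andbT nrm_eq0. Qed.

Lemma nrmN z : nrm (- z) = nrm z.
Proof. by case: z => a b /=; rewrite !sqrrN. Qed.

Lemma nrmM z w : nrm (z * w) = nrm z * nrm w.
Proof. exact: ComplexField.Normc.normcM. Qed.

Lemma nrmV z : nrm z^-1 = (nrm z)^-1.
Proof. exact: ComplexField.Normc.normcV. Qed.

Lemma nrmD z w : nrm (z + w) <= nrm z + nrm w.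
Proof. exact: le_normcD. Qed.

Lemma nrmB z w : nrm (z - w) <= nrm z + nrm w.
Proof. by rewrite -(nrmN w); exact: nrmD. Qed.

Lemma nrmC z w : nrm (z - w) = nrm (w - z).
Proof. by rewrite -nrmN opprB. Qed.

Lemma nrm0 : nrm (0 : R[i]) = 0.
Proof. exact: ComplexField.Normc.normc0. Qed.

Lemma nrm1 : nrm (1 : R[i]) = 1.
Proof. exact: ComplexField.Normc.normc1. Qed.

Lemma nrm_signr n : nrm ((-1) ^+ n : R[i]) = 1.
Proof.
elim: n => [|n IH]; first by rewrite expr0 nrm1.
by rewrite exprS nrmM IH mulr1 nrmN nrm1.
Qed.

Lemma nrm_sub_dist z w : nrm z - nrm w <= nrm (z - w).
Proof. by rewrite lerBlDr (le_trans _ (nrmD _ _)) // subrK. Qed.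

Lemma nrm_sum (I : Type) (s : seq I) (P : pred I) (F : I -> R[i]) :
  nrm (\sum_(i <- s | P i) F i) <= \sum_(i <- s | P i) nrm (F i).
Proof.
elim/big_rec2: _ => [|i x y _ h]; first by rewrite nrm0.
by rewrite (le_trans (nrmD _ _))// lerD2l.
Qed.

Lemma Re_le_nrm z : `|complex.Re z| <= nrm z.
Proof.
rewrite -(ler_pXn2r (n := 2)) ?nnegrE ?nrm_ge0// nrm_sqr real_normK ?num_real//.
by rewrite lerDl sqr_ge0.
Qed.

Lemma Im_le_nrm z : `|complex.Im z| <= nrm z.
Proof.
rewrite -(ler_pXn2r (n := 2)) ?nnegrE ?nrm_ge0// nrm_sqr real_normK ?num_real//.
by rewrite lerDr sqr_ge0.
Qed.

End complex_modulus.

Lemma integral_cst_probability d (T : measurableType d) (R : realType)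
  (P : probability T R) (c : R) : (\int[P]_x c%:E = c%:E)%E.
Proof. by rewrite integral_cst//= probability_setT mule1. Qed.

(** Real powers are measurable, and f^-1 is f times the power -1 of the nonnegative f^2; both sides
    vanish where f does. *)
Lemma measurable_fun_inv d (D : measurableType d) (R : realType) (f : D -> R) :
  measurable_fun setT f -> measurable_fun setT (fun x => (f x)^-1).
Proof.
move=> mf; rewrite (_ : (fun x => _) = fun x => f x * (f x ^+ 2) `^ (-1)).
  apply: measurable_funM => //.
  apply: (measurableT_comp (measurable_powR _)); exact: measurable_funX.
apply/funext => x; rewrite powR_inv1 ?sqr_ge0//.
have [->|x0] := eqVneq (f x) 0; first by rewrite invr0 mul0r.
by rewrite expr2 invfM mulrA divff// mul1r.
Qed.

Section complex_measurable.
Context d (D : measurableType d) (R : realType).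
Implicit Types f g : D -> R[i].

Definition cmeasurable f :=
  measurable_fun setT (fun x => complex.Re (f x)) /\
  measurable_fun setT (fun x => complex.Im (f x)).

Lemma cmeasurable_cst z : cmeasurable (fun=> z).
Proof. by split; exact: measurable_cst. Qed.

Lemma cmeasurableD f g : cmeasurable f -> cmeasurable g ->
  cmeasurable (fun x => f x + g x).
Proof.
move=> [f1 f2] [g1 g2]; split.
  rewrite (_ : (fun x => _) = fun x => complex.Re (f x) + complex.Re (g x)).
    exact: measurable_funD.
  by apply/funext => x; case: (f x) (g x) => a b [].
rewrite (_ : (fun x => _) = fun x => complex.Im (f x) + complex.Im (g x)).
  exact: measurable_funD.
by apply/funext => x; case: (f x) (g x) => a b [].
Qed.

Lemma cmeasurableN f : cmeasurable f -> cmeasurable (fun x => - f x).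
Proof.
move=> [f1 f2]; split.
  rewrite (_ : (fun x => _) = fun x => - complex.Re (f x)).
    exact: measurableT_comp.
  by apply/funext => x; case: (f x).
rewrite (_ : (fun x => _) = fun x => - complex.Im (f x)).
  exact: measurableT_comp.
by apply/funext => x; case: (f x).
Qed.

Lemma cmeasurableB f g : cmeasurable f -> cmeasurable g ->
  cmeasurable (fun x => f x - g x).
Proof. by move=> mf mg; apply: cmeasurableD => //; exact: cmeasurableN. Qed.

Lemma cmeasurableM f g : cmeasurable f -> cmeasurable g ->
  cmeasurable (fun x => f x * g x).
Proof.
move=> [f1 f2] [g1 g2]; split.
  rewrite (_ : (fun x => _) = fun x => complex.Re (f x) * complex.Re (g x) -
     complex.Im (f x) * complex.Im (g x)).
    by apply: measurable_funB; exact: measurable_funM.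
  by apply/funext => x; case: (f x) (g x) => a b [].
rewrite (_ : (fun x => _) = fun x => complex.Re (f x) * complex.Im (g x) +
     complex.Im (f x) * complex.Re (g x)).
  by apply: measurable_funD; exact: measurable_funM.
by apply/funext => x; case: (f x) (g x) => a b [].
Qed.

Lemma cmeasurable_sum (I : Type) (s : seq I) (P : pred I) (F : I -> D -> R[i]) :
  (forall i, cmeasurable (F i)) ->
  cmeasurable (fun x => \sum_(i <- s | P i) F i x).
Proof.
move=> mF; elim: s => [|i s IH].
  rewrite (_ : (fun x => _) = fun=> 0); first exact: cmeasurable_cst.
  by apply/funext => x; rewrite big_nil.
rewrite (_ : (fun x => _) =
    fun x => (if P i then F i x else 0) + \sum_(i <- s | P i) F i x).
  apply: cmeasurableD => //; case: (P i) => //; exact: cmeasurable_cst.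
by apply/funext => x; rewrite big_cons; case: ifP; rewrite ?add0r.
Qed.

Lemma cmeasurable_prod (I : Type) (s : seq I) (P : pred I) (F : I -> D -> R[i]) :
  (forall i, cmeasurable (F i)) ->
  cmeasurable (fun x => \prod_(i <- s | P i) F i x).
Proof.
move=> mF; elim: s => [|i s IH].
  rewrite (_ : (fun x => _) = fun=> 1); first exact: cmeasurable_cst.
  by apply/funext => x; rewrite big_nil.
rewrite (_ : (fun x => _) =
    fun x => (if P i then F i x else 1) * \prod_(i <- s | P i) F i x).
  apply: cmeasurableM => //; case: (P i) => //; exact: cmeasurable_cst.
by apply/funext => x; rewrite big_cons; case: ifP; rewrite ?mul1r.
Qed.

Lemma measurable_nrm f : cmeasurable f -> measurable_fun setT (fun x => nrm (f x)).
Proof.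
move=> [f1 f2]; rewrite (_ : (fun x => _) =
    Num.sqrt \o (fun x => complex.Re (f x) ^+ 2 + complex.Im (f x) ^+ 2)).
  apply: measurableT_comp; last first.
    by apply: measurable_funD; apply: measurable_funX.
  by apply: continuous_measurable_fun; exact: sqrt_continuous.
by apply/funext => x /=; case: (f x).
Qed.

Lemma cmeasurable_det n (M : D -> 'M[R[i]]_n) :
  (forall i j, cmeasurable (fun x => M x i j)) ->
  cmeasurable (fun x => \det (M x)).
Proof.
move=> mM; apply: cmeasurable_sum => s; apply: cmeasurableM.
  exact: cmeasurable_cst.
by apply: cmeasurable_prod => i.
Qed.

Lemma cmeasurable_cofactor n (M : D -> 'M[R[i]]_n) i j :
  (forall i j, cmeasurable (fun x => M x i j)) ->
  cmeasurable (fun x => cofactor (M x) i j).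
Proof.
move=> mM; apply: cmeasurableM; first exact: cmeasurable_cst.
apply: cmeasurable_det => a b.
rewrite (_ : (fun x => _) = fun x => M x (lift i a) (lift j b))//.
by apply/funext => x; rewrite !mxE.
Qed.

(* Zero is mapped to zero by both inversions. *)
Lemma cmeasurableV f : cmeasurable f -> cmeasurable (fun x => (f x)^-1).
Proof.
move=> mf; have mn := measurable_nrm mf; case: mf => f1 f2; split.
  rewrite (_ : (fun x => _) = fun x => complex.Re (f x) * (nrm (f x) ^+ 2)^-1).
    apply: measurable_funM => //; apply: measurable_fun_inv.
    exact: measurable_funX.
  by apply/funext => x; rewrite nrm_sqr; case: (f x).
rewrite (_ : (fun x => _) = fun x => - complex.Im (f x) * (nrm (f x) ^+ 2)^-1).
  apply: measurable_funM => //; first exact: measurableT_comp.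
  by apply: measurable_fun_inv; exact: measurable_funX.
by apply/funext => x; rewrite nrm_sqr; case: (f x) => a b /=; rewrite mulNr.
Qed.

End complex_measurable.

Lemma cmeasurable_comp d d' (D : measurableType d) (D' : measurableType d')
    (R : realType) (f : D' -> R[i]) (h : D -> D') :
  cmeasurable f -> measurable_fun setT h -> cmeasurable (fun x => f (h x)).
Proof.
by move=> [f1 f2] mh; split; [exact: (measurableT_comp f1 mh)|
  exact: (measurableT_comp f2 mh)].
Qed.

Section complex_coordinates.
Variables (R : realType) (K : finType).
Let I : finType := (K * bool)%type.
Implicit Types (t : state R I) (k l : K) (z : R * R).

Definition toC z : R[i] := z.1 +i* z.2.

Definition zc t k : R[i] := t (k, false) +i* t (k, true).

Definition updC k z t : state R I := upd (k, false) z.1 (upd (k, true) z.2 t).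

Lemma zc_updC k z t l : zc (updC k z t) l = if l == k then toC z else zc t l.
Proof.
rewrite /zc /updC /upd !xpair_eqE /= !andbT !andbF.
by case: eqP.
Qed.

Lemma cmeasurable_zc k : cmeasurable (fun t => zc t k).
Proof. by split; exact: measurable_state_proj. Qed.

Lemma measurable_updC d (D : measurableType d) k (f : D -> R * R) g :
  measurable_fun setT f -> measurable_fun setT g ->
  measurable_fun setT (fun x => updC k (f x) (g x)).
Proof.
move=> mf mg; apply: measurable_upd; first exact: measurableT_comp.
by apply: measurable_upd => //; exact: measurableT_comp.
Qed.

Lemma cmeasurable_toC : cmeasurable toC.
Proof. by split; [exact: measurable_fst|exact: measurable_snd]. Qed.

Definition cgauss (sigma : R) : probability (R * R)%type R :=
  (gauss sigma \x gauss sigma)%E.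

Local Open Scope ereal_scope.

Lemma resampling_complex sigma (mu : {measure set (state R I) -> \bar R}) :
  resampling sigma mu ->
  forall k (F : state R I -> \bar R),
    measurable_fun setT F -> (forall t, 0 <= F t) ->
  \int[mu]_t F t = \int[mu]_t \int[cgauss sigma]_z F (updC k z t).
Proof.
move=> RS k F mF F0; rewrite (RS (k, false))//.
have mG : measurable_fun setT
    (fun t : state R I => \int[gauss sigma]_x F (upd (k, false) x t)).
  apply: (measurable_fun_fubini_tonelli_F
    (fun p : state R I * R => F (upd (k, false) p.2 p.1))) => //.
  by apply: measurableT_comp => //; exact: measurable_upd.
rewrite (RS (k, true)) => [||t]; [|exact: mG|exact: integral_ge0].
apply: eq_integral => t _; rewrite (fubini_tonelli2 (fun z => F (updC k z t)))//.
apply: measurableT_comp => //; apply: measurable_updC => //.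
Qed.

(** With c = b / a, |a z - b|^2 = |a|^2 |z - c|^2 splits over real and imaginary parts; each factor
    contributes w^(-1/2), so no square root remains. For a = 0 the integrand is constant. *)
Lemma cgauss_laplace (sigma s : R) (a b : R[i]) : (0 < sigma)%R ->
  (0 < 1 + s * nrm a ^+ 2 * (2 * sigma ^+ 2))%R ->
  \int[cgauss sigma]_z (expR (- (s * nrm (a * toC z - b) ^+ 2)))%:E =
  ((1 + s * nrm a ^+ 2 * (2 * sigma ^+ 2))^-1 *
   expR (- (s * nrm b ^+ 2 / (1 + s * nrm a ^+ 2 * (2 * sigma ^+ 2)))))%:E.
Proof.
move=> sig0; have [->|a0] := eqVneq a 0%R.
  move=> _; rewrite nrm0 expr0n/= mulr0 mul0r addr0 invr1 mulr1 mul1r.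
  under eq_integral do rewrite mul0r sub0r nrmN.
  by rewrite integral_cst_probability.
set S := (s * nrm a ^+ 2)%R; set w := (1 + _)%R => w0.
pose e (c x : R) : R := expR (- (S * (x - c) ^+ 2)).
have me c : measurable_fun setT (e c).
  apply: measurableT_comp => //; apply: measurableT_comp => //.
  apply: measurable_funM => //; apply: measurable_funX; exact: measurable_funB.
have wE : w = (1 + 2 * S * sigma ^+ 2)%R by rewrite /w; ring.
have ie c : \int[gauss sigma]_x (e c x)%:E =
    ((Num.sqrt w)^-1 * expR (- (S * c ^+ 2 / w)))%:E.
  rewrite ge0_integral_gauss; [|exact/measurable_EFinP|by move=> x; rewrite lee_fin expR_ge0].
  by rewrite integral_normal_expR -?wE.
pose c := (b / a)%R.
have E z : (expR (- (s * nrm (a * toC z - b) ^+ 2)))%R =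
    (e (complex.Re c) z.1 * e (complex.Im c) z.2)%R.
  have -> : (a * toC z - b = a * (toC z - c))%R.
    by rewrite mulrBr /c mulrCA divff// mulr1.
  rewrite /e -expRD nrmM exprMn (nrm_sqr (toC z - c)%R); congr expR; rewrite /S.
  by case: c => c1 c2 /=; ring.
under eq_integral do rewrite E EFinM.
have mE c' : measurable_fun setT (EFin \o e c') by exact/measurable_EFinP.
have e0 c' x : (0 <= (e c' x)%:E) by rewrite lee_fin expR_ge0.
rewrite fubini_tonelli1; first last.
- by move=> z; rewrite mule_ge0.
- apply: emeasurable_funM; first exact: (measurableT_comp (mE _) measurable_fst).
  exact: (measurableT_comp (mE _) measurable_snd).
rewrite /fubini_F; under eq_integral => x _.
  rewrite (ge0_integralZl _ measurableT (mE _) (fun y _ => e0 _ y) (e0 _ _)) ie.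
  over.
rewrite (ge0_integralZr _ measurableT (mE _) (fun y _ => e0 _ y)); last first.
  by rewrite lee_fin mulr_ge0 ?invr_ge0 ?sqrtr_ge0 ?expR_ge0.
rewrite ie -EFinM; congr EFin; rewrite mulrACA -invfM -expr2 sqr_sqrtr ?ltW//.
rewrite -expRD; congr (_ * expR _)%R.
rewrite -opprD -mulrDl -mulrDr -nrm_sqr /S /c nrmM nrmV.
congr (- (_ / _))%R; rewrite -mulrA -exprMn (mulrC (nrm a)) divfK//.
by rewrite nrm_eq0.
Qed.

End complex_coordinates.
Arguments cgauss : simpl never.

(** * Gaussian linear combinations *)

Section gaussian_combination.
Variables (R : realType) (K : finType) (sigma : R).
Hypothesis sigma_gt0 : 0 < sigma.
Variable mu : {measure set (state R (K * bool)%type) -> \bar R}.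
Hypothesis mu_resampling : resampling sigma mu.
Local Notation S := (state R (K * bool)%type).

Definition free_of (U : Type) (k : K) (f : S -> U) : Prop :=
  forall z t, f (updC k z t) = f t.

(* Integrating out a Gaussian variable of variance [2 * sigma ^ 2] keeps the
   shape [A * exp (- s * |b| ^ 2)], so the variables can be removed one by one. *)
Lemma integral_gaussian_combination (I : eqType) (zeta : I -> K) (L : seq I)
    (A s : S -> R) (b : S -> R[i]) (c : I -> S -> R[i]) :
  injective zeta -> uniq L ->
  measurable_fun setT A -> (forall t, 0 <= A t) -> measurable_fun setT s ->
  cmeasurable b -> (forall k, cmeasurable (c k)) ->
  (forall k, k \in L -> [/\ free_of (zeta k) A, free_of (zeta k) s,
    free_of (zeta k) b & forall l, l \in L -> free_of (zeta k) (c l)]) ->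
  (forall t, 0 < 1 + s t * (2 * sigma ^+ 2 * \sum_(k <- L) nrm (c k t) ^+ 2)) ->
  (\int[mu]_t (A t *
     expR (- (s t * nrm (\sum_(k <- L) c k t * zc t (zeta k) - b t) ^+ 2)))%:E =
   \int[mu]_t (A t /
       (1 + s t * (2 * sigma ^+ 2 * \sum_(k <- L) nrm (c k t) ^+ 2)) *
     expR (- (s t * nrm (b t) ^+ 2 /
       (1 + s t * (2 * sigma ^+ 2 * \sum_(k <- L) nrm (c k t) ^+ 2)))))%:E)%E.
Proof.
move=> izeta + mA A0 ms + mc; elim: L b => [|k L IH] b.
  move=> _ _ _ _; apply: eq_integral => t _.
  by rewrite !big_nil !mulr0 addr0 sub0r nrmN !divr1.
move=> /= /andP[kL uL] mb fr pos.
pose V t := 2 * sigma ^+ 2 * \sum_(k <- L) nrm (c k t) ^+ 2.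
(* The first variable is moved into the shift; the others are removed by induction, and resampling
   it afterwards integrates it out. *)
pose b' t := b t - c k t * zc t (zeta k).
have V0 t : 0 <= V t.
  apply: mulr_ge0; first by rewrite mulr_ge0 ?sqr_ge0.
  by apply: sumr_ge0 => l _; exact: sqr_ge0.
(* For s < 0, positivity for the partial variance follows from that for the full variance, which is
   larger. *)
have D0 t : 0 < 1 + s t * V t.
  have [s0|s0] := leP 0 (s t); first by rewrite ltr_wpDr// mulr_ge0.
  apply: lt_le_trans (pos t) _; rewrite lerD2l; apply: ler_wnM2l; first exact: ltW.
  rewrite /V; apply: ler_wpM2l; first by rewrite mulr_ge0 ?sqr_ge0.
  by rewrite big_cons lerDr sqr_ge0.
have mb' : cmeasurable b'.
  by apply: cmeasurableB => //; apply: cmeasurableM => //; exact: cmeasurable_zc.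
have mV : measurable_fun setT V.
  apply: measurable_funM => //; apply: measurable_sum => l.
  by apply: measurable_funX; exact: measurable_nrm.
transitivity (\int[mu]_t (A t *
     expR (- (s t * nrm (\sum_(k <- L) c k t * zc t (zeta k) - b' t) ^+ 2)))%:E)%E.
  apply: eq_integral => t _; rewrite big_cons /b'.
  by congr (_ * expR (- (_ * nrm _ ^+ 2)))%:E; ring.
rewrite (IH b')//; last first.
  move=> l lL; have [fA fs fb fc] := fr l (mem_behead (s := k :: L) lL).
  split => //; last by move=> l' l'L; apply: fc; rewrite inE l'L orbT.
  move=> z t; rewrite /b' fb fc ?mem_head// zc_updC.
  by case: eqP => // /izeta kl; move: lL kL; rewrite kl => ->.
have [fA fs fb fc] := fr k (mem_head _ _).
have fV : free_of (zeta k) V.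
  move=> z t; rewrite /V; congr (_ * _); apply: eq_big_seq => l lL.
  by rewrite fc// inE lL orbT.
pose F (t : S) : \bar R := (A t / (1 + s t * V t) *
   expR (- (s t * nrm (b' t) ^+ 2 / (1 + s t * V t))))%:E.
have mF : measurable_fun setT F.
  have mD : measurable_fun setT (fun t => (1 + s t * V t)^-1).
    apply: measurable_fun_inv; apply: measurable_funD => //.
    exact: measurable_funM.
  apply/measurable_EFinP; apply: measurable_funM; first exact: measurable_funM.
  apply: measurableT_comp => //; apply: measurableT_comp => //.
  apply: measurable_funM => //; apply: measurable_funM => //.
  by apply: measurable_funX; exact: measurable_nrm.
have F0 t : (0 <= F t)%E.
  by rewrite lee_fin mulr_ge0 ?expR_ge0// divr_ge0// ltW.
rewrite (resampling_complex mu_resampling (zeta k) mF F0).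
apply: eq_integral => t _; rewrite /F.
have e z : (A (updC (zeta k) z t) / (1 + s (updC (zeta k) z t) * V (updC (zeta k) z t)) *
   expR (- (s (updC (zeta k) z t) * nrm (b' (updC (zeta k) z t)) ^+ 2 /
      (1 + s (updC (zeta k) z t) * V (updC (zeta k) z t))))) =
   A t / (1 + s t * V t) *
     expR (- (s t / (1 + s t * V t) * nrm (c k t * toC z - b t) ^+ 2)).
  rewrite fA fs fV /b' fb fc ?mem_head// zc_updC eqxx (nrmC (b t)).
  by congr (_ * expR (- _)); rewrite mulrAC.
under eq_integral do rewrite e EFinM.
have pos' : 0 < 1 + s t / (1 + s t * V t) * nrm (c k t) ^+ 2 * (2 * sigma ^+ 2).
  have := pos t; rewrite big_cons mulrDr mulrDr addrCA -/(V t) addrC.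
  rewrite -(pmulr_lgt0 _ (_ : 0 < (1 + s t * V t)^-1)) ?invr_gt0//.
  rewrite mulrDl divff ?gt_eqF// => h; apply: lt_le_trans h _.
  by rewrite lerD2l le_eqVlt; apply/orP; left; apply/eqP; ring.
have mE : measurable_fun setT (fun z : R * R =>
    (expR (- (s t / (1 + s t * V t) * nrm (c k t * toC z - b t) ^+ 2)))%:E).
  apply/measurable_EFinP; apply: measurableT_comp => //.
  apply: measurableT_comp => //; apply: measurable_funM => //.
  apply: measurable_funX; apply: measurable_nrm; apply: cmeasurableB.
    by apply: cmeasurableM; [exact: cmeasurable_cst|exact: cmeasurable_toC].
  exact: cmeasurable_cst.
rewrite (ge0_integralZl _ measurableT mE); last 2 first.
- by move=> z _; rewrite lee_fin expR_ge0.
- rewrite lee_fin; apply: divr_ge0; [exact: A0|exact/ltW/D0].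
rewrite cgauss_laplace// -EFinM [X in X%:E]mulrA; congr EFin.
have DE : (1 + s t * V t) *
   (1 + s t / (1 + s t * V t) * nrm (c k t) ^+ 2 * (2 * sigma ^+ 2)) =
   1 + s t * (2 * sigma ^+ 2 * (\sum_(j <- k :: L) nrm (c j t) ^+ 2)).
  rewrite mulrDr mulr1 big_cons [in RHS]mulrDr -/(V t).
  have -> a x y : a != 0 -> a * (x / a * y * (2 * sigma ^+ 2)) =
    x * (2 * sigma ^+ 2 * y) :> R by move=> a0; field.
    by rewrite mulrDr addrA addrAC.
  by rewrite gt_eqF.
congr (_ * expR _); first by rewrite -DE [in RHS]invfM [RHS]mulrA.
rewrite -DE; have E4 (x y D w : R) : x / D * y / w = x * y / (D * w).
  by rewrite invfM mulrA (mulrAC x y).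
by rewrite E4.
Qed.

End gaussian_combination.

(** * Almost sure nondegeneracy *)

Section polynomial_measurable.
Context d (D : measurableType d) (R : realType).
Implicit Types f g : D -> {poly R[i]}.

Definition pmeasurable f := forall i, cmeasurable (fun x => (f x)`_i).

Lemma pmeasurable_cst p : pmeasurable (fun=> p).
Proof. by move=> i; exact: cmeasurable_cst. Qed.

Lemma pmeasurableB f g : pmeasurable f -> pmeasurable g ->
  pmeasurable (fun x => f x - g x).
Proof.
move=> mf mg i; rewrite (_ : (fun x => _) = fun x => (f x)`_i - (g x)`_i).
  exact: cmeasurableB.
by apply/funext => x; rewrite coefB.
Qed.

Lemma pmeasurableM f g : pmeasurable f -> pmeasurable g ->
  pmeasurable (fun x => f x * g x).
Proof.
move=> mf mg i.
rewrite (_ : (fun x => _) = fun x => \sum_(j < i.+1) (f x)`_j * (g x)`_(i - j)).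
  by apply: cmeasurable_sum => j; exact: cmeasurableM.
by apply/funext => x; rewrite coefM.
Qed.

Lemma pmeasurable_deriv f : pmeasurable f -> pmeasurable (fun x => (f x)^`()).
Proof.
move=> mf i; rewrite (_ : (fun x => _) = fun x => (f x)`_i.+1 * i.+1%:R).
  by apply: cmeasurableM => //; exact: cmeasurable_cst.
by apply/funext => x; rewrite coef_deriv mulr_natr.
Qed.

Lemma pmeasurable_sum (I : Type) (s : seq I) (F : I -> D -> {poly R[i]}) :
  (forall i, pmeasurable (F i)) ->
  pmeasurable (fun x => \sum_(i <- s) F i x).
Proof.
move=> mF i; rewrite (_ : (fun x => _) = fun x => \sum_(j <- s) (F j x)`_i).
  by apply: cmeasurable_sum => j; exact: mF.
by apply/funext => x; rewrite coef_sum.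
Qed.

Lemma pmeasurable_prod (I : Type) (s : seq I) (F : I -> D -> {poly R[i]}) :
  (forall i, pmeasurable (F i)) ->
  pmeasurable (fun x => \prod_(i <- s) F i x).
Proof.
move=> mF; elim: s => [|i s IH].
  rewrite (_ : (fun x => _) = fun=> 1); first exact: pmeasurable_cst.
  by apply/funext => x; rewrite big_nil.
rewrite (_ : (fun x => _) = fun x => F i x * \prod_(i <- s) F i x).
  exact: pmeasurableM.
by apply/funext => x; rewrite big_cons.
Qed.

Lemma pmeasurable_det n (M : D -> 'M[{poly R[i]}]_n) :
  (forall i j, pmeasurable (fun x => M x i j)) ->
  pmeasurable (fun x => \det (M x)).
Proof.
move=> mM; apply: pmeasurable_sum => s; apply: pmeasurableM.
  exact: pmeasurable_cst.
by apply: pmeasurable_prod => i.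
Qed.

Lemma pmeasurable_cofactor n (M : D -> 'M[{poly R[i]}]_n) i j :
  (forall i j, pmeasurable (fun x => M x i j)) ->
  pmeasurable (fun x => cofactor (M x) i j).
Proof.
move=> mM; apply: pmeasurableM; first exact: pmeasurable_cst.
apply: pmeasurable_det => a b.
rewrite (_ : (fun x => _) = fun x => M x (lift i a) (lift j b))//.
by apply/funext => x; rewrite !mxE.
Qed.

Lemma cmeasurable_horner m f (h : D -> R[i]) :
  pmeasurable f -> (forall x, (size (f x) <= m)%N) -> cmeasurable h ->
  cmeasurable (fun x => (f x).[h x]).
Proof.
move=> mf sf mh.
rewrite (_ : (fun x => _) = fun x => \sum_(i < m) (f x)`_i * (\prod_(j < i) h x)).
  apply: cmeasurable_sum => i; apply: cmeasurableM => //.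
  exact: cmeasurable_prod.
apply/funext => x; rewrite (horner_coef_wide _ (sf x)).
by apply: eq_bigr => i _; rewrite prodr_const card_ord.
Qed.

(** Fixed degrees give the Sylvester matrix a constant size, so the resultant is one determinant
    with measurable entries. It makes the event of a multiple eigenvalue measurable. *)
Lemma cmeasurable_resultant a b f g :
  (forall x, size (f x) = a.+1) -> (forall x, size (g x) = b.+1) ->
  pmeasurable f -> pmeasurable g -> cmeasurable (fun x => resultant (f x) (g x)).
Proof.
move=> sf sg mf mg.
rewrite (_ : (fun x => _) = fun x => \det (\matrix_(i < b + a, j < b + a)
   match fintype.split i with inl k => ('X^k * f x)`_j | inr k => ('X^k * g x)`_j end)).
  apply: cmeasurable_det => i j.
  rewrite (_ : (fun x => _) = fun x => match fintype.split i with
     inl k => ('X^k * f x)`_j | inr k => ('X^k * g x)`_j end); last first.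
    by apply/funext => x; rewrite mxE.
  by case: (fintype.split i) => k; apply: pmeasurableM => //; exact: pmeasurable_cst.
apply/funext => x; rewrite /resultant.
have := @Sylvester_mxE _ (f x) (g x); move: (Sylvester_mx _ _).
rewrite sf sg /= => M ME; congr (\det _); apply/matrixP => i j.
by rewrite ME mxE; case: (fintype.split i) => k; rewrite coefXnM ltnNge if_neg -mulrb.
Qed.

End polynomial_measurable.

(** * Submatrices of the random matrix and their dependence on one entry *)

Section random_submatrix.
Variables (R : realType) (K : finType).
Local Notation C := R[i].
Local Notation S := (state R (K * bool)%type).
Implicit Types (t : S) (z : R * R).

(** Minors and their transposes are all read from one state by an injection [phi] of positions, so
    that inductions on the size keep the same measure. *)
Definition subm m m' (phi : 'I_m * 'I_m' -> K) t : 'M[C]_(m, m') :=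
  \matrix_(i, j) zc t (phi (i, j)).

Definition lift2 m m' (phi : 'I_m * 'I_m' -> K) i j (p : 'I_m.-1 * 'I_m'.-1) : K :=
  phi (lift i p.1, lift j p.2).

Lemma lift2_inj m m' (phi : 'I_m * 'I_m' -> K) i j :
  injective phi -> injective (lift2 phi i j).
Proof.
move=> iphi [a b] [a' b'] /iphi E.
by congr pair; [exact: (lift_inj (congr1 fst E))|exact: (lift_inj (congr1 snd E))].
Qed.

Lemma row'_col'_subm m m' (phi : 'I_m * 'I_m' -> K) i j t :
  row' i (col' j (subm phi t)) = subm (lift2 phi i j) t.
Proof. by apply/matrixP => a b; rewrite !mxE. Qed.

Lemma subm_free m m' (phi : 'I_m * 'I_m' -> K) k z t :
  (forall p, phi p != k) -> subm phi (updC k z t) = subm phi t.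
Proof.
by move=> ne; apply/matrixP => a b; rewrite !mxE zc_updC (negbTE (ne _)).
Qed.

Section shifted.
Variables (P : comNzRingType) (f : {rmorphism C -> P}) (m : nat).
Variables (phi : 'I_m * 'I_m -> K) (A : 'M[P]_m).
Hypothesis phi_inj : injective phi.
Let B t := A - map_mx f (subm phi t).

(** The morphism [f] is the identity for lambda - G and [polyC] for the characteristic matrix of G;
    one computation serves both. *)
Lemma cofactor_row_free i l j z t :
  cofactor (B (updC (phi (i, l)) z t)) i j = cofactor (B t) i j.
Proof.
congr (_ * \det _); apply/matrixP => a b; rewrite !mxE zc_updC.
case: eqP => // /phi_inj [/eqP]; by rewrite eq_sym (negbTE (neq_lift _ _)).
Qed.

Lemma cofactor_col_free i l j z t :
  cofactor (B (updC (phi (l, j)) z t)) i j = cofactor (B t) i j.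
Proof.
congr (_ * \det _); apply/matrixP => a b; rewrite !mxE zc_updC.
by case: eqP => // /phi_inj [_ /eqP]; rewrite eq_sym (negbTE (neq_lift _ _)).
Qed.

(** A determinant is affine in each entry with the cofactor as slope; the minus sign comes from
    subtracting the random matrix from A. *)
Lemma det_updC i j z t :
  \det (B (updC (phi (i, j)) z t)) =
  \det (B t) - f (toC z - zc t (phi (i, j))) * cofactor (B t) i j.
Proof.
rewrite (expand_det_row (B t) i) (expand_det_row (B (updC _ _ _)) i).
rewrite [in LHS](bigD1 j)//= [in RHS](bigD1 j)//= cofactor_row_free.
rewrite [X in _ + X = _](_ : _ =
    \sum_(l < m | l != j) B t i l * cofactor (B t) i l); last first.
  apply: eq_bigr => l lj; rewrite cofactor_row_free; congr (_ * _).
  by rewrite !mxE zc_updC; case: eqP => // /phi_inj [/eqP]; rewrite (negbTE lj).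
by rewrite !mxE zc_updC eqxx raddfB /=; ring.
Qed.

End shifted.

Lemma cmeasurable_subm m (phi : 'I_m * 'I_m -> K) (A : 'M[C]_m) i j :
  cmeasurable (fun t => (A - subm phi t) i j).
Proof.
rewrite (_ : (fun t => _) = fun t => A i j - zc t (phi (i, j))).
  by apply: cmeasurableB; [exact: cmeasurable_cst|exact: cmeasurable_zc].
by apply/funext => t; rewrite !mxE.
Qed.

Lemma pmeasurable_char_poly_mx m (phi : 'I_m * 'I_m -> K) i j :
  pmeasurable (fun t => char_poly_mx (subm phi t) i j).
Proof.
rewrite (_ : (fun t => _) = fun t => ('X%:M : 'M[{poly C}]_m) i j -
    (zc t (phi (i, j)))%:P).
  apply: pmeasurableB; first exact: pmeasurable_cst.
  move=> l; rewrite (_ : (fun t => _) = fun t => zc t (phi (i, j)) * (l == 0%N)%:R).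
    by apply: cmeasurableM; [exact: cmeasurable_zc|exact: cmeasurable_cst].
  by apply/funext => t; rewrite coefC; case: eqP => _; rewrite ?mulr1 ?mulr0.
by apply/funext => t; rewrite !mxE.
Qed.

Lemma pmeasurable_char_poly m (phi : 'I_m * 'I_m -> K) :
  pmeasurable (fun t => char_poly (subm phi t)).
Proof. by apply: pmeasurable_det => i j; exact: pmeasurable_char_poly_mx. Qed.

End random_submatrix.

Section almost_sure.
Variables (R : realType) (K : finType) (sigma : R).
Hypothesis sigma_gt0 : 0 < sigma.
Local Notation C := R[i].
Local Notation S := (state R (K * bool)%type).
Variable mu : {measure set S -> \bar R}.
Hypothesis mu_resampling : resampling sigma mu.

Lemma gauss_set1 (x : R) : gauss sigma [set x] = 0%E.
Proof.
rewrite /gauss /distribution /pushforward /=.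
have -> : toR (R := R) @^-1` [set x] = [set x] by [].
have /null_content_dominatesP := normal_prob_dominates (0 : R) sigma.
apply; [exact: measurable_set1|exact: lebesgue_measure_set1].
Qed.

Lemma measurable_toC_set1 (w : C) : measurable [set z | toC z = w].
Proof.
rewrite (_ : [set z | _] = [set complex.Re w] `*` [set complex.Im w]).
  by apply: measurableX; exact: measurable_set1.
apply/seteqP; split => [[a b] <-//|[a b] [/= -> ->]].
by case: w.
Qed.

Lemma cgauss_toC_set1 (w : C) : cgauss sigma [set z | toC z = w] = 0%E.
Proof.
rewrite (_ : [set z | _] = [set complex.Re w] `*` [set complex.Im w]); last first.
  apply/seteqP; split => [[a b] <-//|[a b] [/= -> ->]].
  by case: w.
transitivity (gauss sigma [set complex.Re w] * gauss sigma [set complex.Im w])%E.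
  by apply: product_measure1E; exact: measurable_set1.
by rewrite !gauss_set1 mul0e.
Qed.

Lemma cgauss_toC_seq (s : seq C) :
  measurable [set z | toC z \in s] /\ cgauss sigma [set z | toC z \in s] = 0%E.
Proof.
elim: s => [|w s [ms IH]].
  rewrite (_ : [set z | _] = set0) ?measure0//.
  by apply/seteqP; split.
have -> : [set z : R * R | toC z \in w :: s] =
    [set z | toC z = w] `|` [set z | toC z \in s].
  apply/seteqP; split => [z /=|z [/= ->|/= h]].
  - by rewrite inE => /orP[/eqP|]; [left|right].
  - by rewrite /= mem_head.
  - by rewrite /= inE h orbT.
have mw := measurable_toC_set1 w.
split; first exact: measurableU.
have : (cgauss sigma ([set z | toC z = w] `|` [set z | toC z \in s]) <=
    cgauss sigma [set z | toC z = w] + cgauss sigma [set z | toC z \in s])%E.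
  exact: measureU2.
by rewrite cgauss_toC_set1 IH add0e measure_le0 => /eqP.
Qed.

(** Redraw entry k: outside N the fibre of B lies in a finite set of complex numbers, which is Gauss
    null; over N the fibre has measure at most 1, and N is null. *)
Lemma negligible_resampling k (B N : set S) :
  measurable B -> measurable N -> mu N = 0%E ->
  (forall t, ~ N t -> exists s : seq C, forall z, B (updC k z t) -> toC z \in s) ->
  mu B = 0%E.
Proof.
move=> mB mN N0 h.
have := resampling_complex mu_resampling k (F := fun t => (\1_B t)%:E).
rewrite integral_indic// setIT => ->; last 2 first.
- by apply/measurable_EFinP; exact: measurable_indic.
- by move=> t; rewrite lee_fin.
have m1 : measurable_fun setT (fun p : S * (R * R) => (\1_B (updC k p.2 p.1))%:E : \bar R).
  apply/measurable_EFinP; apply: (measurableT_comp (measurable_indic mB)).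
  by apply: measurable_updC; [exact: measurable_snd|exact: measurable_fst].
apply/eqP; rewrite eq_le integral_ge0 ?andbT; last first.
  by move=> t _; apply: integral_ge0 => z _; rewrite lee_fin.
apply: (@le_trans _ _ (\int[mu]_t (\1_N t)%:E)%E); last first.
  by rewrite integral_indic// setIT N0.
apply: ge0_le_integral_nomeas => t.
  by apply: integral_ge0 => z _; rewrite lee_fin.
have [Nt|Nt] := pselect (N t).
  rewrite indicE mem_set//.
  apply: le_trans (_ : \int[cgauss sigma]_z 1%:E <= _)%E; last first.
    by rewrite integral_cst_probability.
  by apply: ge0_le_integral_nomeas => z; rewrite lee_fin indicE; case: (_ \in B).
have [s hs] := h _ Nt; have [ms s0] := cgauss_toC_seq s.
have -> : (\1_N t)%:E = 0%E :> \bar R by rewrite indicE memNset.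
rewrite -s0; have <- : (\int[cgauss sigma]_z (\1_[set z | toC z \in s] z)%:E =
    cgauss sigma [set z | toC z \in s])%E by rewrite integral_indic// setIT.
apply: ge0_le_integral_nomeas => z; rewrite ?lee_fin// !indicE.
have [/set_mem Bz|//] := boolP (updC k z t \in B).
by rewrite mem_set//=; exact: hs.
Qed.

End almost_sure.

Lemma cmeasurable_eq0 d (D : measurableType d) (R : realType) (f : D -> R[i]) :
  cmeasurable f -> measurable [set x | f x = 0].
Proof.
move=> mf; rewrite (_ : [set x | _] = (fun x => nrm (f x)) @^-1` [set 0]).
  rewrite -[X in measurable X]setTI; exact: (measurable_nrm mf measurableT (measurable_set1 0)).
apply/seteqP; split => x /=; first by move=> ->; rewrite nrm0.
by move=> /eqP; rewrite nrm_eq0 => /eqP.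
Qed.

(* A multiple root [r] of [p - c q] is a root of the Wronskian [p' q - p q'],
   which is nonzero, and [r] determines [c]: by [c = p r / q r] if [q r != 0], by
   [c = p' r / q' r] otherwise. *)
Lemma finite_inseparable_pencil (R : realType) (p q : {poly R[i]}) :
  p \is monic -> q \is monic -> size p = (size q).+1 -> coprimep q q^`() ->
  exists s : seq R[i], forall c, ~~ coprimep (p - c *: q) (p - c *: q)^`() -> c \in s.
Proof.
move=> mp mq spq cq.
pose W := p^`() * q - p * q^`().
have q0 : q != 0 by rewrite monic_neq0.
have W0 : W != 0.
  have sq : (0 < size q)%N by rewrite size_poly_gt0.
  set m := (size q).-1.
  have sqE : size q = m.+1 by rewrite prednK.
  have lcp : p`_m.+1 = 1 by have /monicP := mp; rewrite lead_coefE spq sqE.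
  have lcq : q`_m = 1 by have /monicP := mq; rewrite lead_coefE sqE.
  have lcp' : p^`()`_m = m.+1%:R by rewrite coef_deriv lcp.
  (* Here p and q are monic of degrees m + 1 and m, so in degree 2 m the product p' q has
     coefficient m + 1 and p q' has coefficient m. *)
  suff : W`_(m + m) != 0 by apply: contraNneq => ->; rewrite coef0.
  have E1 : (p^`() * q)`_(m + m) = m.+1%:R.
    rewrite coefM (bigD1 (inord m : 'I_(m + m).+1))//= inordK ?ltnS ?leq_addr//.
    rewrite addKn lcp' lcq mulr1 big1 ?addr0// => i im.
    have im' : i != m :> nat.
      by apply: contra im => /eqP E; apply/eqP/val_inj; rewrite /= inordK ?ltnS ?leq_addr.
    have [lim|lmi] := ltnP i m.
      by rewrite [q`_ _]nth_default ?mulr0// sqE; lia.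
    rewrite [p^`()`_i]coef_deriv [p`_ _]nth_default ?mul0rn ?mul0r// spq sqE.
    by move: im' lmi; lia.
  have E2 : (p * q^`())`_(m + m) = m%:R.
    rewrite coefM; have [m0|m0] := posnP m.
      rewrite m0; apply: big1 => i _.
      by rewrite coef_deriv [q`_ _]nth_default ?mul0rn ?mulr0// sqE m0.
    have lt : (m.+1 < (m + m).+1)%N by rewrite ltnS -addn1 leq_add2l.
    rewrite (bigD1 (Ordinal lt))//= lcp mul1r.
    have -> : (m + m - m.+1 = m.-1)%N by lia.
    rewrite coef_deriv prednK// lcq big1 ?addr0// => i im.
    have im' : i != m.+1 :> nat by apply: contra im => /eqP E; apply/eqP/val_inj.
    have [lim|lmi] := ltnP i m.+1.
      rewrite coef_deriv [q`_ _]nth_default ?mul0rn ?mulr0// sqE.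
      by have := ltn_ord i; lia.
    by rewrite [p`_i]nth_default ?mul0r// spq sqE; lia.
  by rewrite coefB E1 E2 -natrB ?leqnSn// subSnn oner_neq0.
have [rs Wrs] := closed_field_poly_normal W.
pose c r := if q.[r] != 0 then p.[r] / q.[r] else p^`().[r] / q^`().[r].
exists [seq c r | r <- rs] => x; rewrite /coprimep => nc.
have [r] : exists r, root (gcdp (p - x *: q) (p - x *: q)^`()) r.
  exact/closed_rootP.
rewrite root_gcd => /andP[/rootP r1 /rootP r2].
move: r1 r2; rewrite derivB derivZ !hornerE => r1 r2.
have pr : p.[r] = x * q.[r] by apply/eqP; rewrite -subr_eq0 r1.
have p'r : p^`().[r] = x * q^`().[r] by apply/eqP; rewrite -subr_eq0 r2.
have : root W r.
  by rewrite rootE /W !hornerE pr p'r; apply/eqP; ring.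
rewrite Wrs rootZ ?lead_coef_eq0// root_prod_XsubC => rrs.
apply/mapP; exists r => //; rewrite /c.
have [qr0|qr0] := eqVneq q.[r] 0; last by rewrite pr mulfK.
rewrite p'r mulfK//; apply: contraTneq cq => q'r0.
apply/coprimepP => /(_ ('X - r%:P)).
rewrite !dvdp_XsubCl !rootE qr0 q'r0 eqxx => /(_ isT isT).
by move=> /eqp_size; rewrite size_XsubC size_poly1.
Qed.

Section almost_sure_nondegeneracy.
Variables (R : realType) (K : finType) (sigma : R).
Local Notation C := R[i].
Local Notation S := (state R (K * bool)%type).
Variable mu : {measure set S -> \bar R}.
Hypothesis mu_resampling : resampling sigma mu.

(** Induction on the size: off a null set the minor without row and column 0 is nonzero, and the
    determinant, affine in entry (0, 0) with that slope, vanishes for a single value of the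
    entry. *)
Lemma det_shift_negligible m (phi : 'I_m * 'I_m -> K) (A : 'M[C]_m) :
  injective phi -> mu [set t | \det (A - subm phi t) = 0] = 0%E.
Proof.
elim: m phi A => [|m IH] phi A iphi.
  rewrite (_ : [set t | _] = set0) ?measure0//.
  by apply/seteqP; split => // t /=; rewrite det_mx00 => /eqP; rewrite oner_eq0.
pose N := [set t | \det (row' 0 (col' 0 A) - subm (lift2 phi 0 0) t) = 0].
have mdet k (psi : 'I_k * 'I_k -> K) (B : 'M[C]_k) :
    measurable [set t | \det (B - subm psi t) = 0].
  by apply: cmeasurable_eq0; apply: cmeasurable_det => i j; exact: cmeasurable_subm.
apply: (negligible_resampling mu_resampling (k := phi (0, 0)) (N := N)).
- exact: mdet.
- exact: mdet.
- exact: (IH (lift2 phi 0 0) _ (lift2_inj (i:=0) (j:=0) iphi)).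
move=> t Nt; pose q := cofactor (A - subm phi t) 0 0.
have q0 : q != 0.
  apply/eqP => /eqP; rewrite mulf_eq0 signr_eq0/= => /eqP h; apply: Nt; rewrite /N/= -h.
  by congr (\det _); apply/matrixP => a b; rewrite !mxE.
exists [:: zc t (phi (0, 0)) + \det (A - subm phi t) / q] => z /=.
have := det_updC idfun A iphi 0 0 z t.
rewrite !(map_mx_id (f := idfun) (fun=> erefl)) -/q => -> /eqP; rewrite subr_eq0 => /eqP h.
rewrite inE; apply/eqP; rewrite h mulfK//=.
by rewrite addrC subrK.
Qed.

(** As entry (0, 0) varies, the characteristic polynomial runs through the pencil p - c q, where q
    is the characteristic polynomial of the minor. By induction q is almost surely separable, and
    then finitely many c are bad. Measurability comes from the resultant of the polynomial with its
    derivative. *)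
Lemma inseparable_negligible m (phi : 'I_m * 'I_m -> K) :
  injective phi ->
  measurable [set t : S | ~~ coprimep (char_poly (subm phi t)) (char_poly (subm phi t))^`()] /\
  mu [set t : S | ~~ coprimep (char_poly (subm phi t)) (char_poly (subm phi t))^`()] = 0%E.
Proof.
elim: m phi => [|m IH] phi iphi.
  rewrite (_ : [set t | _] = set0) ?measure0//.
  apply/seteqP; split => // t /=.
  by rewrite /char_poly det_mx00 coprime1p.
have [mN N0] := IH _ (lift2_inj (i:=0) (j:=0) iphi).
set B := (X in measurable X /\ _).
have mB : measurable B.
  pose f (t : S) := char_poly (subm phi t).
  have sf' t : size (f t)^`() = m.+1.
    have sf : size (f t) = m.+2 by exact: size_char_poly.
    apply/eqP; rewrite eqn_leq -ltnS -sf lt_size_deriv ?monic_neq0 ?char_poly_monic//=.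
    rewrite ltnNge; apply/negP => /(nth_default 0) /eqP.
    rewrite coef_deriv; have /monicP := char_poly_monic (subm phi t).
    by rewrite lead_coefE -/(f t) sf /= => ->; rewrite pnatr_eq0.
  have mf : pmeasurable f by exact: pmeasurable_char_poly.
  rewrite (_ : B = [set t | resultant (f t) (f t)^`() = 0]).
    apply: cmeasurable_eq0; apply: cmeasurable_resultant => //.
    - by move=> t; exact: size_char_poly.
    - exact: pmeasurable_deriv.
  have fE t : ~~ coprimep (f t) (f t)^`() = (resultant (f t) (f t)^`() == 0).
    rewrite resultant_eq0 /coprimep neq_ltn ltnS leqn0 size_poly_eq0 gcdp_eq0.
    by rewrite (negbTE (monic_neq0 (char_poly_monic _))).
  by apply/seteqP; split => t; rewrite /B /= fE => /eqP.
split => //.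
apply: (negligible_resampling mu_resampling (k := phi (0, 0)) mB mN N0).
move=> t /negP; rewrite negbK => cq.
pose p := char_poly (subm phi t); pose q := char_poly (subm (lift2 phi 0 0) t).
have [s hs] := @finite_inseparable_pencil R p q (char_poly_monic _)
  (char_poly_monic _) (etrans (size_char_poly _) (congr1 succn (esym (size_char_poly _)))) cq.
exists [seq x + zc t (phi (0, 0)) | x <- s] => z /=.
have := det_updC (@polyC C) 'X%:M iphi 0 0 z t.
rewrite -/(char_poly_mx _) -/(char_poly _) -/(char_poly_mx _) -/(char_poly (subm phi t)).
have -> : cofactor (char_poly_mx (subm phi t)) 0 0 = q.
  rewrite /cofactor addn0 expr0 mul1r /q /char_poly; congr (\det _).
  apply/matrixP => a b; rewrite !mxE /lift2 /=.
  by rewrite (inj_eq (@lift_inj _ 0)).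
move=> E; rewrite /B /= E => h.
have /hs : ~~ coprimep (p - (toC z - zc t (phi (0, 0))) *: q)
   (p - (toC z - zc t (phi (0, 0))) *: q)^`() by rewrite -mul_polyC.
by move=> ?; apply/mapP; exists (toC z - zc t (phi (0, 0))) => //; rewrite subrK.
Qed.

End almost_sure_nondegeneracy.

(** * Delocalisation of the cofactor vector *)

(** For y < 1 take k with 2^-(k+1) <= y < 2^-k: then 1 / y <= 2^(k+1), while e exp(-4^k y^2) >= 1.
    Summed over k, this reduces the mean of 1 / |X| to Gaussian integrals. *)
Lemma inv_le_gaussian_sum (R : realType) (y : R) : 0 < y ->
  exists k, y^-1 <= 1 + 2 * expR 1 * 2 ^+ k * expR (- (4 ^+ k * y ^+ 2)).
Proof.
move=> y0; have [y1|y1] := leP 1 y.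
  exists 0%N; rewrite (le_trans (_ : _ <= 1)) ?invf_le1//.
  by rewrite lerDl !mulr_ge0 ?expR_ge0// exprn_ge0.
have ex : exists k, 1 <= 2 ^+ k.+1 * y.
  have y'0 : 0 <= y^-1 by rewrite invr_ge0 ltW.
  exists (Num.bound y^-1); rewrite -ler_pdivrMr// mul1r.
  rewrite (le_trans (ltW (archi_boundP y'0)))// -natrX ler_nat.
  by rewrite (leq_trans (ltnW (ltn_expl _ (isT : 1 < 2)%N)))// leq_exp2l.
case: (ex_minnP ex) => k hk kmin; exists k.
have ky : 2 ^+ k * y < 1.
  case: k hk kmin => [|k] hk kmin; first by rewrite mul1r.
  by rewrite ltNge; apply/negP => /kmin; rewrite ltnn.
have k0 : 0 < 2 ^+ k * y by rewrite mulr_gt0 ?exprn_gt0.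
have E : y^-1 <= 2 ^+ k.+1 by rewrite -[leLHS]mul1r ler_pdivrMr.
apply: (le_trans E); apply: ler_wpDl => //.
have -> x : 2 * expR 1 * 2 ^+ k * x = 2 * 2 ^+ k * (expR 1 * x) :> R by ring.
rewrite exprS ler_peMr ?mulr_ge0 ?exprn_ge0//.
rewrite -expRD -[leLHS]expR0 ler_expR subr_ge0.
have -> : 4 ^+ k * y ^+ 2 = (2 ^+ k * y) ^+ 2.
  have -> : (4 : R) = 2 ^+ 2 by rewrite -natrX.
  by rewrite [RHS]exprMn -!exprM mulnC.
by rewrite expr_le1 ?ltW.
Qed.

(** From x <= 1 + x^2 / 2. It dominates a first absolute moment by a Gaussian integral with negative
    parameter. *)
Lemma le_expR_sqr (R : realType) (x : R) : x <= expR (x ^+ 2 / 2).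
Proof.
apply: le_trans (expR_ge1Dx _).
have := sqr_ge0 (x - 1); rewrite sqrrB expr1n mulr1; lra.
Qed.

Section gaussian_ratio.
Variables (R : realType) (K : finType) (sigma : R).
Hypothesis sigma_gt0 : 0 < sigma.
Local Notation C := R[i].
Local Notation S := (state R (K * bool)%type).
Variable mu : {measure set S -> \bar R}.
Hypothesis mu1 : mu setT = 1%E.
Hypothesis mu_resampling : resampling sigma mu.
Variables (I : finType) (xi yi : I -> K) (d : I -> S -> C) (b : S -> C).
Hypotheses (xi_inj : injective xi) (yi_inj : injective yi).
Hypothesis xi_yi : forall i l, xi i != yi l.
Hypotheses (md : forall i, cmeasurable (d i)) (mb : cmeasurable b).
Hypotheses (d_xi : forall i l, free_of (xi i) (d l))
  (d_yi : forall i l, free_of (yi i) (d l)).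
Hypothesis b_xi : forall i, free_of (xi i) b.

(** Given the d_i, X and Y are centred complex Gaussians with common variance w, and a is the
    numerator in units of sqrt w. Where w = 0 the division convention gives a = 0. *)
Let w t := 2 * sigma ^+ 2 * \sum_i nrm (d i t) ^+ 2.
Let X t := \sum_i d i t * zc t (xi i).
Let Y t := \sum_i d i t * zc t (yi i).
Let a t := nrm (Y t - b t) / Num.sqrt (w t).

Let w_ge0 t : 0 <= w t.
Proof.
apply: mulr_ge0; first by rewrite mulr_ge0 ?sqr_ge0.
by apply: sumr_ge0 => i _; exact: sqr_ge0.
Qed.

Let w_eq0 t : w t = 0 -> forall i, d i t = 0.
Proof.
move=> /eqP; rewrite mulf_eq0 mulf_eq0 sqrf_eq0 (gt_eqF sigma_gt0).
rewrite (gt_eqF (ltr0n R 2)) /= psumr_eq0 => [/allP h i|i _]; last exact: sqr_ge0.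
have := h i (mem_index_enum _); rewrite sqrf_eq0 nrm_eq0 => /eqP//.
Qed.

Let mw : measurable_fun setT w.
Proof.
apply: measurable_funM => //; apply: measurable_sum => i.
by apply: measurable_funX; exact: measurable_nrm.
Qed.

Let mX : cmeasurable X.
Proof.
by apply: cmeasurable_sum => i; apply: cmeasurableM => //; exact: cmeasurable_zc.
Qed.

Let mY : cmeasurable Y.
Proof.
by apply: cmeasurable_sum => i; apply: cmeasurableM => //; exact: cmeasurable_zc.
Qed.

Let msqw : measurable_fun setT (fun t => (Num.sqrt (w t))^-1).
Proof.
apply: measurable_fun_inv; apply: measurableT_comp => //.
by apply: continuous_measurable_fun; exact: sqrt_continuous.
Qed.

Let ma : measurable_fun setT a.
Proof.
apply: measurable_funM => //; apply: measurable_nrm.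
exact: cmeasurableB.
Qed.

Let a_ge0 t : 0 <= a t.
Proof. by rewrite divr_ge0 ?nrm_ge0 ?sqrtr_ge0. Qed.

Let w_xi i : free_of (xi i) w.
Proof. by move=> z t; rewrite /w; under eq_bigr do rewrite d_xi. Qed.

Let w_yi i : free_of (yi i) w.
Proof. by move=> z t; rewrite /w; under eq_bigr do rewrite d_yi. Qed.

Let Y_xi i : free_of (xi i) Y.
Proof.
move=> z t; apply: eq_bigr => l _.
by rewrite d_xi zc_updC eq_sym (negbTE (xi_yi _ _)).
Qed.

Let a_xi i : free_of (xi i) a.
Proof. by move=> z t; rewrite /a Y_xi b_xi w_xi. Qed.

(** The k-th Gaussian of [inv_le_gaussian_sum] at y = |X| / sqrt w, multiplied by a. *)
Let term k t := a t * (2 * expR 1 * 2 ^+ k) *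
  expR (- (4 ^+ k / w t * nrm (X t) ^+ 2)).

Let term_ge0 k t : 0 <= term k t.
Proof.
rewrite /term mulr_ge0 ?expR_ge0//; apply: mulr_ge0; first exact: a_ge0.
by rewrite mulr_ge0 ?exprn_ge0// mulr_ge0 ?expR_ge0.
Qed.
Let mterm k : measurable_fun setT (term k).
Proof.
apply: measurable_funM; first exact: measurable_funM.
apply: measurableT_comp => //; apply: measurableT_comp => //.
apply: measurable_funM; last by apply: measurable_funX; exact: measurable_nrm.
by apply: measurable_funM => //; exact: measurable_fun_inv.
Qed.

Let ratio_le t :
  ((nrm (Y t - b t) / nrm (X t))%:E <= (a t)%:E + \sum_(k <oo) (term k t)%:E)%E.
Proof.
(* If X = 0 the quotient is 0 by convention, so only nonnegativity of the bound is at stake. *)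
have [X0|X0] := eqVneq (X t) 0.
  rewrite X0 nrm0 invr0 mulr0 adde_ge0 ?lee_fin//.
  by apply: nneseries_ge0 => k _ _; rewrite lee_fin.
have w0 : 0 < w t.
  rewrite lt_def w_ge0 andbT; apply: contra X0 => /eqP /w_eq0 d0.
  by apply/eqP; rewrite /X big1// => i _; rewrite d0 mul0r.
have sw0 : 0 < Num.sqrt (w t) by rewrite sqrtr_gt0.
have X1 : 0 < nrm (X t) by rewrite nrm_gt0.
have [k hk] := inv_le_gaussian_sum (divr_gt0 X1 sw0).
apply: (@le_trans _ _ ((a t)%:E + (term k t)%:E)%E).
  rewrite -EFinD lee_fin.
  have -> : a t + term k t = a t * (1 + 2 * expR 1 * 2 ^+ k *
      expR (- (4 ^+ k * (nrm (X t) / Num.sqrt (w t)) ^+ 2))).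
    rewrite /term [RHS]mulrDr mulr1 [X in _ = _ + X]mulrA.
    congr (_ + _ * expR (- _)).
    by rewrite expr_div_n sqr_sqrtr// [RHS]mulrA mulrAC.
  apply: le_trans (ler_wpM2l (a_ge0 t) hk).
  by rewrite /a invf_div mulrA divfK ?gt_eqF.
rewrite leeD2l// (nneseries_split _ k.+1) => [|i _]; last by rewrite lee_fin.
rewrite add0n big_mkord big_ord_recr/= -addeA addeC -addeA leeDl// adde_ge0//.
  by apply: nneseries_ge0 => i _ _; rewrite lee_fin.
by apply: sume_ge0 => i _; rewrite lee_fin.
Qed.

(** Integrating out X leaves 1 / (1 + 4^k) against 2 e 2^k, which is at most 2 e / 2^k. The form 4 e
    / 2^(k+1) makes the series over k sum to 4 e. *)
Let int_term k :
  (\int[mu]_t (term k t)%:E <= (4 * expR 1 / (2 ^ k.+1)%:R)%:E * \int[mu]_t (a t)%:E)%E.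
Proof.
have E t : expR (- (4 ^+ k / w t * nrm (X t) ^+ 2)) =
  expR (- (4 ^+ k / w t * nrm (X t - (fun=> 0) t) ^+ 2)) by rewrite subr0.
rewrite /term; under eq_integral do rewrite E /X.
have k0 : 0 <= 4 ^+ k :> R by rewrite exprn_ge0.
have pos t : 0 < 1 + 4 ^+ k / w t * w t.
  by rewrite ltr_wpDr// mulr_ge0// divr_ge0.
have A0 t : 0 <= a t * (2 * expR 1 * 2 ^+ k).
  apply: mulr_ge0; first exact: a_ge0.
  by rewrite mulr_ge0 ?exprn_ge0// mulr_ge0 ?expR_ge0.
rewrite (integral_gaussian_combination sigma_gt0 mu_resampling xi_inj
  (index_enum_uniq I) (A := fun t => a t * (2 * expR 1 * 2 ^+ k))
  (s := fun t => 4 ^+ k / w t) (b := fun=> 0) (c := d))//.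
- have mEa : measurable_fun setT (EFin \o a) by exact/measurable_EFinP.
  have e0 : (0 <= (4 * expR 1 / (2 ^ k.+1)%:R : R)%:E)%E.
    by rewrite lee_fin divr_ge0 ?mulr_ge0 ?expR_ge0.
  have Ea0 t : setT t -> (0 <= (EFin \o a) t)%E by rewrite lee_fin.
  rewrite -(ge0_integralZl _ measurableT mEa Ea0 e0).
  apply: ge0_le_integral_nomeas => t; rewrite -?[(EFin \o a) t]/((a t)%:E) -?EFinM lee_fin -/(w t).
    apply: mulr_ge0; rewrite ?expR_ge0//; apply: divr_ge0; last exact/ltW/pos.
    exact: A0.
  rewrite nrm0 expr0n /= mulr0 mul0r oppr0 expR0 mulr1.
  have [w0|w0] := eqVneq (w t) 0.
    by rewrite /a w0 sqrtr0 invr0 mulr0 !mul0r mulr0.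
  rewrite divfK// -[leLHS]mulrA [leRHS]mulrC; apply: ler_wpM2l; first exact: a_ge0.
  rewrite natrX exprS.
  have k1 : 0 < 1 + 4 ^+ k :> R by rewrite ltr_wpDr.
  rewrite ler_pdivrMr//.
  have -> : 4 * expR 1 / (2 * 2 ^+ k) = 2 * expR 1 / 2 ^+ k :> R.
    by field; rewrite expf_neq0 ?pnatr_eq0.
  rewrite mulrDr mulr1; apply: ler_wpDl.
    by rewrite divr_ge0 ?mulr_ge0 ?expR_ge0 ?exprn_ge0.
  have -> : 4 ^+ k = 2 ^+ k * 2 ^+ k :> R by rewrite -exprMn; congr (_ ^+ _); ring.
  rewrite le_eqVlt; apply/orP; left; apply/eqP; field.
  by rewrite expf_neq0 ?pnatr_eq0.
- exact: measurable_funM.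
- by apply: measurable_funM => //; exact: measurable_fun_inv.
- move=> i _; split=> [z t|z t|//|l _]; last exact: d_xi.
    by rewrite a_xi.
  by rewrite w_xi.
Qed.

(** By [le_expR_sqr], |Y| / sqrt w is at most exp(|Y|^2 / (2 w)). This is the Gaussian integral with
    s = -1 / (2 w), so s w = -1/2 and its value is 1 / (1 - 1/2) = 2, or 1 where w = 0. *)
Let int_a : (\int[mu]_t (a t)%:E <=
  2%:E + \int[mu]_t (nrm (b t) / Num.sqrt (w t))%:E)%E.
Proof.
have mbw : measurable_fun setT (fun t => (nrm (b t) / Num.sqrt (w t))%:E).
  by apply/measurable_EFinP; apply: measurable_funM => //; exact: measurable_nrm.
pose s t := - (2 * w t)^-1.
have ms : measurable_fun setT s.
  apply: measurableT_comp => //; apply: measurable_fun_inv.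
  exact: measurable_funM.
have sw t : s t * w t = if w t == 0 then 0 else - 2^-1.
  have [->|w0] := eqVneq (w t) 0; first by rewrite mulr0.
  by rewrite /s mulNr invfM divfK.
pose g t := expR (- (s t * nrm (Y t - (fun=> 0) t) ^+ 2)).
have mg : measurable_fun setT (fun t => (g t)%:E).
  apply/measurable_EFinP; apply: measurableT_comp => //; apply: measurableT_comp => //.
  apply: measurable_funM => //; apply: measurable_funX; apply: measurable_nrm.
  by apply: cmeasurableB => //; exact: cmeasurable_cst.
apply: (@le_trans _ _ (\int[mu]_t ((g t)%:E + (nrm (b t) / Num.sqrt (w t))%:E))%E).
  apply: ge0_le_integral_nomeas => t; first by rewrite lee_fin; exact: a_ge0.
  rewrite -EFinD lee_fin.
  apply: (@le_trans _ _ (nrm (Y t) / Num.sqrt (w t) + nrm (b t) / Num.sqrt (w t))).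
    by rewrite -mulrDl ler_wpM2r ?invr_ge0 ?sqrtr_ge0 ?nrmB.
  rewrite lerD2r /g subr0 (le_trans (le_expR_sqr _))// ler_expR.
  rewrite /s mulNr opprK expr_div_n sqr_sqrtr//.
  by rewrite (invfM 2) [leRHS]mulrC [2^-1 * _]mulrC mulrA.
have g0 t : setT t -> (0 <= (g t)%:E)%E by rewrite lee_fin expR_ge0.
have bw0 t : setT t -> (0 <= (nrm (b t) / Num.sqrt (w t))%:E)%E.
  by rewrite lee_fin divr_ge0 ?nrm_ge0 ?sqrtr_ge0.
rewrite (ge0_integralD _ measurableT g0 mg bw0 mbw) leeD2r//.
have pos t : 0 < 1 + s t * w t.
  rewrite sw; case: ifP => _; first by rewrite addr0.
  lra.
have E t : (g t)%:E = (1 * expR (- (s t * nrm (Y t - (fun=> 0) t) ^+ 2)))%:E.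
  by rewrite mul1r.
under eq_integral do rewrite E /Y.
rewrite (integral_gaussian_combination sigma_gt0 mu_resampling yi_inj
  (index_enum_uniq I) (A := fun t => 1) (s := s) (b := fun=> 0) (c := d))//.
- apply: (@le_trans _ _ (\int[mu]_t 2%:E)%E); last first.
    by rewrite integral_cst// mu1 mule1.
  apply: ge0_le_integral_nomeas => t; rewrite lee_fin -/(w t).
    by rewrite mulr_ge0 ?expR_ge0// divr_ge0 ?ltW.
  rewrite nrm0 expr0n /= mulr0 mul0r oppr0 expR0 mulr1 sw.
  case: ifP => _; first by rewrite addr0 divr1 ler1n.
  have -> : 1 - 2^-1 = 2^-1 :> R by field.
  by rewrite invrK mul1r.
- move=> i _; split=> [//|z t|//|l _]; last exact: d_yi.
  by rewrite /s w_yi.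
Qed.

(** E a plus the bounds (4 e / 2^(k+1)) E a of the terms gives (1 + 4 e) E a, whence the
    constant. *)
Lemma expected_gaussian_ratio :
  (\int[mu]_t (nrm (Y t - b t) / nrm (X t))%:E <=
   (1 + 4 * expR 1)%:E *
     (2%:E + \int[mu]_t (nrm (b t) / Num.sqrt (w t))%:E))%E.
Proof.
have I0 : (0 <= \int[mu]_t (a t)%:E)%E by apply: integral_ge0 => t _; rewrite lee_fin.
apply: le_trans (lee_wpmul2l _ int_a); last by rewrite lee_fin addr_ge0 ?mulr_ge0 ?expR_ge0.
rewrite EFinD ge0_muleDl ?lee_fin ?mulr_ge0 ?expR_ge0// mul1e.
have mS : measurable_fun setT (fun t => (\sum_(k <oo) (term k t)%:E)%E).
  apply: ge0_emeasurable_sum => [k t _ _|k _]; first by rewrite lee_fin.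
  exact/measurable_EFinP.
apply: (@le_trans _ _ (\int[mu]_t ((a t)%:E + \sum_(k <oo) (term k t)%:E))%E).
  apply: ge0_le_integral_nomeas => t; last exact: ratio_le.
  by rewrite lee_fin divr_ge0 ?nrm_ge0.
have mEa : measurable_fun setT (fun t => (a t)%:E) by exact/measurable_EFinP.
have Ea0 t : setT t -> (0 <= (a t)%:E)%E by move=> _; rewrite lee_fin; exact: a_ge0.
have S0 t : setT t -> (0 <= \sum_(k <oo) (term k t)%:E)%E.
  by move=> _; apply: nneseries_ge0 => k _ _; rewrite lee_fin; exact: term_ge0.
rewrite (ge0_integralD _ measurableT Ea0 mEa S0 mS) leeD2l//.
rewrite integral_nneseries//; last 2 first.
- by move=> k; exact/measurable_EFinP.
- by move=> k t _; rewrite lee_fin; exact: term_ge0.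
apply: (@le_trans _ _ (\sum_(k <oo)
    ((4 * expR 1 / (2 ^ k.+1)%:R)%:E * \int[mu]_t (a t)%:E))%E).
  apply: lee_nneseries => [k _ _|k _]; last exact: int_term.
  by apply: integral_ge0 => t _; rewrite lee_fin; exact: term_ge0.
have e40 : 0 < 4 * expR 1 :> R by rewrite mulr_gt0 ?expR_gt0.
have [Ifin|] := boolP ((\int[mu]_t (a t)%:E)%E \is a fin_num); last first.
  by rewrite ge0_fin_numE// -leNgt leye_eq => /eqP ->; rewrite gt0_muley ?leey ?lte_fin.
rewrite -(fineK Ifin); under eq_eseriesr do rewrite muleC.
rewrite nneseriesZl => [|k _]; last by rewrite lee_fin divr_ge0 ?mulr_ge0 ?expR_ge0.
rewrite muleC lee_wpmul2r//; first by rewrite lee_fin fine_ge0.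
by apply: (epsilon_trick0 xpredT); rewrite ltW.
Qed.

End gaussian_ratio.

(** Jensen's inequality for the convex function u^(-1/2) at u = x_i^2, through its tangent line at
    the mean square s^2. *)
Lemma sumr_inv_tangent (R : realType) (I : finType) (x : I -> R) :
  (forall i, 0 < x i) -> (0 < #|I|)%N ->
  #|I|%:R * Num.sqrt #|I|%:R / Num.sqrt (\sum_i x i ^+ 2) <= \sum_i (x i)^-1.
Proof.
move=> x0 I0; pose N : R := #|I|%:R; rewrite -/N.
have N0 : 0 < N by rewrite ltr0n.
have S0 : 0 < \sum_i x i ^+ 2.
  have [i _] : exists i : I, i \in I by exact/card_gt0P.
  rewrite (bigD1 i)//= ltr_wpDr ?exprn_gt0// sumr_ge0// => j _.
  exact: sqr_ge0.
pose s := Num.sqrt ((\sum_i x i ^+ 2) / N).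
have s0 : 0 < s by rewrite sqrtr_gt0 divr_gt0.
have tangent i : 3 / (2 * s) - x i ^+ 2 / (2 * s ^+ 3) <= (x i)^-1.
  rewrite -subr_ge0.
  have -> : (x i)^-1 - (3 / (2 * s) - x i ^+ 2 / (2 * s ^+ 3)) =
     (x i - s) ^+ 2 * (x i + 2 * s) / (2 * s ^+ 3 * x i).
    by field; rewrite !gt_eqF.
  rewrite divr_ge0//; first by rewrite mulr_ge0 ?sqr_ge0// ltW// addr_gt0 ?mulr_gt0.
  by rewrite ltW// !mulr_gt0 ?exprn_gt0.
apply: le_trans (ler_sum _ (fun i _ => tangent i)).
have -> : \sum_i (3 / (2 * s) - x i ^+ 2 / (2 * s ^+ 3)) =
    3 / (2 * s) * N - (\sum_i x i ^+ 2) / (2 * s ^+ 3).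
  by rewrite sumrB sumr_const mulr_suml -[X in X - _]mulr_natr.
have sE : \sum_i x i ^+ 2 = N * s ^+ 2.
  by rewrite sqr_sqrtr ?divr_ge0 ?ltW// mulrC divfK ?gt_eqF.
rewrite sE (sqrtrM _ (ltW N0)) sqrtr_sqr gtr0_norm//.
have sN0 : 0 < Num.sqrt N by rewrite sqrtr_gt0.
have E (a b : R) : a = b -> a <= b by move=> ->.
by apply: E; field; rewrite !gt_eqF.
Qed.

(** * Cofactors along one row *)

Section cofactor_row.
Variable R : realType.
Local Notation C := R[i].

Lemma nrm_signM n (z : C) : nrm ((-1) ^+ n * z) = nrm z.
Proof. by rewrite nrmM nrm_signr mul1r. Qed.

Lemma nrm_cofactor_diag m (A : 'M[C]_m.+2) j l :
  nrm (cofactor A j j) =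
  nrm (\sum_i row' j (col' j A) i l * cofactor (row' j (col' j A)) i l).
Proof. by rewrite nrm_signM (expand_det_col _ l). Qed.

Lemma lift_lift_swap m (j l : 'I_m.+2) (l' p : 'I_m.+1) (b : 'I_m) :
  lift j l' = l -> lift l p = j -> lift l (lift p b) = lift j (lift l' b).
Proof.
move=> /(congr1 val) /= e1 /(congr1 val) /= e2; apply: val_inj => /=.
move: e1 e2; rewrite /bump.
lia.
Qed.

(** Expand the minor along what remains of column j, at position p. Deleting the two columns in
    either order leaves the same smaller minor ([lift_lift_swap]), so both expansions differ by the
    sign (-1)^(l + p). *)
Lemma nrm_cofactor_offdiag m (A : 'M[C]_m.+2) j l :
  nrm (cofactor A j (lift j l)) =
  nrm (\sum_i A (lift j i) j * cofactor (row' j (col' j A)) i l).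
Proof.
have [p jE _] := unlift_some (negbT (introF eqP (fun e : lift j l = j =>
  negP (neq_lift j l) (introT eqP (esym e))))).
rewrite nrm_signM (expand_det_col _ p).
have -> : \sum_i A (lift j i) j * cofactor (row' j (col' j A)) i l =
    (-1) ^+ (l + p) * \sum_i row' j (col' (lift j l) A) i p *
      cofactor (row' j (col' (lift j l) A)) i p.
  rewrite mulr_sumr; apply: eq_bigr => i _; rewrite [RHS]mulrCA; congr (_ * _).
    by rewrite !mxE -jE.
  rewrite /cofactor [RHS]mulrA -exprD.
  have -> : row' i (col' p (row' j (col' (lift j l) A))) =
            row' i (col' l (row' j (col' j A))).
    apply/matrixP => a b; rewrite !mxE; congr (A _ _).
    exact: (lift_lift_swap _ erefl (esym jE)).
  congr (_ * _); rewrite -signr_odd -[RHS]signr_odd !oddD.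
  by case: (odd i); case: (odd l); case: (odd p).
by rewrite nrm_signM.
Qed.

(** The cofactors of row j are orthogonal to all other rows, up to conjugation; if they do not all
    vanish, this is the modulus of the j-th coordinate of the unit normal to those rows. *)
Definition rowratio m (A : 'M[C]_m) j :=
  nrm (cofactor A j j) / Num.sqrt (\sum_l nrm (cofactor A j l) ^+ 2).

Lemma rowratio_ge0 m (A : 'M[C]_m) j : 0 <= rowratio A j.
Proof. by rewrite divr_ge0 ?nrm_ge0 ?sqrtr_ge0. Qed.

Lemma rowratio_le1 m (A : 'M[C]_m) j : rowratio A j <= 1.
Proof.
rewrite /rowratio; set D := \sum_l _.
have h : nrm (cofactor A j j) ^+ 2 <= D.
  by rewrite /D (bigD1 j)//= lerDl sumr_ge0// => l _; exact: sqr_ge0.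
have [D0|D0] := eqVneq D 0; first by rewrite D0 sqrtr0 invr0 mulr0.
have D1 : 0 < D by rewrite lt_def D0 (le_trans _ h)// sqr_ge0.
rewrite ler_pdivrMr ?sqrtr_gt0// mul1r -(ger0_norm (nrm_ge0 _)) -sqrtr_sqr.
by rewrite ler_wsqrtr.
Qed.

(** Dropping q_jj from the norm and applying [sumr_inv_tangent] replaces the norm of the row by
    single cofactors, so that each summand is a ratio of two Gaussian combinations. *)
Lemma rowratio_le_sum m (A : 'M[C]_m.+2) j :
  (forall l, cofactor A j (lift j l) != 0) ->
  rowratio A j <= (m.+1%:R * Num.sqrt m.+1%:R)^-1 *
    \sum_l nrm (cofactor A j j) / nrm (cofactor A j (lift j l)).
Proof.
move=> c0; pose x (l : 'I_m.+1) := nrm (cofactor A j (lift j l)).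
have x0 l : 0 < x l by rewrite nrm_gt0.
have := sumr_inv_tangent x0; rewrite card_ord => /(_ isT) h.
have N0 : 0 < m.+1%:R :> R by rewrite ltr0n.
have M0 : 0 < m.+1%:R * Num.sqrt m.+1%:R :> R by rewrite mulr_gt0 ?sqrtr_gt0.
rewrite -mulr_sumr mulrCA ler_wpM2l ?nrm_ge0//.
rewrite mulrC ler_pdivlMr// mulrC (le_trans _ h)// ler_pM2l//.
have S0 : 0 < \sum_i x i ^+ 2.
  rewrite (bigD1 ord0)//= ltr_wpDr ?exprn_gt0// sumr_ge0// => i _.
  exact: sqr_ge0.
rewrite lef_pV2 ?posrE ?sqrtr_gt0//.
  rewrite ler_wsqrtr// (bigD1_ord j)//= lerDr; exact: sqr_ge0.
by rewrite (bigD1_ord j)//= ltr_wpDl ?sqr_ge0.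
Qed.

End cofactor_row.

(** * Recursion on the size for the expected normal coordinate *)

Section delocalisation.
Variables (R : realType) (K : finType) (sigma : R).
Hypothesis sigma_gt0 : 0 < sigma.
Local Notation C := R[i].
Local Notation S := (state R (K * bool)%type).
Variable mu : {measure set S -> \bar R}.
Hypothesis mu1 : mu setT = 1%E.
Hypothesis mu_resampling : resampling sigma mu.
Variable lam : C.

Let shifted m (phi : 'I_m * 'I_m -> K) (t : S) : 'M[C]_m := lam%:M - subm phi t.

Let mshifted m (phi : 'I_m * 'I_m -> K) i j : cmeasurable (fun t => shifted phi t i j).
Proof. exact: cmeasurable_subm. Qed.

Let mcof m (phi : 'I_m * 'I_m -> K) i j :
  cmeasurable (fun t => cofactor (shifted phi t) i j).
Proof. by apply: cmeasurable_cofactor => *; exact: mshifted. Qed.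

Lemma measurable_rowratio m (phi : 'I_m * 'I_m -> K) j :
  measurable_fun setT (fun t => rowratio (shifted phi t) j).
Proof.
apply: measurable_funM; first exact: measurable_nrm.
apply: measurable_fun_inv; apply: measurableT_comp.
  by apply: continuous_measurable_fun; exact: sqrt_continuous.
by apply: measurable_sum => l; apply: measurable_funX; exact: measurable_nrm.
Qed.

Lemma cofactor_negligible m (phi : 'I_m.+1 * 'I_m.+1 -> K) i j : injective phi ->
  mu [set t | cofactor (shifted phi t) i j = 0] = 0%E.
Proof.
move=> iphi.
rewrite (_ : [set t | _] = [set t |
    \det (row' i (col' j lam%:M) - subm (lift2 phi i j) t) = 0]).
  by apply: (det_shift_negligible mu_resampling); exact: (lift2_inj (i := i) (j := j) iphi).
have E t : \det (row' i (col' j lam%:M) - subm (lift2 phi i j) t) =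
    \det (row' i (col' j (shifted phi t))).
  by congr (\det _); apply/matrixP => a b; rewrite !mxE.
apply/seteqP; split => t /=; rewrite E => /eqP.
  by rewrite mulf_eq0 signr_eq0 => /eqP.
by move=> /eqP e; rewrite /cofactor e mulr0.
Qed.

(** Uniformity over all injections matters: the induction applies the bound to the transpose of a
    principal minor. *)
Definition rowratio_bound m (B : R) := forall (phi : 'I_m * 'I_m -> K) j,
  injective phi -> (\int[mu]_t (rowratio (lam%:M - subm phi t) j)%:E <= B%:E)%E.

Lemma rowratio_bound1 m : rowratio_bound m 1.
Proof.
move=> phi j _; apply: (@le_trans _ _ (\int[mu]_t 1%:E)%E).
  apply: ge0_le_integral_nomeas => t; rewrite lee_fin ?rowratio_ge0//.
  exact: rowratio_le1.
by rewrite integral_cst// mul1e mu1.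
Qed.

Let Kc : R := 1 + 4 * expR 1.

(** Both cofactors are combinations with coefficients d_i. The denominator uses column j without its
    diagonal entry, hence only matrix entries; the numerator meets lambda once, in the diagonal
    entry of column l, hence the shift b = lambda d_l. *)
Let ratio_bound m B (phi : 'I_m.+2 * 'I_m.+2 -> K) j (l : 'I_m.+1) :
  rowratio_bound m.+1 B -> injective phi ->
  (\int[mu]_t (nrm (cofactor (shifted phi t) j j) /
               nrm (cofactor (shifted phi t) j (lift j l)))%:E <=
   (Kc * (2 + nrm lam / Num.sqrt (2 * sigma ^+ 2) * B))%:E)%E.
Proof.
move=> hB iphi; pose psi := lift2 phi j j.
have ipsi : injective psi := lift2_inj (i := j) (j := j) iphi.
pose d i t := cofactor (shifted psi t) i l.
pose b t := lam * d l t.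
pose xi i := phi (lift j i, j).
pose yi i := psi (i, l).
have minorE t : row' j (col' j (shifted phi t)) = shifted psi t.
  by apply/matrixP => p q; rewrite !mxE (inj_eq lift_inj).
have jl i : (lift j i == j) = false by rewrite eq_sym (negbTE (neq_lift _ _)).
have d_xi i p : free_of (xi i) (d p).
  move=> z t; rewrite /d /shifted subm_free// => -[a c]; apply/eqP.
  by move=> /iphi /(congr1 snd) /= /eqP; rewrite jl.
have d_yi i p : free_of (yi i) (d p).
  move=> z t; have := cofactor_col_free idfun lam%:M ipsi p i l z t.
  by rewrite !(map_mx_id (f := idfun) (fun=> erefl)).
have ratioE t : nrm (cofactor (shifted phi t) j j) /
     nrm (cofactor (shifted phi t) j (lift j l)) =
   nrm (\sum_i d i t * zc t (yi i) - b t) / nrm (\sum_i d i t * zc t (xi i)).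
  rewrite (nrm_cofactor_diag _ _ l) nrm_cofactor_offdiag minorE.
  congr (_ / _).
    rewrite -[RHS]nrmN opprB; congr nrm.
    rewrite (bigD1 l)//= [in RHS](bigD1 l)//= !mxE eqxx /b /d.
    rewrite [X in _ + X = _](_ : _ = - \sum_(i < m.+1 | i != l)
        cofactor (shifted psi t) i l * zc t (yi i)).
      by rewrite mulr1n -/(yi l); ring.
    rewrite -sumrN; apply: eq_bigr => i il.
    by rewrite !mxE (negbTE il) mulr0n sub0r mulNr mulrC.
  rewrite -[LHS]nrmN; congr nrm; rewrite -sumrN; apply: eq_bigr => i _.
  by rewrite !mxE jl mulr0n sub0r mulNr opprK mulrC.
under eq_integral do rewrite ratioE.
have xi_inj : injective xi by move=> i i' /iphi /(congr1 fst) /= /lift_inj.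
have yi_inj : injective yi by move=> i i' /ipsi /(congr1 fst).
have xi_yi i i' : xi i != yi i'.
  by apply/eqP => /iphi /(congr1 snd) /= /eqP; rewrite eq_sym jl.
have md i : cmeasurable (d i) by exact: mcof.
have mb : cmeasurable b by apply: cmeasurableM => //; exact: cmeasurable_cst.
have b_xi i : free_of (xi i) b by move=> z t; rewrite /b d_xi.
have := expected_gaussian_ratio sigma_gt0 mu1 mu_resampling xi_inj yi_inj xi_yi
  md mb d_xi d_yi b_xi.
move=> /le_trans; apply.
rewrite -/Kc EFinM; apply: lee_wpmul2l.
  by rewrite lee_fin addr_ge0 ?mulr_ge0 ?expR_ge0.
rewrite [leRHS]EFinD leeD2l// [leRHS]EFinM.
(* The d_i are the cofactors of a column of the minor. After transposition they form a row, and |b|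
   / sqrt w is |lambda| / sqrt(2 sigma^2) times the [rowratio] of the transpose. *)
pose phiT p := psi (p.2, p.1).
have iphiT : injective phiT by move=> [a c] [a' c'] /ipsi [-> ->].
have c0 : 0 <= nrm lam / Num.sqrt (2 * sigma ^+ 2).
  by rewrite divr_ge0 ?nrm_ge0 ?sqrtr_ge0.
apply: le_trans (lee_wpmul2l _ (hB phiT l iphiT)); last by rewrite lee_fin.
have mr : measurable_fun setT (fun t => (rowratio (shifted phiT t) l)%:E).
  by apply/measurable_EFinP; exact: measurable_rowratio.
have r0 t : setT t -> (0 <= (rowratio (shifted phiT t) l)%:E)%E.
  by rewrite lee_fin rowratio_ge0.
rewrite -(ge0_integralZl _ measurableT mr r0) ?lee_fin//.
apply: ge0_le_integral_nomeas => t; rewrite -?EFinM lee_fin.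
  by rewrite divr_ge0 ?nrm_ge0 ?sqrtr_ge0.
have dT i : cofactor (shifted phiT t) l i = d i t.
  rewrite /d -cofactor_tr; congr cofactor.
  by apply/matrixP => a c; rewrite !mxE eq_sym.
rewrite /rowratio dT; under [X in _ <= _ * (_ / Num.sqrt X)]eq_bigr do rewrite dT.
have v0 : 0 <= 2 * sigma ^+ 2 by rewrite mulr_ge0 ?sqr_ge0.
rewrite /b nrmM (sqrtrM _ v0) invfM le_eqVlt; apply/orP; left.
by apply/eqP; rewrite mulrACA.
Qed.

(** The m + 1 ratios have a common bound, and the prefactor (m + 1)^(-3/2) of [rowratio_le_sum]
    leaves (m + 1)^(-1/2). *)
Lemma rowratio_step m B : rowratio_bound m.+1 B -> rowratio_bound m.+2
  (Kc * (2 + nrm lam / Num.sqrt (2 * sigma ^+ 2) * B) / Num.sqrt m.+1%:R).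
Proof.
move=> hB phi j iphi; pose A t := shifted phi t.
pose N : R := m.+1%:R * Num.sqrt m.+1%:R.
have N0 : 0 < N by rewrite mulr_gt0 ?sqrtr_gt0 ?ltr0n.
pose q (l : 'I_m.+1) t := nrm (cofactor (A t) j j) / nrm (cofactor (A t) j (lift j l)).
pose E (l : 'I_m.+1) := [set t | cofactor (A t) j (lift j l) = 0].
have mE l : measurable (E l) by apply: cmeasurable_eq0; exact: mcof.
have q0 l t : 0 <= q l t by rewrite divr_ge0 ?nrm_ge0.
have mq l : measurable_fun setT (q l).
  apply: measurable_funM; first by apply: measurable_nrm; exact: mcof.
  by apply: measurable_fun_inv; apply: measurable_nrm; exact: mcof.
apply: (@le_trans _ _
    (\int[mu]_t (\sum_(l < m.+1) ((N^-1 * q l t)%:E + (\1_(E l) t)%:E)))%E).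
  apply: ge0_le_integral_nomeas => t; first by rewrite lee_fin rowratio_ge0.
  (* If some off-diagonal cofactor vanishes, its zero quotient would spoil the sum; the trivial
     bound 1 is then paid for by the indicator of a null set. *)
  have [[l El]|nE] := pselect (exists l, E l t).
    apply: (@le_trans _ _ 1%:E); first by rewrite lee_fin rowratio_le1.
    rewrite (bigD1 l)//= indicE mem_set//.
    apply: (@le_trans _ _ ((N^-1 * q l t)%:E + 1%:E)%E).
      by rewrite -EFinD lee_fin lerDr mulr_ge0 ?invr_ge0 ?(ltW N0).
    rewrite leeDl// sume_ge0// => i _.
    by rewrite -EFinD lee_fin addr_ge0// mulr_ge0 ?invr_ge0 ?(ltW N0).
  apply: (@le_trans _ _ (\sum_(l < m.+1) (N^-1 * q l t)%:E)%E).
    rewrite sumEFin lee_fin -mulr_sumr; apply: rowratio_le_sum => l.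
    by apply/eqP => El; apply: nE; exists l.
  by apply: lee_sum => l _; rewrite leeDl// lee_fin.
rewrite ge0_integral_sum//; last 2 first.
- move=> l; apply: emeasurable_funD; apply/measurable_EFinP.
    exact: measurable_funM.
  exact: measurable_indic.
- by move=> l t _; rewrite -EFinD lee_fin addr_ge0// mulr_ge0 ?invr_ge0 ?(ltW N0).
have NE : Kc * (2 + nrm lam / Num.sqrt (2 * sigma ^+ 2) * B) / Num.sqrt m.+1%:R =
    \sum_(l < m.+1) N^-1 * (Kc * (2 + nrm lam / Num.sqrt (2 * sigma ^+ 2) * B)).
  rewrite sumr_const card_ord -[RHS]mulr_natr /N invfM.
  have E' (n s x : R) : n != 0 -> x * s = n^-1 * s * x * n by move=> n0; field.
  by apply: E'; rewrite pnatr_eq0.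
rewrite NE -sumEFin; apply: lee_sum => l _.
have mNq : measurable_fun setT (fun t => (N^-1 * q l t)%:E).
  by apply/measurable_EFinP; exact: measurable_funM.
have mEi : measurable_fun setT (fun t => (\1_(E l) t : R)%:E).
  by apply/measurable_EFinP; exact: measurable_indic.
have Nq0 t : setT t -> (0 <= (N^-1 * q l t)%:E)%E.
  by rewrite lee_fin mulr_ge0 ?invr_ge0 ?(ltW N0).
have i0 t : setT t -> (0 <= (\1_(E l) t : R)%:E)%E by rewrite lee_fin.
rewrite (ge0_integralD _ measurableT Nq0 mNq i0 mEi).
rewrite integral_indic// setIT cofactor_negligible// adde0.
under eq_integral do rewrite EFinM.
have mqE : measurable_fun setT (fun t => (q l t)%:E) by exact/measurable_EFinP.
have qE0 t : setT t -> (0 <= (q l t)%:E)%E by rewrite lee_fin.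
rewrite (ge0_integralZl _ measurableT mqE qE0) ?lee_fin ?invr_ge0 ?(ltW N0)//.
rewrite EFinM lee_wpmul2l ?lee_fin ?invr_ge0 ?(ltW N0)//.
exact: ratio_bound.
Qed.

End delocalisation.

Lemma measurable_neq0 d (D : measurableType d) (R : realType) (f : D -> R[i]) :
  cmeasurable f -> measurable_fun setT (fun x => (f x != 0)%:R : R).
Proof.
move=> mf; rewrite (_ : (fun x => _) = \1_(~` [set x | f x = 0])).
  by apply: measurable_indic; apply: measurableC; exact: cmeasurable_eq0.
apply/funext => x; rewrite indicE; congr ((nat_of_bool _)%:R).
apply/idP/idP => [/eqP h|/set_mem /= h]; [exact: mem_set|exact/eqP].
Qed.

(** * Lower bound for the pivots of one row *)

Section row_bound.
Variable R : realType.

(** The first constant is that of [expected_gaussian_ratio]. The radius makes [ratio_const] |lambda|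
    at most 1/4, so that the recursion contracts; 6 [ratio_const] is then stable under it, and the
    added 1 absorbs the initial bound. [pivot_const] is what remains after Markov's inequality at
    the level 2 [deloc_const]. *)
Definition ratio_const : R := 1 + 4 * expR 1.
Definition deloc_const : R := 1 + 6 * ratio_const.
Definition spectral_radius : R := (4 * ratio_const)^-1.
Definition pivot_const : R :=
  4^-1 * expR (- (2 * spectral_radius ^+ 2 * (2 * deloc_const) ^+ 2)).

Lemma ratio_const_gt0 : 0 < ratio_const.
Proof. by rewrite addr_gt0// mulr_gt0// expR_gt0. Qed.

Lemma deloc_const_gt0 : 0 < deloc_const.
Proof. by rewrite addr_gt0// mulr_gt0// ratio_const_gt0. Qed.

Lemma spectral_radius_gt0 : 0 < spectral_radius.
Proof. by rewrite invr_gt0 mulr_gt0// ratio_const_gt0. Qed.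

Lemma pivot_const_gt0 : 0 < pivot_const.
Proof. by rewrite mulr_gt0 ?expR_gt0// invr_gt0. Qed.

Variables (K : finType) (sigma : R) (n' : nat).
Let n := n'.+1.
Hypothesis sigma_gt0 : 0 < sigma.
Hypothesis sigmaE : 2 * sigma ^+ 2 = n%:R^-1.
Local Notation C := R[i].
Local Notation S := (state R (K * bool)%type).
Variable mu : {measure set S -> \bar R}.
Hypothesis mu1 : mu setT = 1%E.
Hypothesis mu_resampling : resampling sigma mu.
Variable lam : C.
Hypothesis lam_le : nrm lam <= spectral_radius.

Let n0 : 0 < n%:R :> R. Proof. by rewrite ltr0n. Qed.

(* Starting from the trivial bound at size about [n / 2], each increase of the
   size by one contracts the deviation from the fixed point by a factor [2]. *)
Lemma rowratio_bound_iter m i : (n <= 2 * m.+1)%N ->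
  rowratio_bound mu lam (m + i).+1
    ((2 ^- i * Num.sqrt n%:R + 6 * ratio_const) / Num.sqrt n%:R).
Proof.
move=> nm; have sn0 : 0 < Num.sqrt n%:R :> R by rewrite sqrtr_gt0.
have c0 := ratio_const_gt0.
elim: i => [|i IH].
  move=> phi j iphi; rewrite addn0 in phi j iphi *.
  apply: le_trans (@rowratio_bound1 R K mu mu1 lam _ phi j iphi) _.
  rewrite lee_fin ler_pdivlMr// mul1r expr0 invr1 mul1r lerDl.
  by rewrite mulr_ge0// ltW.
rewrite addnS => phi j iphi.
apply: le_trans (rowratio_step sigma_gt0 mu1 mu_resampling IH j iphi) _.
rewrite lee_fin -/ratio_const.
(* All sizes in the iteration are at least n / 2, and sqrt 2 <= 3/2. *)
have h : Num.sqrt n%:R <= 3 / 2 * Num.sqrt (m + i).+1%:R :> R.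
  rewrite -[3 / 2](ger0_norm (_ : 0 <= 3 / 2)) ?divr_ge0// -sqrtr_sqr -sqrtrM ?sqr_ge0//.
  rewrite ler_wsqrtr//.
  have : n%:R <= 2 * (m + i).+1%:R :> R.
    by rewrite -natrM ler_nat (leq_trans nm)// leq_mul2l/= ltnS leq_addr.
  have : 0 < (m + i).+1%:R :> R by rewrite ltr0n.
  by move: (n%:R) ((m + i).+1%:R : R) => x y; lra.
rewrite sigmaE.
have -> : Num.sqrt n%:R^-1 = (Num.sqrt n%:R)^-1 :> R by rewrite sqrtrV ?ltW.
set s := Num.sqrt n%:R in sn0 h *; set q := Num.sqrt (m + i).+1%:R in h *.
have q0 : 0 < q by rewrite sqrtr_gt0 ltr0n.
set x := 2 ^- i * s + _.
have -> : nrm lam / s^-1 * (x / s) = nrm lam * x.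
  by rewrite invrK -mulrA (mulrC s) divfK ?gt_eqF.
rewrite ler_pdivrMr// mulrAC ler_pdivlMr//.
have x0 : 0 <= x by rewrite addr_ge0 ?mulr_ge0 ?invr_ge0 ?exprn_ge0 ?ltW.
have lx : ratio_const * (nrm lam * x) <= x / 4.
  rewrite mulrA [leRHS]mulrC ler_wpM2r//.
  have := ler_wpM2l (ltW c0) lam_le; rewrite /spectral_radius invfM.
  by rewrite mulrCA mulfV ?gt_eqF// mulr1.
have E : 2 ^- i.+1 * s = 2 ^- i * s / 2 by rewrite exprS invfM; ring.
(* With x = y + 6 c, where c is [ratio_const], 3/2 (2 c + x / 4) = 3/8 y + 21/4 c, which is below y
   / 2 + 6 c. *)
apply: le_trans (_ : (ratio_const * 2 + x / 4) * (3 / 2 * q) <= _).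
  rewrite mulrDr; apply: ler_pM => //; last by rewrite lerD2l.
    by apply: addr_ge0; apply: mulr_ge0; rewrite ?(ltW c0)// mulr_ge0 ?nrm_ge0.
  exact: ltW.
rewrite mulrA ler_pM2r// E; move: (2 ^- i * s) @x x0 lx => y x x0 lx.
by rewrite /x in x0 *; lra.
Qed.

(** The number i of steps from size about n / 2 is half of n - 1, rounded up; since n <= 2^(n - 1)
    <= 4^i, the term 2^-i sqrt n has dropped below 1. *)
Lemma rowratio_bound_final :
  rowratio_bound mu lam n (deloc_const / Num.sqrt n%:R).
Proof.
have nm : (n <= 2 * (n'./2).+1)%N by rewrite /n; have := odd_double_half n'; lia.
have := @rowratio_bound_iter n'./2 (uphalf n') nm.
have -> : (n'./2 + uphalf n' = n')%N by have := odd_double_half n'; lia.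
move=> h phi j iphi; apply: le_trans (h phi j iphi) _.
rewrite lee_fin ler_wpM2r ?invr_ge0 ?sqrtr_ge0// /deloc_const lerD2r.
rewrite mulrC ler_pdivrMr ?exprn_gt0// mul1r.
rewrite -(ler_pXn2r (n := 2)) ?nnegrE ?sqrtr_ge0 ?exprn_ge0// sqr_sqrtr ?(ltW n0)//.
rewrite -exprM -natrX ler_nat.
apply: leq_trans (ltn_expl n' (isT : 1 < 2)%N) _.
by rewrite leq_exp2l//; have := odd_double_half n'; lia.
Qed.

Variables (phi : 'I_n * 'I_n -> K) (j : 'I_n).
Hypothesis iphi : injective phi.

Let A t : 'M[C]_n := lam%:M - subm phi t.
Let c l t := cofactor (A t) j l.
Let D t := \sum_l nrm (c l t) ^+ 2.
Let pivot k t := zc t (phi (j, k)) + \det (A t) / c k t.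

Let mc l : cmeasurable (c l).
Proof. by apply: cmeasurable_cofactor => *; exact: cmeasurable_subm. Qed.

Let c_free i l : free_of (phi (j, i)) (c l).
Proof.
move=> z t; have := cofactor_row_free idfun lam%:M iphi j i l z t.
by rewrite !(map_mx_id (f := idfun) (fun=> erefl)).
Qed.

Let D_ge k t : nrm (c k t) ^+ 2 <= D t.
Proof. by rewrite /D (bigD1 k)//= lerDl sumr_ge0// => l _; exact: sqr_ge0. Qed.

(** Expanding the determinant along row j, the contribution of entry (j, k) cancels, so the pivot
    depends on the other entries of the row only. *)
Let pivotE k t : c k t != 0 ->
  nrm (pivot k t) = nrm (\sum_(l <- [seq l <- index_enum 'I_n | l != k])
    c l t * zc t (phi (j, l)) - lam * c j t) / nrm (c k t).
Proof.
move=> ck; rewrite -nrmV -nrmM -[RHS]nrmN -mulNr opprB; congr nrm.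
apply: (mulIf ck); rewrite divfK// /pivot mulrDl divfK//.
rewrite (expand_det_row _ j) big_filter.
transitivity (zc t (phi (j, k)) * c k t + \sum_l (lam *+ (j == l) * c l t - c l t * zc t (phi (j, l)))).
  congr (_ + _); apply: eq_bigr => l _; rewrite !mxE -/(c l t); ring.
rewrite sumrB (bigD1 j)//= eqxx mulr1n big1 ?addr0; last first.
  by move=> l lj; rewrite eq_sym (negbTE lj) mulr0n mul0r.
by rewrite (bigD1 k)//=; ring.
Qed.

(** Integrating out row j except entry k, with s = 2 n / |c_k|^2 and variance (D - |c_k|^2) / n,
    gives the denominator (2 D - |c_k|^2) / |c_k|^2. It is at most 2 D / |c_k|^2 in the prefactor,
    and 2 D - |c_k|^2 >= D in the exponent produces the square of [rowratio]. *)
Let pivot_term k :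
  (\int[mu]_t (nrm (c k t) ^+ 2 / (2 * D t) *
      expR (- (2 * n%:R * nrm lam ^+ 2 * rowratio (A t) j ^+ 2)))%:E <=
   \int[mu]_t ((c k t != 0)%:R * expR (- (2 * n%:R * nrm (pivot k t) ^+ 2)))%:E)%E.
Proof.
pose L := [seq l <- index_enum 'I_n | l != k].
pose s t := 2 * n%:R / nrm (c k t) ^+ 2.
pose V t := 2 * sigma ^+ 2 * \sum_(l <- L) nrm (c l t) ^+ 2.
have V0 t : 0 <= V t.
  rewrite mulr_ge0//; first by rewrite mulr_ge0 ?sqr_ge0.
  by apply: sumr_ge0 => l _; exact: sqr_ge0.
have s0 t : 0 <= s t by rewrite divr_ge0 ?sqr_ge0// mulr_ge0.
have izeta : injective (fun l => phi (j, l)) by move=> l l' /iphi [].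
have E t : (c k t != 0)%:R * expR (- (2 * n%:R * nrm (pivot k t) ^+ 2)) =
   (c k t != 0)%:R * expR (- (s t * nrm (\sum_(l <- L)
    c l t * zc t (phi (j, l)) - lam * c j t) ^+ 2)).
  have [ck|ck] := eqVneq (c k t) 0; first by rewrite !mul0r.
  rewrite pivotE// expr_div_n /s.
  by congr (_ * expR (- _)); rewrite mulrA mulrAC.
under [leRHS]eq_integral do rewrite E.
rewrite (integral_gaussian_combination (zeta := fun l => phi (j, l))
  (A := fun t => (c k t != 0)%:R) (s := s) (b := fun t => lam * c j t) (c := c)
  sigma_gt0 mu_resampling izeta (filter_uniq _ (index_enum_uniq _)))//.
- apply: ge0_le_integral_nomeas => t; rewrite lee_fin.
    by rewrite mulr_ge0 ?expR_ge0// divr_ge0 ?sqr_ge0// mulr_ge0// (le_trans _ (D_ge k t)) ?sqr_ge0.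
  have [ck|ck] := eqVneq (c k t) 0.
    by rewrite ck nrm0 expr0n/= !mul0r.
  have x0 : 0 < nrm (c k t) ^+ 2 by rewrite exprn_gt0// nrm_gt0.
  have nz : nrm (c k t) != 0 by rewrite nrm_eq0.
  have nn : n%:R != 0 :> R by rewrite gt_eqF.
  have D0 : 0 < D t by rewrite (lt_le_trans x0).
  have VE : V t = (D t - nrm (c k t) ^+ 2) / n%:R.
    by rewrite /V sigmaE mulrC big_filter /D [in RHS](bigD1 k)//= addrAC subrr add0r.
  have wE : 1 + s t * V t = (2 * D t - nrm (c k t) ^+ 2) / nrm (c k t) ^+ 2.
    rewrite VE /s; move: (D t) (nrm (c k t)) nz (n%:R : R) nn => d x xz y yz.
    by field; rewrite xz yz.
  rewrite -/(V t) wE mul1r invf_div.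
  have w0 : 0 < 2 * D t - nrm (c k t) ^+ 2.
    by rewrite subr_gt0 (le_lt_trans (D_ge k t))// ltr_pMl// ltr1n.
  apply: ler_pM; rewrite ?expR_ge0 ?divr_ge0 ?sqr_ge0 ?mulr_ge0 ?(ltW D0)//.
    by rewrite ler_wpM2l ?sqr_ge0// lef_pV2 ?posrE ?mulr_gt0// gerBl sqr_ge0.
  rewrite ler_expR lerN2 nrmM.
  have -> : s t * (nrm lam * nrm (c j t)) ^+ 2 * (nrm (c k t) ^+ 2 /
      (2 * D t - nrm (c k t) ^+ 2)) =
     2 * n%:R * nrm lam ^+ 2 * (nrm (c j t) ^+ 2 / (2 * D t - nrm (c k t) ^+ 2)).
    rewrite /s; move: w0 (n%:R : R) nz => /gt_eqF /negbT.
    move: (nrm (c k t)) (nrm (c j t)) (nrm lam) (D t) => x y a d wz m xz.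
    by field; rewrite xz wz.
  apply: ler_wpM2l; first by rewrite mulr_ge0 ?sqr_ge0// mulr_ge0 ?(ltW n0).
  rewrite /rowratio -/(c j t) -/(D t) expr_div_n sqr_sqrtr ?(ltW D0)//.
  apply: ler_wpM2l; first exact: sqr_ge0.
  rewrite lef_pV2 ?posrE//.
  by have := D_ge k t; lra.
- exact: measurable_neq0.
- apply: measurable_funM => //; apply: measurable_fun_inv.
  by apply: measurable_funX; exact: measurable_nrm.
- by apply: cmeasurableM => //; exact: cmeasurable_cst.
- move=> l _; split=> [z t|z t|z t|i _]; last exact: c_free.
  + by rewrite (c_free l k z t).
  + by rewrite /s (c_free l k z t).
  + by rewrite (c_free l j z t).
- by move=> t; rewrite -/(V t) ltr_wpDr// mulr_ge0.
Qed.

(** The prefactors |c_k|^2 / (2 D) sum to 1/2 over k. Markov's inequality for [rowratio] is used in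
    the pointwise form [key] and then integrated. *)
Lemma row_lower_bound :
  (pivot_const%:E <= \sum_(k < n) \int[mu]_t ((c k t != 0)%:R *
     expR (- (2 * n%:R * nrm (pivot k t) ^+ 2)))%:E)%E.
Proof.
apply: le_trans (lee_sum _ (fun k _ => pivot_term k)).
pose U t := rowratio (A t) j.
have mU : measurable_fun setT U by exact: measurable_rowratio.
have mD : measurable_fun setT D.
  by apply: measurable_sum => l; apply: measurable_funX; exact: measurable_nrm.
pose e t := expR (- (2 * n%:R * nrm lam ^+ 2 * U t ^+ 2)).
have me : measurable_fun setT e.
  apply: measurableT_comp => //; apply: measurableT_comp => //.
  by apply: measurable_funM => //; exact: measurable_funX.
have D0 t : 0 <= D t by apply: sumr_ge0 => l _; exact: sqr_ge0.
have f0 k t : 0 <= nrm (c k t) ^+ 2 / (2 * D t) * e t.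
  by rewrite mulr_ge0 ?expR_ge0// divr_ge0 ?sqr_ge0 ?mulr_ge0.
have mf k : measurable_fun setT (fun t => nrm (c k t) ^+ 2 / (2 * D t) * e t).
  apply: measurable_funM => //; apply: measurable_funM.
    by apply: measurable_funX; exact: measurable_nrm.
  by apply: measurable_fun_inv; exact: measurable_funM.
rewrite -(ge0_integral_sum _ measurableT) => [|k|k t _]; last 2 first.
- by apply/measurable_EFinP; exact: mf.
- by rewrite lee_fin f0.
pose g t := \sum_k (nrm (c k t) ^+ 2 / (2 * D t) * e t).
under eq_integral do rewrite sumEFin -/(g _).
have gE t : c j t != 0 -> g t = 2^-1 * e t.
  move=> cj; have D1 : 0 < D t.
    by rewrite (lt_le_trans _ (D_ge j t))// exprn_gt0// nrm_gt0.
  rewrite /g -mulr_suml -mulr_suml -/(D t); congr (_ * _).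
  by field; rewrite gt_eqF.
(* By Markov, sqrt n u reaches B with probability at most 1/2. Below B the exponential is at least
   e^(-a); above B the weight w makes w u at least e^(-a) / 2, at an expected cost of e^(-a) / 4. *)
pose B := 2 * deloc_const; pose a := 2 * nrm lam ^+ 2 * B ^+ 2.
have B0 : 0 < B by rewrite mulr_gt0// deloc_const_gt0.
pose w := 2^-1 * expR (- a) / B * Num.sqrt n%:R.
have a0 : 0 <= a by rewrite mulr_ge0 ?sqr_ge0// mulr_ge0 ?sqr_ge0.
have w0 : 0 <= w.
  by rewrite !mulr_ge0 ?expR_ge0 ?invr_ge0 ?sqrtr_ge0// ltW.
pose Z := [set t | c j t = 0].
have mZ : measurable Z by exact: cmeasurable_eq0.
have Z0 : mu Z = 0%E by exact: (cofactor_negligible mu_resampling lam j j iphi).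
have U0 t : 0 <= U t by exact: rowratio_ge0.
have key t : 2^-1 * expR (- a) <= g t + (w * U t + \1_Z t).
  have g0 : 0 <= g t by apply: sumr_ge0.
  have [cj|cj] := eqVneq (c j t) 0.
    rewrite indicE mem_set// addrA; apply: ler_wpDl; first by apply: addr_ge0 => //; apply: mulr_ge0.
    apply: (@le_trans _ _ (1 * 1)); last by rewrite mul1r.
    apply: ler_pM; rewrite ?expR_ge0 ?invr_ge0//; first by rewrite invf_le1// ler1n.
    by rewrite -expR0 ler_expR oppr_le0.
  have wU0 : 0 <= w * U t by apply: mulr_ge0.
  have e0 : 0 <= 2^-1 * e t by rewrite mulr_ge0 ?expR_ge0 ?invr_ge0.
  rewrite gE//; have [hU|hU] := leP B (Num.sqrt n%:R * U t).
    apply: (@le_trans _ _ (w * U t)).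
      have -> : w * U t = 2^-1 * expR (- a) * (Num.sqrt n%:R * U t / B).
        by rewrite /w; ring.
      rewrite ler_peMr ?mulr_ge0 ?expR_ge0 ?invr_ge0//.
      by rewrite ler_pdivlMr// mul1r.
    by rewrite addrCA lerDl addr_ge0.
  apply: (@le_trans _ _ (2^-1 * e t)); last by rewrite lerDl addr_ge0.
  apply: ler_wpM2l; first by rewrite invr_ge0.
  rewrite ler_expR lerN2 /a.
  have -> : 2 * n%:R * nrm lam ^+ 2 * U t ^+ 2 =
      2 * nrm lam ^+ 2 * (Num.sqrt n%:R * U t) ^+ 2.
    by rewrite [in RHS]exprMn (sqr_sqrtr (ltW n0)); ring.
  apply: ler_wpM2l; first by rewrite mulr_ge0 ?sqr_ge0.
  by rewrite ler_pXn2r ?nnegrE ?(ltW hU) ?(ltW B0)// mulr_ge0 ?sqrtr_ge0.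
have mg : measurable_fun setT (fun t => (g t)%:E).
  by apply/measurable_EFinP; apply: measurable_sum.
have mwU : measurable_fun setT (fun t => (w * U t)%:E).
  by apply/measurable_EFinP; exact: measurable_funM.
have m1Z : measurable_fun setT (fun t => (\1_Z t : R)%:E).
  by apply/measurable_EFinP; exact: measurable_indic.
have g0 t : setT t -> (0 <= (g t)%:E)%E by rewrite lee_fin => _; exact: sumr_ge0.
have wU0 t : setT t -> (0 <= (w * U t)%:E)%E by rewrite lee_fin mulr_ge0.
have Zi0 t : setT t -> (0 <= (\1_Z t : R)%:E)%E by rewrite lee_fin.
have int_wU : (\int[mu]_t (w * U t)%:E <= (2^-1 * expR (- a) / 2)%:E)%E.
  have mUE : measurable_fun setT (fun t => (U t)%:E) by exact/measurable_EFinP.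
  have UE0 t : setT t -> (0 <= (U t)%:E)%E by rewrite lee_fin.
  under eq_integral do rewrite EFinM.
  rewrite (ge0_integralZl _ measurableT mUE UE0)//.
  apply: le_trans (lee_wpmul2l _ (rowratio_bound_final j iphi)) _ => //.
  rewrite -EFinM lee_fin /w /B le_eqVlt; apply/orP; left; apply/eqP.
  have dc : deloc_const != 0 by rewrite gt_eqF ?deloc_const_gt0.
  by field; rewrite dc gt_eqF ?sqrtr_gt0.
have tot : ((2^-1 * expR (- a))%:E <= \int[mu]_t (g t)%:E + (2^-1 * expR (- a) / 2)%:E)%E.
  apply: (@le_trans _ _ (\int[mu]_t ((g t)%:E + ((w * U t)%:E + (\1_Z t)%:E)))%E).
    apply: (@le_trans _ _ (\int[mu]_t (2^-1 * expR (- a))%:E)%E).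
      by rewrite integral_cst// mu1 mule1.
    apply: ge0_le_integral_nomeas => t.
      by rewrite lee_fin mulr_ge0 ?expR_ge0 ?invr_ge0.
    by rewrite -!EFinD lee_fin.
  rewrite (ge0_integralD _ measurableT g0 mg)//; last 2 first.
  - by move=> t _; rewrite adde_ge0// (wU0, Zi0).
  - exact: emeasurable_funD.
  rewrite leeD2l// (ge0_integralD _ measurableT wU0 mwU Zi0 m1Z).
  by rewrite integral_indic// setIT Z0 adde0.
have row_le : pivot_const <= 2^-1 * expR (- a) - 2^-1 * expR (- a) / 2.
  have -> : 2^-1 * expR (- a) - 2^-1 * expR (- a) / 2 = 4^-1 * expR (- a) by field.
  rewrite /pivot_const ler_wpM2l ?invr_ge0// ler_expR lerN2 /a.
  rewrite ler_wpM2r ?sqr_ge0// ler_wpM2l//.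
  by rewrite ler_pXn2r ?nnegrE ?nrm_ge0// ltW// spectral_radius_gt0.
apply: (@le_trans _ _ (2^-1 * expR (- a) - 2^-1 * expR (- a) / 2)%:E).
  by rewrite lee_fin.
by rewrite EFinB leeBlDr.
Qed.

End row_bound.

(** * Condition numbers and cofactors *)

Section eigenvalue_condition_numbers.
Variable R : realType.
Local Notation C := R[i].

Lemma horner_char_poly_mx n (M : 'M[C]_n) x :
  map_mx (horner_eval x) (char_poly_mx M) = x%:M - M.
Proof.
apply/matrixP => i j; rewrite !mxE /horner_eval !hornerE.
by case: eqP => _; rewrite ?mulr1n ?mulr0n ?hornerX ?horner0.
Qed.

Lemma horner_cofactor n (M : 'M[C]_n) x j k :
  (cofactor (char_poly_mx M) j k).[x] = cofactor (x%:M - M) j k.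
Proof. by rewrite -horner_char_poly_mx cofactor_map_mx. Qed.

Lemma horner_char_poly n (M : 'M[C]_n) x :
  (char_poly M).[x] = \det (x%:M - M).
Proof. by rewrite -horner_char_poly_mx det_map_mx. Qed.

Lemma char_poly_decomposition n (M V : 'M[C]_n) (D : 'rV[C]_n) :
  V \in unitmx -> M = V *m diag_mx D *m invmx V ->
  char_poly M = \prod_i ('X - (D 0 i)%:P).
Proof.
move=> Vu ME; pose f := @polyC C.
have VVi : map_mx f V *m map_mx f (invmx V) = 1%:M.
  by rewrite -map_mxM mulmxV// map_mx1.
rewrite {1}/char_poly; have -> : char_poly_mx M = map_mx f V *m char_poly_mx (diag_mx D) *m map_mx f (invmx V).
  rewrite /char_poly_mx mulmxBr mulmxBl -!map_mxM -ME.
  by rewrite scalar_mxC -mulmxA VVi mulmx1.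
rewrite !det_mulmx mulrAC -det_mulmx VVi det1 mul1r.
rewrite -/(char_poly (diag_mx D)) char_poly_trig ?diag_mx_is_trig//.
by apply: eq_bigr => i _; rewrite mxE eqxx.
Qed.

(** The adjugate of X - M is V diag(w) V^-1 with w_l the product of the other linear factors: both
    sides agree after multiplication by the characteristic polynomial, which is monic and can be
    cancelled. *)
Lemma cofactor_char_poly_decomposition n (M V : 'M[C]_n) (D : 'rV[C]_n) j k :
  V \in unitmx -> M = V *m diag_mx D *m invmx V ->
  cofactor (char_poly_mx M) j k =
  \sum_l (V k l * invmx V l j)%:P * \prod_(l' | l' != l) ('X - (D 0 l')%:P).
Proof.
move=> Vu ME; pose f := @polyC C; pose P := char_poly_mx M.
pose w := \row_l \prod_(l' | l' != l) ('X - (D 0 l')%:P) : 'rV[{poly C}]_n.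
pose N := map_mx f V *m diag_mx w *m map_mx f (invmx V).
have chiE := char_poly_decomposition Vu ME.
have VVi : map_mx f V *m map_mx f (invmx V) = 1%:M.
  by rewrite -map_mxM mulmxV// map_mx1.
have ViV : map_mx f (invmx V) *m map_mx f V = 1%:M.
  by rewrite -map_mxM mulVmx// map_mx1.
have PE : P = map_mx f V *m char_poly_mx (diag_mx D) *m map_mx f (invmx V).
  rewrite /P /char_poly_mx mulmxBr mulmxBl -!map_mxM -ME.
  by rewrite scalar_mxC -mulmxA VVi mulmx1.
have PN : P *m N = (char_poly M)%:M.
  rewrite PE /N !mulmxA -(mulmxA _ _ (map_mx f V)) ViV mulmx1.
  rewrite -(mulmxA (map_mx f V)).
  have -> : char_poly_mx (diag_mx D) *m diag_mx w = (char_poly M)%:M.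
    apply/matrixP => a c; rewrite mul_mx_diag !mxE.
    case: (eqVneq a c) => [->|ac]; last by rewrite !mulr0n subr0 mul0r.
    by rewrite !mulr1n chiE [RHS](bigD1 c).
  by rewrite scalar_mxC -mulmxA VVi mulmx1.
have E : char_poly M *: N = char_poly M *: \adj P.
  rewrite -[LHS]mul_scalar_mx -[X in X%:M](erefl (\det P)) -mul_adj_mx -mulmxA PN.
  by rewrite mul_mx_scalar.
have /matrixP/(_ k j) := E; rewrite [in RHS]mxE [in RHS]mxE [LHS]mxE.
move=> /(mulfI (monic_neq0 (char_poly_monic M))) => <-.
rewrite mxE; apply: eq_bigr => l _; rewrite mul_mx_diag !mxE.
by rewrite polyCM mulrAC.
Qed.

(** The minimal polynomial divides a product of distinct linear factors, whence diagonalisability;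
    the diagonal entries are the roots of the separable characteristic polynomial, hence
    distinct. *)
Lemma separable_eigendecomposition n (M : 'M[C]_n) :
  coprimep (char_poly M) (char_poly M)^`() ->
  exists V D, distinct_eigendecomposition M V D.
Proof.
case: n M => [|n] M sep.
  exists 1%:M, 0; split; first exact: unitmx1.
    by case.
  by apply/matrixP => -[].
have urs : uniq (eigenvalues M).
  have : separable_poly (char_poly M) by rewrite unlock.
  rewrite char_poly_eigenvalues.
  by rewrite separable_prod_XsubC.
have /diagonalizableP [P Pu /diagonalizable_forPex[D /(simmxP Pu) ME]] : exists2 rs, uniq rs &
    mxminpoly M %| \prod_(x <- rs) ('X - x%:P).
  by exists (eigenvalues M) => //; rewrite -char_poly_eigenvalues mxminpoly_dvd_char.
have ME' : M = invmx P *m diag_mx D *m invmx (invmx P).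
  by rewrite invmxK -mulmxA -ME mulKmx.
exists (invmx P), D; split => //; first by rewrite unitmx_inv.
have : separable_poly (char_poly M) by rewrite unlock.
rewrite (char_poly_decomposition _ ME') ?unitmx_inv//.
rewrite -big_enum /= -(big_map (D 0) xpredT (fun x => 'X - x%:P)).
by rewrite separable_prod_XsubC => u; exact/injectiveP.
Qed.

(** At an eigenvalue D_l the adjugate has rank one: divided by the derivative of the characteristic
    polynomial at D_l, its entries are those of the spectral projection v_l w_l^*, whose squared
    Frobenius norm is the squared condition number. *)
Lemma sum_sqr_eigencond n (M : 'M[C]_n) :
  coprimep (char_poly M) (char_poly M)^`() ->
  exists D : 'I_n -> C, [/\ injective D,
    char_poly M = \prod_i ('X - (D i)%:P) &
    \sum_(i < n) eigencond M (eigenvalues M)`_i ^+ 2 =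
    \sum_l \sum_j \sum_k (nrm (cofactor ((D l)%:M - M) j k) /
       nrm (\prod_(l' | l' != l) (D l - D l'))) ^+ 2].
Proof.
move=> sep; have [V [D dM]] := separable_eigendecomposition sep.
have [Vu Di ME] := dM; have chiE := char_poly_decomposition Vu ME.
exists (D 0); split => //.
pose f x := eigencond M x ^+ 2.
have pe : perm_eq (eigenvalues M) [seq D 0 i | i <- index_enum 'I_n].
  by apply: prod_XsubC_eq; rewrite -char_poly_eigenvalues chiE big_map.
have -> : \sum_(i < n) f (eigenvalues M)`_i = \sum_l f (D 0 l).
  rewrite -[RHS](big_map (D 0) xpredT f) -(perm_big _ pe) /=.
  by rewrite (big_nth 0) big_mkord size_eigenvalues.
apply: eq_bigr => l _; rewrite /f (eigencondE _ dM) left_eigvecE exprMn.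
have sqE (v : 'cV[C]_n) : euclidean_norm v ^+ 2 = \sum_k nrm (v k 0) ^+ 2.
  by rewrite sqr_sqrtr// sumr_ge0// => k _; exact: sqr_ge0.
rewrite !sqE mulrC big_distrl; apply: eq_bigr => j _ /=.
rewrite big_distrr; apply: eq_bigr => k _ /=.
rewrite -horner_cofactor (cofactor_char_poly_decomposition _ _ Vu ME).
rewrite horner_sum (bigD1 l)//= [X in _ + X]big1 ?addr0 => [|l' l'l]; last first.
  rewrite hornerM horner_prod (bigD1 l) 1?eq_sym//= hornerXsubC subrr mul0r.
  by rewrite mulr0.
rewrite hornerM hornerC horner_prod.
under [X in nrm (_ * X)]eq_bigr do rewrite hornerXsubC.
rewrite nrmM mulfK; first by rewrite !mxE nrmM exprMn mulrC.
rewrite nrm_eq0 prodf_seq_neq0; apply/allP => l' _; apply/implyP => l'l.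
by rewrite subr_eq0; apply: contra l'l => /eqP /Di ->.
Qed.

End eigenvalue_condition_numbers.

(** * The Kac-Rice set *)

Lemma deriv_prod_XsubC (F : comNzRingType) (I : eqType) (s : seq I) (D : I -> F) :
  uniq s -> (\prod_(i <- s) ('X - (D i)%:P))^`() =
    \sum_(i <- s) \prod_(l <- s | l != i) ('X - (D l)%:P).
Proof.
elim: s => [|i s IH] /=; first by rewrite !big_nil derivC.
move=> /andP[is' us]; rewrite !big_cons derivM derivXsubC mul1r IH// eqxx /=.
congr (_ + _).
  rewrite [RHS]big_seq_cond [LHS]big_seq; apply: eq_bigl => l.
  have [ls|//] := boolP (l \in s); rewrite /=; apply/esym/negP => /eqP li.
  by rewrite -li ls in is'.
rewrite mulr_sumr [LHS]big_seq [RHS]big_seq; apply: eq_bigr => l ls.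
rewrite big_cons; case: eqP => // il.
by rewrite il ls in is'.
Qed.

Section polynomial_continuity.
Variable R : realType.
Local Notation C := R[i].

Lemma nrm_horner_bounded (p : {poly C}) (w : C) :
  exists2 B : R, 0 <= B & forall x, nrm (x - w) <= 1 -> nrm p.[x] <= B.
Proof.
exists (\sum_(i < size p) nrm p`_i * (nrm w + 1) ^+ i).
  by apply: sumr_ge0 => i _; rewrite mulr_ge0 ?exprn_ge0 ?addr_ge0 ?nrm_ge0.
move=> x xw; rewrite horner_coef (le_trans (nrm_sum _ _ _))//.
apply: ler_sum => i _; rewrite nrmM ler_wpM2l ?nrm_ge0//.
have -> : nrm (x ^+ i) = nrm x ^+ i.
  by elim: (nat_of_ord i) => [|k IH]; rewrite ?nrm1// !exprS nrmM IH.
rewrite lerXn2r ?nnegrE ?addr_ge0 ?nrm_ge0//.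
by have := nrm_sub_dist x w; lra.
Qed.

Lemma nrm_horner_continuous (p : {poly C}) (w : C) (e : R) : 0 < e ->
  exists2 rho : R, 0 < rho &
    forall x, nrm (x - w) <= rho -> nrm (p.[x] - p.[w]) <= e.
Proof.
move=> e0; have /factor_theorem [g gE] : root (p - p.[w]%:P) w.
  by rewrite rootE !hornerE subrr.
have [B B0 hB] := nrm_horner_bounded g w.
have B1 : 0 < 1 + B + e by rewrite addr_gt0// ltr_pwDl.
exists (e / (1 + B + e)); first by rewrite divr_gt0.
move=> x xw.
have -> : p.[x] - p.[w] = g.[x] * (x - w).
  have := congr1 (horner^~ x) gE; rewrite !hornerE => <-; ring.
rewrite nrmM (le_trans (ler_pM (nrm_ge0 _) (nrm_ge0 _) (hB x _) xw))//.
  by rewrite (le_trans xw)// ler_pdivrMr// mul1r lerDr addr_ge0.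
by rewrite mulrCA -[leRHS]mulr1 ler_wpM2l ?(ltW e0)// ler_pdivrMr// mul1r; lra.
Qed.

Lemma horner_ratio_continuous (q o : {poly C}) (w : C) (eta : R) : 0 < eta ->
  o.[w] != 0 -> exists2 rho : R, 0 < rho &
    forall x, nrm (x - w) <= rho ->
      nrm q.[x] <= (nrm q.[w] / nrm o.[w] + eta) * nrm o.[x].
Proof.
move=> eta0 ow; have ow0 : 0 < nrm o.[w] by rewrite nrm_gt0.
pose a := nrm q.[w] / nrm o.[w].
have a0 : 0 <= a by rewrite divr_ge0 ?nrm_ge0.
have d0 : 0 < 1 + a + eta by rewrite addr_gt0// ltr_pwDl.
(* Chosen so that a |o(w)| + e = (a + eta) (|o(w)| - e). *)
pose e := eta * nrm o.[w] / (1 + a + eta).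
have e0 : 0 < e by rewrite divr_gt0 ?mulr_gt0.
have [r1 r10 h1] := nrm_horner_continuous q w e0.
have [r2 r20 h2] := nrm_horner_continuous o w e0.
exists (Num.min r1 r2); first by rewrite lt_min r10.
move=> x; rewrite le_min => /andP[/h1 x1 /h2 x2].
have q1 : nrm q.[x] <= nrm q.[w] + e by have := nrm_sub_dist q.[x] q.[w]; lra.
have o1 : nrm o.[w] - e <= nrm o.[x].
  by have := nrm_sub_dist o.[w] o.[x]; rewrite nrmC; lra.
rewrite (le_trans q1)//.
apply: (@le_trans _ _ ((a + eta) * (nrm o.[w] - e))); last first.
  by rewrite ler_wpM2l// addr_ge0// ltW.
have qw : nrm q.[w] = a * nrm o.[w] by rewrite divfK ?gt_eqF.
have ee : e * (1 + a + eta) = eta * nrm o.[w] by rewrite divfK ?gt_eqF.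
by rewrite qw; lra.
Qed.

End polynomial_continuity.

Section small_squares.
Variables (R : realType) (U : probability R R) (r : R).
Hypothesis r0 : 0 < r.
Hypothesis U_small : forall x h, 0 <= h ->
  (U [set y | (`|y - x| <= h)%R] <= (h / r)%:E)%E.
Local Notation C := R[i].
Local Notation nu := (U \x U)%E.

Definition square (w : C) (h : R) : set (R * R) :=
  [set y | (`|y - complex.Re w| <= h)%R] `*` [set y | (`|y - complex.Im w| <= h)%R].

Lemma measurable_square w h : measurable (square w h).
Proof.
have mI x : measurable [set y : R | `|y - x| <= h].
  rewrite (_ : [set y | _] = `[x - h, x + h]%classic); first exact: measurable_itv.
  by apply/seteqP; split => y /=; rewrite in_itv /= ler_distl.
exact: measurableX.
Qed.

Lemma square_small w h : 0 <= h -> (nu (square w h) <= ((h / r) ^+ 2)%:E)%E.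
Proof.
move=> h0; have mI x : measurable [set y : R | `|y - x| <= h].
  rewrite (_ : [set y | _] = `[x - h, x + h]%classic); first exact: measurable_itv.
  by apply/seteqP; split => y /=; rewrite in_itv /= ler_distl.
have -> : nu (square w h) = (U [set y | (`|y - complex.Re w| <= h)%R] *
    U [set y | (`|y - complex.Im w| <= h)%R])%E by exact: product_measure1E.
by rewrite expr2 EFinM; apply: lee_pmul => //; exact: U_small.
Qed.

Lemma nrm_square (w : C) (z : R * R) h : nrm (toC z - w) <= h -> square w h z.
Proof.
move=> zw; split => /=; apply: le_trans zw.
  by apply: le_trans (Re_le_nrm _); case: w => a b.
by apply: le_trans (Im_le_nrm _); case: w => a b.
Qed.

(** Discs are enlarged to squares, on which the product measure factorises, and a union bound is
    applied. *)
Lemma covered_small (I : finType) (S : set (R * R)) (w : I -> C) (h : I -> R) :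
  measurable S -> (forall i, 0 <= h i) ->
  (forall z, S z -> exists i, nrm (toC z - w i) <= h i) ->
  (nu S <= (\sum_i (h i / r) ^+ 2)%:E)%E.
Proof.
move=> mS h0 cov.
apply: (@le_trans _ _ (nu (\big[setU/set0]_i square (w i) (h i)))).
  apply: le_measure; rewrite ?inE//.
    by apply: bigsetU_measurable => i _; exact: measurable_square.
  move=> z /cov [i zi]; rewrite -bigcup_seq; exists i => /=.
    by rewrite mem_index_enum.
  exact: nrm_square.
have sub (s : seq I) : (nu (\big[setU/set0]_(i <- s) square (w i) (h i)) <=
    (\sum_(i <- s) (h i / r) ^+ 2)%:E)%E.
  elim: s => [|i s IH]; first by rewrite !big_nil measure0.
  rewrite !big_cons EFinD; apply: le_trans (leeD (square_small _ (h0 i)) IH).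
  apply: measureU2; first exact: measurable_square.
  by apply: bigsetU_measurable => l _; exact: measurable_square.
exact: sub.
Qed.

End small_squares.

Section kac_rice.
Variables (R : realType) (U : probability R R) (r : R).
Hypothesis r0 : 0 < r.
Hypothesis U_small : forall x h, 0 <= h ->
  (U [set y | (`|y - x| <= h)%R] <= (h / r)%:E)%E.
Local Notation C := R[i].
Local Notation nu := (U \x U)%E.

Definition near_root (p q : {poly C}) (eps del : R) : set (R * R) :=
  [set z | nrm p.[toC z] < eps * nrm q.[toC z] /\
           del * nrm q.[toC z] < nrm (p^`()).[toC z]].

Variables (n : nat) (D : 'I_n -> C) (q : {poly C}).
Let p := \prod_i ('X - (D i)%:P).
Let o i := \prod_(l | l != i) ('X - (D l)%:P).

Let pE i x : p.[x] = (x - D i) * (o i).[x].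
Proof. by rewrite /p (bigD1 i)//= hornerM hornerXsubC. Qed.

Let derivpE x : (p^`()).[x] = \sum_i (o i).[x].
Proof.
by rewrite /p deriv_prod_XsubC ?index_enum_uniq// horner_sum.
Qed.

(* [|p' / p| <= n / dist(x, roots of p)] *)
Lemma near_root_close eps del z : 0 < eps -> 0 < del -> near_root p q eps del z ->
  exists i, nrm (toC z - D i) <= n%:R * eps / del.
Proof.
move=> e0 d0 [h1 h2]; apply: contrapT => /forallNP far.
set x := toC z in h1 h2 far.
pose h := n%:R * eps / del.
have hfar i : h < nrm (x - D i) by rewrite ltNge; apply/negP/far.
have q0 : 0 < nrm q.[x].
  by rewrite -(pmulr_rgt0 _ e0) (le_lt_trans (nrm_ge0 _) h1).
have h0 : 0 <= h by rewrite divr_ge0 ?mulr_ge0 ?(ltW e0) ?(ltW d0).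
have : nrm (p^`()).[x] * h <= n%:R * nrm p.[x].
  rewrite derivpE; apply: le_trans (ler_wpM2r h0 (nrm_sum _ _ _)) _.
  rewrite mulr_suml; apply: le_trans (_ : \sum_(i < n) nrm p.[x] <= _).
    apply: ler_sum => i _; rewrite (pE i) nrmM mulrC ler_wpM2r ?nrm_ge0//.
    exact: ltW.
  by rewrite sumr_const card_ord mulr_natl.
case: (posnP n) => [n0|n0].
  have : (p^`()).[x] = 0.
    by rewrite derivpE big1// => i; have := ltn_ord i; rewrite {2}n0.
  by move=> E; move: h2; rewrite E nrm0 => /(lt_trans (mulr_gt0 d0 q0)); rewrite ltxx.
have nn : 0 < n%:R :> R by rewrite ltr0n.
rewrite /h mulrA ler_pdivrMr//; apply/negP; rewrite -ltNge.
rewrite -!mulrA [ltRHS]mulrCA ltr_pM2l//.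
apply: (@lt_trans _ _ (eps * nrm q.[x] * del)); first by rewrite ltr_pM2r.
by rewrite -mulrA [ltLHS]mulrC ltr_pM2r// [ltLHS]mulrC.
Qed.

Hypothesis mS : forall eps del, measurable (near_root p q eps del).

(** A bound free of the roots and of q: divided by eps^2 it is the domination required by
    [reverse_fatou]. *)
Lemma near_root_coarse eps del : 0 < eps -> 0 < del ->
  (nu (near_root p q eps del) <= (eps ^+ 2 * (n%:R * (n%:R / del / r) ^+ 2))%:E)%E.
Proof.
move=> e0 d0.
have h0 (i : 'I_n) : 0 <= n%:R * eps / del.
  by rewrite divr_ge0 ?mulr_ge0 ?(ltW e0) ?(ltW d0).
apply: le_trans (covered_small U_small (mS eps del) h0
  (fun z => near_root_close e0 d0)) _.
rewrite lee_fin sumr_const card_ord -mulr_natl.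
by rewrite le_eqVlt; apply/orP; left; apply/eqP; field; rewrite !gt_eqF.
Qed.

Let a i := nrm q.[D i] / nrm (o i).[D i].

(** Since |p(x)| = |x - D_i| |o_i(x)|, the event forces |x - D_i| <= eps |q(x) / o_i(x)|, and for
    small eps [near_root_close] brings x so near some D_i that this quotient is almost its value
    [a i] at D_i. *)
Lemma near_root_fine del e : injective D -> 0 < del -> 0 < e ->
  exists2 e1 : R, 0 < e1 & forall eps, 0 < eps -> eps < e1 ->
   (nu (near_root p q eps del) <= (eps ^+ 2 * (\sum_i (a i / r) ^+ 2 + e))%:E)%E.
Proof.
move=> iD d0 e0.
have a0 i : 0 <= a i by rewrite divr_ge0 ?nrm_ge0.
have oD i : (o i).[D i] != 0.
  rewrite horner_prod prodf_seq_neq0; apply/allP => l _; apply/implyP => li.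
  by rewrite hornerXsubC subr_eq0; apply: contra li => /eqP /iD ->.
pose k : R := n%:R + 1.
have k0 : 0 < k by rewrite ltr_wpDl.
(* For eta <= 1, (a + eta)^2 <= a^2 + eta (2 a + 1), so each root exceeds its limit by at most e /
   k; k = n + 1 stays positive when n = 0. *)
pose eta i := Num.min 1 (e * r ^+ 2 / (k * (2 * a i + 1))).
have eta0 i : 0 < eta i.
  rewrite lt_min ltr01 divr_gt0 ?mulr_gt0 ?exprn_gt0//.
  by rewrite ltr_wpDl// mulr_ge0.
have etaE i : ((a i + eta i) / r) ^+ 2 <= (a i / r) ^+ 2 + e / k.
  have e1 : eta i <= 1 by rewrite ge_min lexx.
  have e2 : eta i * (2 * a i + 1) <= e * r ^+ 2 / k.
    rewrite -ler_pdivlMr; last by rewrite ltr_wpDl// mulr_ge0.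
    by rewrite -[leRHS]mulrA -invfM ge_min lexx orbT.
  rewrite (expr_div_n (a i)) (expr_div_n (a i + eta i)) -[e / k](mulfK (_ : r ^+ 2 != 0)) ?gt_eqF ?exprn_gt0//.
  rewrite -mulrDl ler_wpM2r ?invr_ge0 ?sqr_ge0//.
  apply: (@le_trans _ _ (a i ^+ 2 + eta i * (2 * a i + 1))).
    by have := ltW (eta0 i); have := a0 i; nra.
  by rewrite lerD2l -(mulrAC e).
have /choice [rho hrho] : forall i, exists rho : R, 0 < rho /\
    forall x, nrm (x - D i) <= rho ->
      nrm q.[x] <= (a i + eta i) * nrm (o i).[x].
  move=> i; have [rho ? ?] := horner_ratio_continuous q (eta0 i) (oD i).
  by exists rho.
(* A positive lower bound for all [rho i] that avoids a minimum over a possibly empty index set. *)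
pose m := (1 + \sum_i (rho i)^-1)^-1.
have rho0 i : 0 < rho i by have [] := hrho i.
have s0 : 0 <= \sum_i (rho i)^-1 by apply: sumr_ge0 => i _; rewrite invr_ge0 ltW.
have s1 : 0 < 1 + \sum_i (rho i)^-1 by rewrite ltr_pwDl.
have m0 : 0 < m by rewrite invr_gt0.
have mrho i : m <= rho i.
  rewrite -[leRHS]invrK lef_pV2 ?posrE ?invr_gt0// ler_wpDl//.
  by rewrite (bigD1 i)//= lerDl sumr_ge0// => l _; rewrite invr_ge0 ltW.
exists (m * del / k); first by rewrite divr_gt0 ?mulr_gt0.
move=> eps eps0 epsm.
apply: (@le_trans _ _ (\sum_i (eps * (a i + eta i) / r) ^+ 2)%:E).
  apply: (covered_small U_small (w := D)
    (h := fun i => eps * (a i + eta i))) => //.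
    by move=> i; rewrite mulr_ge0 ?(ltW eps0)// addr_ge0 ?(ltW (eta0 i)).
  move=> z Sz; have [i zi] := near_root_close eps0 d0 Sz.
  exists i; have zr : nrm (toC z - D i) <= rho i.
    apply: le_trans zi _; apply: le_trans (mrho i).
    rewrite ler_pdivrMr//; move: epsm; rewrite ltr_pdivlMr// => epsm.
    rewrite (le_trans _ (ltW epsm))// mulrC; apply: ler_wpM2l; first exact: ltW.
    by rewrite /k lerDl.
  have [_ /(_ _ zr) qle] := hrho i; case: Sz => h1 _.
  move: h1; rewrite (pE i) nrmM => h1.
  have o0 : 0 < nrm (o i).[toC z].
    rewrite lt_def nrm_ge0 andbT; apply/eqP => oz.
    move: h1; rewrite oz mulr0 => /lt_le_trans h.
    have := h _ (ler_wpM2l (ltW eps0) qle).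
    by rewrite oz !mulr0 ltxx.
  rewrite -(ler_pM2r o0) (le_trans (ltW h1))// -mulrA ler_wpM2l ?(ltW eps0)//.
rewrite lee_fin.
have -> : \sum_i (eps * (a i + eta i) / r) ^+ 2 =
    eps ^+ 2 * \sum_i ((a i + eta i) / r) ^+ 2.
  by rewrite mulr_sumr; apply: eq_bigr => i _; rewrite -mulrA exprMn.
rewrite ler_wpM2l ?sqr_ge0//.
apply: le_trans (ler_sum _ (fun i _ => etaE i)) _.
rewrite big_split /= lerD2l sumr_const card_ord -[_ *+ _]mulr_natr.
rewrite mulrAC ler_pdivrMr// ler_wpM2l ?(ltW e0)// /k.
by rewrite lerDl.
Qed.

End kac_rice.

(** * Reverse Fatou lemma for uniformly bounded sequences *)

Section reverse_fatou.
Context d (T : measurableType d) (R : realType).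
Local Open Scope ereal_scope.

Lemma limn_einf_le (u : (\bar R)^nat) (c : \bar R) m0 :
  (forall m, (m0 <= m)%N -> u m <= c) -> limn_einf u <= c.
Proof.
move=> uc; rewrite limn_einf_lim (cvg_lim _ (@cvg_einfs_sup _ u))//.
apply: ge_ereal_sup => _ [m _ <-].
apply: le_trans (uc (maxn m m0) (leq_maxr _ _)).
by apply: ereal_inf_lbound; exists (maxn m m0) => //=; exact: leq_maxl.
Qed.

Lemma limn_einf_ge (u : (\bar R)^nat) (c : \bar R) m0 :
  (forall m, (m0 <= m)%N -> c <= u m) -> c <= limn_einf u.
Proof.
move=> uc; rewrite limn_einf_lim (cvg_lim _ (@cvg_einfs_sup _ u))//.
apply: ereal_sup_ge; exists (einfs u m0); first by exists m0.
by apply: le_ereal_inf_tmp => _ [m /= m0m <-]; exact: uc.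
Qed.

(** Fatou's lemma for the nonnegative C - H m. Its lower limit h is measurable, so C - h can be
    integrated and compared pointwise with F outside N; F itself may be nonmeasurable, as for the
    condition numbers. *)
Lemma reverse_fatou (mu : probability T R) (H : nat -> T -> R) (C L : R)
    (F : T -> R) (N : set T) m0 :
  (forall m, measurable_fun setT (H m)) ->
  (forall m t, (0 <= H m t <= C)%R) ->
  (forall m, (m0 <= m)%N -> L%:E <= \int[mu]_t (H m t)%:E) ->
  measurable N -> mu N = 0 -> (forall t, (0 <= F t)%R) ->
  (forall t, ~ N t -> forall e : R, (0 < e)%R ->
     exists m1, forall m, (m1 <= m)%N -> (H m t <= F t + e)%R) ->
  L%:E <= \int[mu]_t (F t)%:E.
Proof.
move=> mH HC HL mN N0 F0 HF.
pose B m t : \bar R := (C - H m t)%:E.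
have mB m : measurable_fun setT (B m).
  by apply/measurable_EFinP; apply: measurable_funB.
have B0 m t : 0 <= B m t by rewrite lee_fin subr_ge0; case/andP: (HC m t).
pose h t := limn_einf (B ^~ t).
have h0 t : 0 <= h t by apply: (@limn_einf_ge _ _ 0%N) => m _; exact: B0.
have hC t : h t <= C%:E.
  apply: (@limn_einf_le _ _ 0%N) => m _; rewrite lee_fin lerBlDr lerDl.
  by case/andP: (HC m t).
have mh : measurable_fun setT h.
  apply: measurableT_comp => //; apply: measurable_fun_limn_esup => m.
  exact: measurableT_comp.
have hfin t : h t \is a fin_num by rewrite ge0_fin_numE ?(le_lt_trans (hC t)) ?ltry.
have ih : \int[mu]_t h t <= (C - L)%:E.
  apply: le_trans (fatou mu measurableT mB (fun m t _ => B0 m t)) _.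
  apply: (@limn_einf_le _ _ m0) => m /HL; set a := \int[mu]_t (H m t)%:E => La.
  have aB : a + \int[mu]_t B m t = C%:E.
    rewrite -ge0_integralD//; last 2 first.
    - by move=> t _; rewrite lee_fin; case/andP: (HC m t).
    - exact/measurable_EFinP.
    under eq_integral do rewrite /B -EFinD addrC subrK.
    exact: integral_cst_probability.
  have B0' : 0 <= \int[mu]_t B m t by apply: integral_ge0.
  have a0 : 0 <= a by apply: integral_ge0 => t _; rewrite lee_fin; case/andP: (HC m t).
  move: (\int[mu]_t B m t) a B0' a0 La aB => [b||] [a||]//= _ _ La [aB].
  by rewrite lee_fin -aB; move: La; rewrite lee_fin; lra.
have Ch0 t : 0 <= C%:E - h t by rewrite sube_ge0// hfin orbT.
have mCh : measurable_fun setT (fun t => C%:E - h t) by exact: emeasurable_funB.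
have hD : \int[mu]_t h t + \int[mu]_t (C%:E - h t) = C%:E.
  rewrite -ge0_integralD//.
  under eq_integral do rewrite addeC subeK//.
  exact: integral_cst_probability.
have LC : L%:E <= \int[mu]_t (C%:E - h t).
  have C0 : 0 <= \int[mu]_t (C%:E - h t).
    by apply: integral_ge0.
  have h0' : 0 <= \int[mu]_t h t by apply: integral_ge0.
  move: (\int[mu]_t h t) (\int[mu]_t (C%:E - h t)) C0 h0' ih hD => [b||] [a||]//=.
  by move=> _ _; rewrite !lee_fin => bC [ab]; lra.
apply: le_trans LC _.
rewrite (ge0_negligible_integral mN measurableT mCh _ N0)//.
rewrite integral_mkcond; apply: ge0_le_integral_nomeas => t; rewrite patchE.
  by case: ifPn.
case: ifPn => [/set_mem [_ Nt]|_]; last by rewrite lee_fin.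
rewrite leeBlDr//; apply/lee_addgt0Pr => e e0.
have [m1 hm1] := HF _ Nt _ e0.
have : (C - F t - e)%:E <= h t.
  apply: (@limn_einf_ge _ _ m1) => m /hm1; rewrite lee_fin; lra.
rewrite -(fineK (hfin t)) !lee_fin; lra.
Qed.

End reverse_fatou.

Section uniform_box.
Variables (R : realType) (r : R).
Hypothesis r0 : 0 < r.

Let r2 : - r < r. Proof. by rewrite gtrN. Qed.

Definition box : probability R R := distribution (uniform_prob r2) (@toR R).

Lemma box_small x h : 0 <= h -> (box [set y | (`|y - x| <= h)%R] <= (h / r)%:E)%E.
Proof.
move=> h0; rewrite (_ : [set y | _] = `[x - h, x + h]%classic); last first.
  by apply/seteqP; split => y /=; rewrite in_itv /= ler_distl.
apply: (@le_trans _ _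
    (\int[lebesgue_measure]_(y in `[(x - h)%R, (x + h)%R]) ((2 * r)^-1)%:E)%E).
  rewrite /box /distribution /pushforward/= /uniform_prob.
  rewrite integral_mkcond [leRHS]integral_mkcond.
  apply: ge0_le_integral_nomeas => y; rewrite !patchE.
    by case: ifP => // _; rewrite lee_fin uniform_pdf_ge0.
  case: ifP => // _; rewrite lee_fin /uniform_pdf; case: ifP => _.
    by rewrite opprK -mulr2n -(mulr_natl r).
  by rewrite invr_ge0 mulr_ge0// ltW.
rewrite integral_cst//= lebesgue_measure_itv/= lte_fin.
case: ifPn => _; last by rewrite mule0 lee_fin divr_ge0// ltW.
rewrite -EFinD -EFinM lee_fin le_eqVlt; apply/orP; left; apply/eqP.
by field; rewrite gt_eqF.
Qed.

Lemma box_full : box `[- r, r]%classic = 1%E.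
Proof. by rewrite /box /distribution /pushforward/= /uniform_prob integral_uniform_pdf1. Qed.

End uniform_box.
Arguments box : simpl never.

(** * Resampling one entry *)

Section gaussian_ball.
Variables (R : realType) (sigma v : R).
Hypothesis sigma_gt0 : 0 < sigma.
Hypothesis v_gt0 : 0 < v.
Hypothesis sigmaE : 2 * sigma ^+ 2 = v^-1.

(** The density is sqrt(v / pi) exp(-v x^2). On the interval x^2 <= 2 a^2 + 2 h^2, and pi <= 4
    bounds the peak below by sqrt v / 2. *)
Lemma gauss_interval_ge (a h : R) : 0 <= h ->
  ((h * Num.sqrt v * expR (- (2 * v * a ^+ 2 + 2 * v * h ^+ 2)))%:E <=
   gauss sigma [set x | (`|x - a| <= h)%R])%E.
Proof.
move=> h0; rewrite (_ : [set y | _] = `[a - h, a + h]%classic); last first.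
  by apply/seteqP; split => y /=; rewrite in_itv /= ler_distl.
have peak : Num.sqrt v / 2 <= normal_peak sigma.
  rewrite /normal_peak -[leLHS]invrK lef_pV2 ?posrE ?invr_gt0 ?divr_gt0 ?sqrtr_gt0//.
    rewrite invf_div ler_pdivlMr ?sqrtr_gt0// -sqrtrM; last first.
      by rewrite mulrn_wge0// mulr_ge0 ?sqr_ge0 ?pi_ge0.
    have -> : sigma ^+ 2 * pi *+ 2 * v = pi :> R.
      by rewrite -mulrnAl -mulr_natl sigmaE mulrC mulrA divff ?mul1r ?gt_eqF.
    have -> : (2 : R) = Num.sqrt (2 ^+ 2) by rewrite sqrtr_sqr ger0_norm.
    rewrite ler_wsqrtr//; have := pihalf_lt2 R; lra.
  by rewrite mulrn_wgt0// mulr_gt0 ?exprn_gt0 ?pi_gt0.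
pose m := Num.sqrt v / 2 * expR (- (2 * v * a ^+ 2 + 2 * v * h ^+ 2)).
apply: (@le_trans _ _
    (\int[lebesgue_measure]_(y in `[(a - h)%R, (a + h)%R]) m%:E)%E).
  rewrite integral_cst//= lebesgue_measure_itv/= lte_fin.
  case: ifPn => [_|].
    rewrite -EFinD -EFinM lee_fin le_eqVlt; apply/orP; left; apply/eqP.
    by rewrite /m; field.
  rewrite -leNgt => ah; have -> : h = 0 by lra.
  by rewrite !mul0r mule0.
rewrite /gauss /distribution /pushforward/= /normal_prob.
rewrite integral_mkcond [leRHS]integral_mkcond.
apply: ge0_le_integral_nomeas => y; rewrite !patchE.
  by case: ifP => // _; rewrite lee_fin mulr_ge0 ?expR_ge0 ?divr_ge0 ?sqrtr_ge0.
case: ifPn => // /set_mem/=; rewrite in_itv/= => /andP[y1 y2].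
rewrite lee_fin normal_pdfE ?gt_eqF// -[leRHS]/(normal_peak sigma * normal_fun 0 sigma y).
rewrite /m.
apply: ler_pM => //; rewrite ?expR_ge0 ?divr_ge0 ?sqrtr_ge0//.
rewrite /normal_fun ler_expR -[sigma ^+ 2 *+ 2]mulr_natl sigmaE invrK subr0 mulNr lerN2.
have -> : 2 * v * a ^+ 2 + 2 * v * h ^+ 2 = (2 * a ^+ 2 + 2 * h ^+ 2) * v by ring.
rewrite ler_wpM2r ?(ltW v_gt0)//.
have : 0 <= (h - (y - a)) * (h + (y - a)) by apply: mulr_ge0; lra.
have := sqr_ge0 (y - a - a); lra.
Qed.

(** The disc contains the square of half side eps / 2, which accounts for the factor 1/4; the
    remaining exponent v eps^2 <= 1 costs e^-1. *)
Lemma cgauss_ball_ge (w : R[i]) (eps : R) (A : set (R * R)) :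
  measurable A -> 0 < eps -> v * eps ^+ 2 <= 1 ->
  (forall z, nrm (toC z - w) < eps -> A z) ->
  ((eps ^+ 2 * (v / 4 * expR (- 1) * expR (- (2 * v * nrm w ^+ 2))))%:E <=
   cgauss sigma A)%E.
Proof.
move=> mA e0 ve hA; pose h := eps / 2.
have h0 : 0 <= h by rewrite divr_ge0 ?(ltW e0).
apply: (@le_trans _ _ (cgauss sigma (square w h))); last first.
  apply: le_measure; rewrite ?inE//; first exact: measurable_square.
  move=> z [z1 z2]; apply: hA.
  rewrite -(ltr_pXn2r (n := 2)) ?nnegrE ?nrm_ge0 ?(ltW e0)// nrm_sqr.
  have -> : complex.Re (toC z - w) = z.1 - complex.Re w by case: (w).
  have -> : complex.Im (toC z - w) = z.2 - complex.Im w by case: (w).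
  have sq x : `|x| <= h -> x ^+ 2 <= h ^+ 2.
    by move=> xh; rewrite -real_normK ?num_real// lerXn2r ?nnegrE.
  have := sq _ z1; have := sq _ z2.
  have -> : h ^+ 2 = eps ^+ 2 / 4 by rewrite /h; field.
  have : 0 < eps ^+ 2 by rewrite exprn_gt0.
  lra.
have mI x : measurable [set y : R | `|y - x| <= h].
  rewrite (_ : [set y | _] = `[x - h, x + h]%classic); first exact: measurable_itv.
  by apply/seteqP; split => y /=; rewrite in_itv /= ler_distl.
have -> : cgauss sigma (square w h) =
    (gauss sigma [set y | (`|y - complex.Re w| <= h)%R] *
     gauss sigma [set y | (`|y - complex.Im w| <= h)%R])%E.
  exact: product_measure1E.
have lb0 (a : R) : (0 <= (h * Num.sqrt v * expR (- (2 * v * a ^+ 2 + 2 * v * h ^+ 2)))%:E)%E.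
  by rewrite lee_fin mulr_ge0 ?expR_ge0// mulr_ge0 ?sqrtr_ge0.
apply: le_trans (lee_pmul (lb0 _) (lb0 _) (gauss_interval_ge _ h0) (gauss_interval_ge _ h0)).
rewrite -EFinM lee_fin [leRHS]mulrACA -expRD [X in _ <= X * _]mulrACA.
rewrite -!expr2 sqr_sqrtr ?(ltW v_gt0)//.
have -> : eps ^+ 2 * (v / 4 * expR (- 1) * expR (- (2 * v * nrm w ^+ 2))) =
    h ^+ 2 * v * expR (- 1 - 2 * v * nrm w ^+ 2).
  by rewrite expRD /h; field.
apply: ler_wpM2l; first by rewrite mulr_ge0 ?sqr_ge0 ?(ltW v_gt0).
rewrite ler_expR nrm_sqr.
have -> : h ^+ 2 = eps ^+ 2 / 4 by rewrite /h; field.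
have -> : 2 * v * (eps ^+ 2 / 4) = v * eps ^+ 2 / 2 by field.
lra.
Qed.

End gaussian_ball.

(** * Degrees and Wronskians of characteristic polynomials and cofactors *)

Section characteristic_polynomial.
Variable R : realType.
Local Notation C := R[i].

Lemma size_det_le (F : idomainType) m (A : 'M[{poly F}]_m) :
  (forall i j, (size (A i j) <= 2)%N) -> (size (\det A) <= m.+1)%N.
Proof.
move=> sA; apply: (leq_trans (size_sum _ _ _)); apply/bigmax_leqP => s _.
rewrite size_Msign.
apply: (leq_trans (size_poly_prod_leq _ _)); rewrite leq_subLR.
rewrite card_ord addnS ltnS; apply: (@leq_trans (\sum_(i < m) 2)).
  by apply: leq_sum => i _; exact: sA.
by rewrite sum_nat_const card_ord muln2 addnn.
Qed.

Lemma size_cofactor_char_poly_mx n (M : 'M[C]_n) j k :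
  (size (cofactor (char_poly_mx M) j k) <= n)%N.
Proof.
case: n M j k => [M []//|n M j k].
rewrite /cofactor size_Msign; apply: size_det_le => a b.
rewrite !mxE; apply: (leq_trans (size_polyD _ _)); rewrite size_polyN geq_max.
rewrite (leq_trans (size_polyC_leq1 _))// andbT.
by case: eqP => _; rewrite ?mulr1n ?mulr0n ?size_polyX ?size_poly0.
Qed.

(* Compare the coefficients of [X (p' q - p q')] in degree [deg p + deg q]. *)
Lemma wronskian_neq0 (p q : {poly C}) : q != 0 -> (size q < size p)%N ->
  p^`() * q - p * q^`() != 0.
Proof.
move=> q0 qp; apply/negP => /eqP W0.
have p0 : p != 0 by rewrite -size_poly_gt0 (leq_ltn_trans _ qp).
have euler (f : {poly C}) : f != 0 -> exists2 g,
    f^`() * 'X = (size f).-1%:R *: f + g & (size g < size f)%N.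
  move=> f0; exists (f^`() * 'X - (size f).-1%:R *: f); first by rewrite addrC subrK.
  rewrite -[X in (_ < X)%N](@prednK (size f)) ?size_poly_gt0// ltnS.
  apply/leq_sizeP => i; rewrite leq_eqVlt => /orP[/eqP <-|hi].
    rewrite coefB coefZ coefMX coef_deriv.
    case: (size f).-1 => [|m] /=; first by rewrite mul0r subr0.
    by rewrite mulr_natl subrr.
  rewrite coefB coefZ coefMX coef_deriv.
  have fi : f`_i = 0 by rewrite nth_default// -(@prednK (size f)) ?size_poly_gt0.
  by case: i hi fi => [|i] //= _ ->; rewrite mul0rn mulr0 subr0.
have [a E1 s1] := euler _ p0; have [b E2 s2] := euler _ q0.
have pq : size (p * q) = (size p + size q).-1 by exact: size_mul.
have E : ((size p).-1%:R - (size q).-1%:R) *: (p * q) = - (a * q - p * b).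
  apply/eqP; rewrite -subr_eq0 opprK; apply/eqP.
  transitivity ((p^`() * q - p * q^`()) * 'X); last by rewrite W0 mul0r.
  transitivity (p^`() * 'X * q - p * (q^`() * 'X)); last by ring.
  by rewrite E1 E2 -!mul_polyC polyCB; ring.
have q1 : (0 < size q)%N by rewrite size_poly_gt0.
have : (size (((size p).-1%:R - (size q).-1%:R) *: (p * q))%R < size (p * q)%R)%N.
  rewrite E size_polyN pq.
  apply: (leq_ltn_trans (size_polyD _ _)); rewrite size_polyN gtn_max.
  have p1 : (0 < size p)%N by exact: leq_ltn_trans qp.
  apply/andP; split; apply: (leq_ltn_trans (size_polyMleq _ _));
    rewrite -ltnS !prednK ?addn_gt0 ?q1 ?p1 ?orbT// ?ltn_add2r ?ltn_add2l//.
rewrite size_scale ?ltnn// subr_eq0 eqr_nat gtn_eqF// -ltnS !prednK//.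
exact: leq_ltn_trans qp.
Qed.

End characteristic_polynomial.

Lemma measurable_lt d (D : measurableType d) (R : realType) (f g : D -> R) :
  measurable_fun setT f -> measurable_fun setT g -> measurable [set x | f x < g x].
Proof.
move=> mf mg; have := measurable_fun_ltr mf mg measurableT (Y := [set true]).
by rewrite setTI; apply.
Qed.

Section random_char_poly.
Variables (R : realType) (K : finType) (n : nat) (phi : 'I_n * 'I_n -> K).
Hypothesis phi_inj : injective phi.
Local Notation C := R[i].
Local Notation S := (state R (K * bool)%type).
Variables j k : 'I_n.

Definition rchi (t : S) : {poly C} := char_poly (subm phi t).
Definition rcof (t : S) : {poly C} := cofactor (char_poly_mx (subm phi t)) j k.

(* The value of the entry [(j, k)] that makes [x] an eigenvalue; junk if the
   cofactor vanishes at [x]. *)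
Definition rpivot (t : S) (x : C) : C :=
  zc t (phi (j, k)) + (rchi t).[x] / (rcof t).[x].

Definition rwronsk (t : S) : {poly C} :=
  (rchi t)^`() * rcof t - rchi t * (rcof t)^`().

Lemma rcof_updC z t : rcof (updC (phi (j, k)) z t) = rcof t.
Proof. by apply: cofactor_row_free. Qed.

Lemma rchi_updC z t : rchi (updC (phi (j, k)) z t) =
  rchi t - (toC z - zc t (phi (j, k)))%:P * rcof t.
Proof. by apply: det_updC. Qed.

Lemma near_root_resample (eps del : R) (t : S) (z z' : R * R) :
  0 < eps -> eps <= del -> (rcof t).[toC z] != 0 ->
  del * (nrm (rcof t).[toC z] + nrm (rcof t)^`().[toC z]) * nrm (rcof t).[toC z] <
    nrm (rwronsk t).[toC z] ->
  nrm (toC z' - rpivot t (toC z)) < eps ->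
  near_root (rchi (updC (phi (j, k)) z' t)) (rcof (updC (phi (j, k)) z' t)) eps del z.
Proof.
set x := toC z => eps0 ed q0 Wbig close.
rewrite /near_root /= rcof_updC rchi_updC -/x; set c := toC z' - _.
set q := rcof t in q0 Wbig *; set p := rchi t.
have q0' : 0 < nrm q.[x] by rewrite nrm_gt0.
have E1 : (p - c%:P * q).[x] = - (toC z' - rpivot t x) * q.[x].
  rewrite hornerD hornerN hornerM hornerC /rpivot -/p -/q /c; field; exact: q0.
have small : nrm (p - c%:P * q).[x] < eps * nrm q.[x].
  by rewrite E1 nrmM nrmN ltr_pM2r.
split => //; rewrite -(ltr_pM2r q0').
(* Moving along the pencil does not change the Wronskian with q. The error term (p - c q) q' is at
   most delta |q| |q'| because eps <= delta, which is why |q'| enters the condition on W. *)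
have E2 : (p - c%:P * q)^`().[x] * q.[x] =
    (rwronsk t).[x] + (p - c%:P * q).[x] * q^`().[x].
  by rewrite /rwronsk -/p -/q derivB derivM derivC !(hornerD, hornerN, hornerM, hornerC, horner0); ring.
rewrite -nrmM E2.
have h1 : nrm (rwronsk t).[x] - nrm ((p - c%:P * q).[x] * q^`().[x]) <=
    nrm ((rwronsk t).[x] + (p - c%:P * q).[x] * q^`().[x]).
  by have := nrm_sub_dist (rwronsk t).[x] (- ((p - c%:P * q).[x] * q^`().[x])); rewrite nrmN opprK.
apply: lt_le_trans h1; rewrite nrmM.
have h2 : nrm (p - c%:P * q).[x] * nrm q^`().[x] <= del * nrm q.[x] * nrm q^`().[x].
  apply: ler_wpM2r; first exact: nrm_ge0.
  by apply: le_trans (ltW small) _; rewrite ler_wpM2r// nrm_ge0.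
rewrite ltrBrDr (le_lt_trans _ Wbig)//.
apply: le_trans (lerD (lexx _) h2) _.
by rewrite le_eqVlt; apply/orP; left; apply/eqP; ring.
Qed.

Local Notation SD := (S * (R * R))%type.

Let x (p : SD) : C := toC p.2.

Let mx : cmeasurable x.
Proof. exact: (cmeasurable_comp (@cmeasurable_toC R) measurable_snd). Qed.

Let horner_measurable (f : S -> {poly C}) :
  pmeasurable f -> (forall t, (size (f t) <= n.+1)%N) ->
  cmeasurable (fun p : SD => (f p.1).[x p]).
Proof.
move=> mf sf; apply: (cmeasurable_horner (m := n.+1)) => // i.
exact: (cmeasurable_comp (mf i) measurable_fst).
Qed.

Let size_deriv_le (f : {poly C}) : (size f <= n.+1)%N -> (size f^`() <= n.+1)%N.
Proof. by move=> h; rewrite (leq_trans (size_poly _ _))// (leq_trans (leq_pred _)). Qed.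

Let s1 t : (size (rchi t) <= n.+1)%N.
Proof. by rewrite size_char_poly. Qed.

Let s2 t : (size (rcof t) <= n.+1)%N.
Proof. by rewrite (leq_trans (size_cofactor_char_poly_mx _ _ _)). Qed.

Let p1 : pmeasurable rchi. Proof. exact: pmeasurable_char_poly. Qed.

Let p2 : pmeasurable rcof.
Proof. by apply: pmeasurable_cofactor => *; exact: pmeasurable_char_poly_mx. Qed.

Let m1 : cmeasurable (fun p : SD => (rchi p.1).[x p]).
Proof. exact: horner_measurable. Qed.

Let m2 : cmeasurable (fun p : SD => (rcof p.1).[x p]).
Proof. exact: horner_measurable. Qed.

Let m3 : cmeasurable (fun p : SD => (rchi p.1)^`().[x p]).
Proof.
apply: (horner_measurable (f := fun t => (rchi t)^`())).
  exact: pmeasurable_deriv.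
by move=> t; exact: size_deriv_le.
Qed.

Let m4 : cmeasurable (fun p : SD => (rcof p.1)^`().[x p]).
Proof.
apply: (horner_measurable (f := fun t => (rcof t)^`())).
  exact: pmeasurable_deriv.
by move=> t; exact: size_deriv_le.
Qed.

Let mW : cmeasurable (fun p : SD => (rwronsk p.1).[x p]).
Proof.
rewrite (_ : (fun p => _) = fun p : SD => (rchi p.1)^`().[x p] * (rcof p.1).[x p] -
    (rchi p.1).[x p] * (rcof p.1)^`().[x p]).
  by apply: cmeasurableB; exact: cmeasurableM.
by apply/funext => p; rewrite /rwronsk !(hornerD, hornerN, hornerM).
Qed.

Lemma measurable_near_root (eps del : R) :
  measurable [set p : SD | near_root (rchi p.1) (rcof p.1) eps del p.2].
Proof.
apply: measurableI; apply: measurable_lt.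
- exact: measurable_nrm.
- by apply: measurable_funM => //; exact: measurable_nrm.
- by apply: measurable_funM => //; exact: measurable_nrm.
- exact: measurable_nrm.
Qed.

Lemma measurable_degenerate : measurable [set p : SD |
  (rcof p.1).[toC p.2] != 0 /\ (rwronsk p.1).[toC p.2] = 0].
Proof.
have mq : measurable [set p : SD | (rcof p.1).[x p] != 0].
  rewrite (_ : [set p | _] = ~` [set p : SD | (rcof p.1).[x p] = 0]).
    by apply: measurableC; exact: cmeasurable_eq0.
  by apply/seteqP; split => p /= /eqP.
by apply: (measurableI _ _ mq); exact: cmeasurable_eq0.
Qed.

Variables (sigma : R).
Hypothesis sigma_gt0 : 0 < sigma.
Hypothesis n_gt0 : (0 < n)%N.
Hypothesis sigmaE : 2 * sigma ^+ 2 = n%:R^-1.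

(* Bounds [eps ^- 2] times the conditional probability of [near_root] given all
   entries but [(j, k)] from below, up to the factor [\1_(wronskian_large del)]. *)
Definition pivot_density (t : S) (x : C) : R :=
  n%:R / 4 * expR (- 1) * ((rcof t).[x] != 0)%:R *
  expR (- (2 * n%:R * nrm (rpivot t x) ^+ 2)).

Definition wronskian_large (del : R) : set SD := [set p |
  del * (nrm (rcof p.1).[toC p.2] + nrm (rcof p.1)^`().[toC p.2]) *
     nrm (rcof p.1).[toC p.2] < nrm (rwronsk p.1).[toC p.2]].

Lemma measurable_wronskian_large del : measurable (wronskian_large del).
Proof.
apply: measurable_lt; last exact: measurable_nrm.
apply: measurable_funM; last exact: measurable_nrm.
by apply: measurable_funM => //; apply: measurable_funD; exact: measurable_nrm.
Qed.

Lemma pivot_density_ge0 t y : 0 <= pivot_density t y.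
Proof. by rewrite !mulr_ge0 ?expR_ge0. Qed.

Lemma measurable_pivot_density : measurable_fun setT (fun p : SD => pivot_density p.1 (toC p.2)).
Proof.
apply: measurable_funM.
  by apply: measurable_funM => //; exact: measurable_neq0.
apply: measurableT_comp => //; apply: measurableT_comp => //.
apply: measurable_funM => //; apply: measurable_funX; apply: measurable_nrm.
apply: cmeasurableD; last by apply: cmeasurableM => //; exact: cmeasurableV.
have mz := @cmeasurable_zc R K (phi (j, k)).
exact: (cmeasurable_comp mz measurable_fst).
Qed.

Lemma near_root_resample_ge (eps del : R) (t : S) (z : R * R) :
  0 < eps -> eps <= del -> n%:R * eps ^+ 2 <= 1 ->
  ((eps ^+ 2 * (pivot_density t (toC z) * \1_(wronskian_large del) (t, z)))%:E <=
   \int[cgauss sigma]_z' (\1_[set p : SD | near_root (rchi p.1) (rcof p.1) eps del p.2]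
      (updC (phi (j, k)) z' t, z))%:E)%E.
Proof.
move=> eps0 ed neps; rewrite indicE.
have nn : (0 < n%:R :> R) by rewrite ltr0n.
case: (boolP ((t, z) \in wronskian_large del)) => [/set_mem /= W|_]; last first.
  by rewrite !mulr0; apply: integral_ge0 => z' _; rewrite lee_fin.
rewrite mulr1 /pivot_density.
have [q0|q0] := eqVneq (rcof t).[toC z] 0.
  rewrite mulr0 mul0r mulr0; apply: integral_ge0 => z' _; rewrite lee_fin//.
rewrite mulr1.
pose A := [set z' : R * R | near_root (rchi (updC (phi (j, k)) z' t))
  (rcof (updC (phi (j, k)) z' t)) eps del z].
have mA : measurable A.
  have mh : measurable_fun setT (fun z' : R * R => (updC (phi (j, k)) z' t, z)).
    apply/measurable_fun_pairP; split; last exact: measurable_cst.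
    exact: (@measurable_updC R K _ (R * R)%type (phi (j, k)) id (fun=> t)).
  by have := mh measurableT _ (measurable_near_root eps del); rewrite setTI.
rewrite (_ : \int[_]_z' _ = cgauss sigma A)%E; last first.
  by rewrite -[A]setIT -integral_indic//; apply: eq_integral => z' _.
by apply: (cgauss_ball_ge sigma_gt0 nn) => // z'; exact: near_root_resample.
Qed.

End random_char_poly.

(** * The second moment of the condition numbers *)

Section condition_number_moment.
Variables (R : realType) (K : finType) (n' : nat).
Let n := n'.+1.
Variables (phi : 'I_n * 'I_n -> K) (sigma r : R).
Hypothesis phi_inj : injective phi.
Hypothesis sigma_gt0 : 0 < sigma.
Hypothesis sigmaE : 2 * sigma ^+ 2 = n%:R^-1.
Local Notation C := R[i].
Local Notation S := (state R (K * bool)%type).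
Variables (mu : probability S R) (U : probability R R).
Hypothesis mu_resampling : resampling sigma mu.
Hypothesis r0 : 0 < r.
Hypothesis U_small : forall x h, 0 <= h ->
  (U [set y | (`|y - x| <= h)%R] <= (h / r)%:E)%E.
Let nu : probability (R * R)%type R := (U \x U)%E.
Let Pi : probability (S * (R * R))%type R := (mu \x nu)%E.
Local Notation SD := (S * (R * R))%type.
Implicit Types (a : 'I_n * 'I_n) (t : S) (p : SD) (z : R * R) (m : nat).

Let near a t := near_root (rchi phi t) (rcof phi a.1 a.2 t).

Let measurable_near a t eps del : measurable (near a t eps del).
Proof.
have := measurable_xsection t (measurable_near_root phi a.1 a.2 eps del).
by rewrite xsectionE.
Qed.

(** The conditional probability of the event given the matrix t, divided by eps^2, with eps = 1 / (m
    + 1). *)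
Let density a del m t : R := m.+1%:R ^+ 2 * fine (nu (near a t m.+1%:R^-1 del)).

Let density_EFin a del m t : (density a del m t)%:E =
  ((m.+1%:R ^+ 2)%:E * nu (near a t m.+1%:R^-1 del))%E.
Proof. by rewrite /density EFinM fineK// fin_num_measure. Qed.

Let measurable_density a del m : measurable_fun setT (density a del m).
Proof.
apply: measurable_funM => //; apply: measurableT_comp; first exact: fine_measurable.
have mA := measurable_near_root phi a.1 a.2 m.+1%:R^-1 del.
rewrite (_ : (fun t => _) = nu \o xsection [set p | near_root (rchi phi p.1)
  (rcof phi a.1 a.2 p.1) m.+1%:R^-1 del p.2]); first exact: measurable_fun_xsection.
by apply/funext => t /=; rewrite xsectionE.
Qed.

Let density_bounded a del m t : 0 < del ->
  0 <= density a del m t <= n%:R * (n%:R / del / r) ^+ 2.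
Proof.
move=> del0; apply/andP; split.
  by rewrite mulr_ge0 ?sqr_ge0// fine_ge0.
have [D chiE] : exists D : 'I_n -> C, rchi phi t = \prod_i ('X - (D i)%:P).
  exists (fun i => (eigenvalues (subm phi t))`_i).
  by rewrite /rchi char_poly_eigenvalues (big_nth 0) size_eigenvalues big_mkord.
have e0 : 0 < m.+1%:R^-1 :> R by rewrite invr_gt0.
have mn := fun eps del => measurable_near a t eps del.
rewrite /near chiE in mn.
have := near_root_coarse r0 U_small mn e0 del0.
rewrite -lee_fin density_EFin /near chiE => h.
have m0 : (0 <= (m.+1%:R ^+ 2)%:E :> \bar R)%E by rewrite lee_fin.
apply: le_trans (lee_wpmul2l m0 h) _.
by rewrite -EFinM lee_fin mulrA -exprMn divff ?expr1n ?mul1r.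
Qed.

Let kappa2 t : R :=
  \sum_(i < n) eigencond (subm phi t) (eigenvalues (subm phi t))`_i ^+ 2.

(** Adding [near_root_fine] over the n^2 positions and all eigenvalues reproduces the cofactor
    formula of [sum_sqr_eigencond]; e is shared equally among the positions. *)
Let density_limsup del t e : 0 < del -> 0 < e ->
  coprimep (rchi phi t) (rchi phi t)^`() ->
  exists m1, forall m, (m1 <= m)%N ->
    \sum_a density a del m t <= kappa2 t / r ^+ 2 + e.
Proof.
move=> del0 e0 /sum_sqr_eigencond [D [iD chiE kE]].
pose b a l := nrm (cofactor ((D l)%:M - subm phi t) a.1 a.2) /
   nrm (\prod_(l' | l' != l) (D l - D l')).
have kE' : kappa2 t / r ^+ 2 = \sum_a \sum_l (b a l / r) ^+ 2.
  rewrite /kappa2 kE exchange_big/=.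
  under eq_bigr do rewrite exchange_big/=.
  rewrite pair_big/= mulr_suml; apply: eq_bigr => -[j k] _ /=.
  by rewrite mulr_suml; apply: eq_bigr => l _; rewrite [RHS]expr_div_n.
pose e' := e / (n * n)%:R.
have nn0 : 0 < (n * n)%:R :> R by rewrite ltr0n.
have e'0 : 0 < e' by rewrite divr_gt0.
have h a : exists m1, forall m, (m1 <= m)%N ->
    density a del m t <= \sum_l (b a l / r) ^+ 2 + e'.
  have mn := fun eps del => measurable_near a t eps del.
  rewrite /near [rchi _ _]chiE in mn.
  have [e1 e10 he1] := near_root_fine r0 U_small mn iD del0 e'0.
  exists (Num.truncn e1^-1).+1 => m hm.
  have m0 : 0 < m.+1%:R^-1 :> R by rewrite invr_gt0.
  have me : m.+1%:R^-1 < e1.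
    rewrite invf_plt ?posrE// (lt_le_trans (truncnS_gt _))//.
    by rewrite ler_nat (leq_trans hm).
  have := he1 _ m0 me.
  rewrite -lee_fin density_EFin /near [rchi _ _]chiE => h.
  have m2 : (0 <= (m.+1%:R ^+ 2)%:E :> \bar R)%E by rewrite lee_fin.
  apply: le_trans (lee_wpmul2l m2 h) _.
  rewrite -EFinM lee_fin mulrA -exprMn divff ?expr1n ?mul1r// lerD2r.
  apply: ler_sum => l _; rewrite /b /rcof horner_cofactor horner_prod.
  by under eq_bigr do rewrite hornerXsubC.
have [m1 hm1] := choice h.
exists (\max_a m1 a) => m hm; rewrite kE'.
have eE : e = \sum_(a : 'I_n * 'I_n) e'.
  by rewrite sumr_const card_prod !card_ord -[RHS]mulr_natr /e' divfK// gt_eqF.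
rewrite [X in _ + X]eE -big_split /=; apply: ler_sum => a _.
by apply: hm1; apply: leq_trans hm; exact: leq_bigmax.
Qed.

(** The two orders of integration meet here: the density integrates over x first, while by Fubini x
    may be fixed and entry a of the matrix redrawn. *)
Let density_integral del a m : m.+1%:R^-1 <= del -> n%:R * m.+1%:R^-1 ^+ 2 <= 1 :> R ->
  (\int[Pi]_p (pivot_density phi a.1 a.2 p.1 (toC p.2) * \1_(wronskian_large phi a.1 a.2 del) p)%:E <=
   \int[mu]_t (density a del m t)%:E)%E.
Proof.
move=> mdel mn; set eps := m.+1%:R^-1 in mdel mn.
have eps0 : 0 < eps by rewrite invr_gt0.
pose A := [set p : SD | near_root (rchi phi p.1) (rcof phi a.1 a.2 p.1) eps del p.2].
have mA : measurable A by exact: measurable_near_root.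
have m2 : (0 <= (m.+1%:R ^+ 2)%:E :> \bar R)%E by rewrite lee_fin.
have -> : (\int[mu]_t (density a del m t)%:E)%E = ((m.+1%:R ^+ 2)%:E * Pi A)%E.
  under eq_integral do rewrite density_EFin.
  have mx := measurable_fun_xsection nu mA.
  have xE : (fun t => nu (near a t eps del)) = nu \o xsection A.
    by apply/funext => t /=; rewrite xsectionE.
  rewrite (eq_integral (fun t => (m.+1%:R ^+ 2)%:E * (nu \o xsection A) t)%E).
    exact: (ge0_integralZl _ measurableT mx).
  by move=> t _; rewrite -xE.
have -> : Pi A = (\int[nu]_z \int[mu]_t (\1_A (t, z))%:E)%E.
  have <- : (\int[Pi]_p (\1_A p)%:E = Pi A)%E.
    by rewrite (integral_indic _ measurableT mA) setIT.
  apply: (fubini_tonelli2 (fun p => (\1_A p)%:E)) => //.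
  by apply/measurable_EFinP; exact: measurable_indic.
pose g p := pivot_density phi a.1 a.2 p.1 (toC p.2) * \1_(wronskian_large phi a.1 a.2 del) p.
have g0 p : (0 <= (g p)%:E)%E by rewrite lee_fin mulr_ge0// pivot_density_ge0.
have mg : measurable_fun setT (EFin \o g).
  apply/measurable_EFinP; apply: measurable_funM; first exact: measurable_pivot_density.
  by apply: measurable_indic; exact: measurable_wronskian_large.
have -> : (\int[Pi]_p (g p)%:E)%E = (\int[nu]_z \int[mu]_t (g (t, z))%:E)%E.
  by apply: (fubini_tonelli2 (EFin \o g)).
have e2 : (0 <= (eps ^+ 2)%:E :> \bar R)%E by rewrite lee_fin sqr_ge0.
have mG : measurable_fun setT (fun z => \int[mu]_t (g (t, z))%:E)%E.
  exact: (measurable_fun_fubini_tonelli_G (m1 := mu) (EFin \o g)).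
have G0 z : (0 <= \int[mu]_t (g (t, z))%:E)%E by exact: integral_ge0.
have le1 : ((eps ^+ 2)%:E * \int[nu]_z \int[mu]_t (g (t, z))%:E <=
    \int[nu]_z \int[mu]_t (\1_A (t, z))%:E)%E.
  rewrite -(ge0_integralZl _ measurableT mG (fun z _ => G0 z) e2).
  apply: ge0_le_integral_nomeas => z; first exact: mule_ge0.
  have mgz : measurable_fun setT (fun t => (g (t, z))%:E).
    exact: (measurableT_comp mg (measurable_pair2 z)).
  rewrite -(ge0_integralZl _ measurableT mgz (fun t _ => g0 _) e2).
  rewrite (resampling_complex mu_resampling (phi (a.1, a.2))
    (F := fun t => (\1_A (t, z))%:E)) => [||t]; last 2 first.
  - apply/measurable_EFinP; apply: (measurableT_comp (measurable_indic mA)).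
    exact: measurable_pair2.
  - by rewrite lee_fin.
  apply: ge0_le_integral_nomeas => t; first exact: mule_ge0.
  rewrite -EFinM; exact: (near_root_resample_ge phi_inj).
apply: le_trans (lee_wpmul2l m2 le1); rewrite muleA -EFinM -exprMn.
by rewrite divff// expr1n mul1e.
Qed.

Let G p : R := \sum_a pivot_density phi a.1 a.2 p.1 (toC p.2).

Let Gtrunc del p : R :=
  \sum_a pivot_density phi a.1 a.2 p.1 (toC p.2) * \1_(wronskian_large phi a.1 a.2 del) p.

Let measurable_G : measurable_fun setT G.
Proof. by apply: measurable_sum => a; exact: measurable_pivot_density. Qed.

Let measurable_term del a : measurable_fun setT
  (fun p => pivot_density phi a.1 a.2 p.1 (toC p.2) * \1_(wronskian_large phi a.1 a.2 del) p).
Proof.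
apply: measurable_funM; first exact: measurable_pivot_density.
by apply: measurable_indic; exact: measurable_wronskian_large.
Qed.

Let measurable_Gtrunc del : measurable_fun setT (Gtrunc del).
Proof. by apply: measurable_sum => a. Qed.

Let Gtrunc_ge0 del p : 0 <= Gtrunc del p.
Proof. by apply: sumr_ge0 => a _; rewrite mulr_ge0// pivot_density_ge0. Qed.

Let kappa2_ge0 t : 0 <= kappa2 t.
Proof. by apply: sumr_ge0 => i _; exact: sqr_ge0. Qed.

Let pivot_density_le a t x : pivot_density phi a.1 a.2 t x <= n%:R.
Proof.
rewrite /pivot_density -[leRHS]mulr1; apply: ler_pM; rewrite ?mulr_ge0 ?expR_ge0//.
  rewrite -[leRHS]mulr1; apply: ler_pM; rewrite ?mulr_ge0 ?expR_ge0//.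
    rewrite -[leRHS]mulr1; apply: ler_pM; rewrite ?mulr_ge0 ?expR_ge0//.
      by rewrite ler_pdivrMr// ler_peMr// ler1n.
  by case: (_ != 0).
by rewrite expR_le1 oppr_le0 mulr_ge0 ?sqr_ge0.
Qed.

(** [reverse_fatou] with the inseparable matrices as null set. The densities are bounded by n, so
    the left side is finite and can serve as its real lower bound. *)
Let Gtrunc_integral del : 0 < del ->
  (\int[Pi]_p (Gtrunc del p)%:E <= ((r ^+ 2)^-1)%:E * \int[mu]_t (kappa2 t)%:E)%E.
Proof.
move=> del0.
have Ile : (\int[Pi]_p (Gtrunc del p)%:E <= (\sum_(a : 'I_n * 'I_n) n%:R)%:E)%E.
  rewrite -(integral_cst_probability Pi); apply: ge0_le_integral_nomeas => p.
    by rewrite lee_fin.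
  rewrite lee_fin; apply: ler_sum => a _; apply: le_trans (pivot_density_le a p.1 (toC p.2)).
  by rewrite ler_piMr ?pivot_density_ge0// indicE; case: (_ \in _).
have I0 : (0 <= \int[Pi]_p (Gtrunc del p)%:E)%E.
  by apply: integral_ge0 => p _; rewrite lee_fin.
have Ifin : (\int[Pi]_p (Gtrunc del p)%:E)%E \is a fin_num.
  by rewrite ge0_fin_numE// (le_lt_trans Ile)// ltry.
have r2 : 0 < r ^+ 2 by rewrite exprn_gt0.
rewrite lee_pdivlMl// -(fineK Ifin) -EFinM.
have [mN N0] := inseparable_negligible mu_resampling phi_inj.
(* With eps = 1 / (m + 1), m >= n gives n eps^2 <= 1, and m at least the integer part of 1 / delta
   gives eps <= delta. *)
apply: (reverse_fatou (H := fun m t => r ^+ 2 * \sum_a density a del m t)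
  (C := r ^+ 2 * \sum_(a : 'I_n * 'I_n) n%:R * (n%:R / del / r) ^+ 2)
  (m0 := maxn n (Num.truncn del^-1)) _ _ _ mN N0).
- by move=> m; apply: measurable_funM => //; apply: measurable_sum => a.
- move=> m t; apply/andP; split.
    apply: mulr_ge0; first exact: sqr_ge0.
    by apply: sumr_ge0 => a _; case/andP: (density_bounded a m t del0).
  apply: ler_wpM2l; first exact: sqr_ge0.
  by apply: ler_sum => a _; case/andP: (density_bounded a m t del0).
- move=> m; rewrite geq_max => /andP[nm dm]; rewrite EFinM fineK//.
  have m0 : 0 < m.+1%:R :> R by rewrite ltr0n.
  have mdel : m.+1%:R^-1 <= del.
    rewrite invf_ple ?posrE//; apply: (le_trans (ltW (truncnS_gt _))).
    by rewrite ler_nat ltnS.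
  have mn : n%:R * m.+1%:R^-1 ^+ 2 <= 1 :> R.
    rewrite exprVn ler_pdivrMr ?exprn_gt0// mul1r -natrX ler_nat.
    by rewrite (leq_trans nm)// (leq_trans (leqnSn m))// -[leqLHS]muln1 leq_mul.
  rewrite /Gtrunc; under eq_integral do rewrite -sumEFin.
  under [leRHS]eq_integral do rewrite EFinM.
  have S0 t : (0 <= (\sum_a density a del m t)%:E)%E.
    by rewrite lee_fin sumr_ge0// => a _; case/andP: (density_bounded a m t del0).
  have mS : measurable_fun setT (fun t => (\sum_a density a del m t)%:E).
    by apply/measurable_EFinP; apply: measurable_sum => a.
  have r2e : (0 <= (r ^+ 2)%:E)%E by rewrite lee_fin ltW.
  rewrite (ge0_integralZl _ measurableT mS (fun t _ => S0 t) r2e).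
  apply: lee_wpmul2l => //; under [leRHS]eq_integral do rewrite -sumEFin.
  rewrite ge0_integral_sum//; last 2 first.
  - by move=> a; apply/measurable_EFinP.
  - by move=> a p _; rewrite lee_fin mulr_ge0// pivot_density_ge0.
  rewrite ge0_integral_sum//; last 2 first.
  - by move=> a; apply/measurable_EFinP.
  - by move=> a t _; rewrite lee_fin; case/andP: (density_bounded a m t del0).
  by apply: lee_sum => a _; exact: density_integral.
- exact: kappa2_ge0.
- move=> t /= /negP; rewrite negbK => sep e e0.
  have [m1 hm1] := density_limsup del0 (divr_gt0 e0 r2) sep.
  exists m1 => m /hm1; rewrite -(ler_pM2l r2) => /le_trans; apply.
  by rewrite mulrDr !(mulrC (r ^+ 2)) !divfK ?gt_eqF.
Qed.

(** Where q_jk(x) = 0 the pivot density is already 0, so only the other zeros of the Wronskian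
    obstruct the limit delta -> 0. *)
Let degenerate : set SD := \bigcup_(a in [set: 'I_n * 'I_n]) [set p |
  (rcof phi a.1 a.2 p.1).[toC p.2] != 0 /\ (rwronsk phi a.1 a.2 p.1).[toC p.2] = 0].

Let measurable_degenerate_union : measurable degenerate.
Proof.
by apply: fin_bigcup_measurable => [|a _]; [exact: finite_finset|exact: measurable_degenerate].
Qed.

Let degenerate_negligible : Pi degenerate = 0%E.
Proof.
have mx t : measurable (xsection degenerate t) by exact: measurable_xsection.
have x0 t : nu (xsection degenerate t) = 0%E.
  (* The product of the Wronskians that are not the zero polynomial. Its finitely many roots contain
     the fibre, and they are covered by discs of radius 0. *)
  pose Q := \prod_a (if rwronsk phi a.1 a.2 t == 0 then 1 else rwronsk phi a.1 a.2 t).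
  have Q0 : Q != 0.
    by apply/prodf_neq0 => a _; case: ifPn => // _; rewrite oner_eq0.
  have [rs QE] := closed_field_poly_normal Q.
  apply/eqP; rewrite eq_le measure_ge0 andbT.
  apply: (@le_trans _ _ (\sum_(i < size rs) (0 / r) ^+ 2)%:E); last first.
    by rewrite lee_fin big1// => i _; rewrite mul0r expr0n.
  apply: (covered_small U_small (I := 'I_(size rs)) (w := fun i => rs`_i)
    (h := fun=> 0) (mx t)) => //.
  move=> z; rewrite xsectionE => -[a _ [/= q0 W0]].
  have Wp : rwronsk phi a.1 a.2 t != 0.
    apply: wronskian_neq0; first by apply: contra_neq q0 => ->; rewrite horner0.
    by rewrite size_char_poly ltnS size_cofactor_char_poly_mx.
  have : root Q (toC z).
    by rewrite rootE horner_prod (bigD1 a)//= (negbTE Wp) W0 mul0r.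
  rewrite QE rootZ ?lead_coef_eq0// root_prod_XsubC => zrs.
  have zi : (index (toC z) rs < size rs)%N by rewrite index_mem.
  by exists (Ordinal zi) => /=; rewrite nth_index// subrr nrm0.
transitivity (\int[mu]_t nu (xsection degenerate t))%E => //.
by under eq_integral do rewrite x0; rewrite integral0.
Qed.

(** Off [degenerate], the truncating indicators are eventually 1 or the density vanishes. The bound
    for [Gtrunc] is free of delta, so Fatou's lemma removes the truncation. *)
Let G_integral : (\int[Pi]_p (G p)%:E <= ((r ^+ 2)^-1)%:E * \int[mu]_t (kappa2 t)%:E)%E.
Proof.
pose del (i : nat) : R := i.+1%:R^-1.
have mG : measurable_fun setT (EFin \o G) by exact/measurable_EFinP.
have mT i : measurable_fun setT (EFin \o Gtrunc (del i)).
  by apply/measurable_EFinP.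
rewrite (ge0_negligible_integral measurable_degenerate_union measurableT mG _
  degenerate_negligible); last first.
  by move=> p _; rewrite lee_fin sumr_ge0// => a _; exact: pivot_density_ge0.
rewrite integral_mkcond.
apply: (@le_trans _ _ (\int[Pi]_p limn_einf (fun i => (Gtrunc (del i) p)%:E))%E).
  apply: ge0_le_integral_nomeas => p; rewrite patchE.
    case: ifPn => // _; rewrite lee_fin sumr_ge0// => a _; exact: pivot_density_ge0.
  case: ifPn => [/set_mem [_ pd]|_]; last first.
    by apply: (@limn_einf_ge _ _ _ 0%N) => i _; rewrite lee_fin.
  have h a : exists i0, forall i, (i0 <= i)%N -> pivot_density phi a.1 a.2 p.1 (toC p.2) <=
      pivot_density phi a.1 a.2 p.1 (toC p.2) * \1_(wronskian_large phi a.1 a.2 (del i)) p.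
    have [q0|q0] := eqVneq (rcof phi a.1 a.2 p.1).[toC p.2] 0.
      by exists 0%N => i _; rewrite /pivot_density q0 eqxx mulr0 !mul0r.
    have W0 : 0 < nrm (rwronsk phi a.1 a.2 p.1).[toC p.2].
      by rewrite nrm_gt0; apply/eqP => W0; apply: pd; exists a.
    pose X := (nrm (rcof phi a.1 a.2 p.1).[toC p.2] +
       nrm (rcof phi a.1 a.2 p.1)^`().[toC p.2]) * nrm (rcof phi a.1 a.2 p.1).[toC p.2].
    exists (Num.truncn (X / nrm (rwronsk phi a.1 a.2 p.1).[toC p.2])) => i hi.
    rewrite indicE mem_set ?mulr1//= /wronskian_large /= -mulrA -/X /del mulrC.
    rewrite ltr_pdivrMr// mulrC -ltr_pdivrMr// (lt_le_trans (truncnS_gt _))//.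
    by rewrite ler_nat ltnS.
  have [i0 hi0] := choice h.
  apply: (@limn_einf_ge _ _ _ (\max_a i0 a)%N) => i hi; rewrite lee_fin.
  by apply: ler_sum => a _; apply: hi0; apply: leq_trans hi; exact: leq_bigmax.
apply: le_trans (fatou Pi measurableT mT _) _.
  by move=> i p _; rewrite lee_fin.
by apply: (@limn_einf_le _ _ _ 0%N) => i _; apply: Gtrunc_integral; rewrite invr_gt0.
Qed.

Hypothesis U_box : U `[- r, r]%classic = 1%E.
Hypothesis r_le : 2 * r <= spectral_radius R.

(** For each x in the square, every row contributes n / (4 e) times [pivot_const], and there are n
    rows; r^2 is the cost of the density bound for x. *)
Lemma expected_sqr_eigencond_ge :
  ((expR (- 1) / 4 * r ^+ 2 * pivot_const R * n%:R ^+ 2)%:E <=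
   \int[mu]_t (\sum_(i < n)
     eigencond (subm phi t) (eigenvalues (subm phi t))`_i ^+ 2)%:E)%E.
Proof.
pose I : set R := `[- r, r]%classic.
pose B : set (R * R) := I `*` I.
have mB : measurable B by apply: measurableX; exact: measurable_itv.
have nuB : nu B = 1%E.
  transitivity (U I * U I)%E; last by rewrite U_box mule1.
  by apply: product_measure1E; exact: measurable_itv.
have mG : measurable_fun setT (EFin \o G) by exact/measurable_EFinP.
pose c : R := n%:R / 4 * expR (- 1).
have c0 : 0 <= c by rewrite mulr_ge0 ?expR_ge0.
have lower : ((n%:R * (c * pivot_const R))%:E <= \int[Pi]_p (G p)%:E)%E.
  have -> : (\int[Pi]_p (G p)%:E = \int[nu]_z \int[mu]_t (G (t, z))%:E)%E.
    apply: (fubini_tonelli2 (EFin \o G)) => // p /=.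
    by rewrite lee_fin sumr_ge0// => a _; exact: pivot_density_ge0.
  apply: (@le_trans _ _ (\int[nu]_z ((n%:R * (c * pivot_const R))%:E * (\1_B z)%:E))%E).
    have nc0 : (0 <= (n%:R * (c * pivot_const R))%:E)%E.
      by rewrite lee_fin !mulr_ge0// ltW// pivot_const_gt0.
    rewrite ge0_integralZl//; last by apply/measurable_EFinP; exact: measurable_indic.
    have -> : (\int[nu]_z (\1_B z)%:E = 1)%E.
      by rewrite (integral_indic _ measurableT mB) setIT; exact: nuB.
    by rewrite mule1.
  have G0 t z : (0 <= (G (t, z))%:E)%E.
    by rewrite lee_fin sumr_ge0// => a _; exact: pivot_density_ge0.
  apply: ge0_le_integral_nomeas => z; rewrite indicE.
    by rewrite -EFinM lee_fin !mulr_ge0// ltW// pivot_const_gt0.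
  case: (boolP (z \in B)) => [/set_mem [/= z1 z2]|_]; last first.
    by rewrite mule0; apply: integral_ge0.
  rewrite mule1.
  (* In the square, |x| <= sqrt 2 r <= 2 r. *)
  have lam_le : nrm (toC z) <= spectral_radius R.
    apply: le_trans r_le; rewrite -(ler_pXn2r (n := 2)) ?nnegrE ?nrm_ge0//; last first.
      by rewrite mulr_ge0// ltW.
    rewrite nrm_sqr /=; move: z1 z2; rewrite /I /= !in_itv /= -!ler_norml => z1 z2.
    have sq x : `|x| <= r -> x ^+ 2 <= r ^+ 2.
      by move=> xh; rewrite -real_normK ?num_real// lerXn2r ?nnegrE// ltW.
    have := sq _ z1; have := sq _ z2; have := sqr_ge0 r; rewrite exprMn; lra.
  have mg a : measurable_fun setT (fun t => (pivot_density phi a.1 a.2 t (toC z))%:E).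
    have := @measurable_pivot_density R K n phi a.1 a.2.
    move=> /measurable_EFinP h.
    exact: (measurableT_comp h (measurable_pair2 z)).
  rewrite /G; under eq_integral do rewrite -sumEFin.
  rewrite ge0_integral_sum//; last by move=> a t _; rewrite lee_fin pivot_density_ge0.
  rewrite -(pair_bigA _ (fun j k => \int[mu]_t (pivot_density phi j k t (toC z))%:E)%E)/=.
  have -> : n%:R * (c * pivot_const R) = \sum_(j < n) c * pivot_const R.
    by rewrite sumr_const card_ord mulr_natl.
  rewrite -sumEFin; apply: lee_sum => j _.
  have := row_lower_bound sigma_gt0 sigmaE (probability_setT mu) mu_resampling
    lam_le j phi_inj.
  have ce0 : (0 <= c%:E)%E by rewrite lee_fin.
  move=> /(lee_wpmul2l ce0) h; rewrite (EFinM c); apply: le_trans h _.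
  rewrite ge0_sume_distrr; last first.
    by move=> k _; apply: integral_ge0 => t _; rewrite lee_fin mulr_ge0 ?expR_ge0.
  apply: lee_sum => k _.
  pose f t : R := (cofactor ((toC z)%:M - subm phi t) j k != 0)%:R *
    expR (- (2 * n%:R * nrm (zc t (phi (j, k)) + \det ((toC z)%:M - subm phi t) /
      cofactor ((toC z)%:M - subm phi t) j k) ^+ 2)).
  have E t : (pivot_density phi j k t (toC z))%:E = (c%:E * (f t)%:E)%E.
    by rewrite /pivot_density /rpivot /rcof /rchi horner_cofactor horner_char_poly -EFinM -mulrA.
  under [leRHS]eq_integral do rewrite E.
  have c1 : c != 0 by rewrite gt_eqF// mulr_gt0 ?divr_gt0 ?expR_gt0.
  have mf : measurable_fun setT (fun t => (f t)%:E).
    rewrite (_ : (fun t => _) = fun t => ((c^-1)%:E * (pivot_density phi j k t (toC z))%:E)%E).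
      by apply: measurable_funeM; exact: (mg (j, k)).
    by apply/funext => t; rewrite E -!EFinM mulrA mulVf// mul1r.
  have f0 t : (0 <= (f t)%:E)%E by rewrite lee_fin mulr_ge0 ?expR_ge0.
  have -> : (\int[mu]_t (c%:E * (f t)%:E) = c%:E * \int[mu]_t (f t)%:E)%E.
    exact: (ge0_integralZl _ measurableT mf (fun t _ => f0 t) ce0).
  exact: lexx.
have r2 : 0 < r ^+ 2 by rewrite exprn_gt0.
have := le_trans lower G_integral; rewrite lee_pdivlMl// -EFinM => /(le_trans _); apply.
rewrite lee_fin le_eqVlt; apply/orP; left; apply/eqP; rewrite /c; ring.
Qed.

End condition_number_moment.

(** * From the law of the entries back to the probability space *)

Section transfer.
Context d (T : measurableType d) d' (T' : measurableType d') (R : realType).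
Local Open Scope ereal_scope.
Import HBNNSimple.

(** A simple function below f pulls back to a simple function below f composed with X. For f of
    unknown measurability this gives an inequality, in the direction needed for a lower bound. *)
Lemma ge0_integral_distribution_le (P : probability T R) (X : {mfun T >-> T'})
    (f : T' -> \bar R) : (forall x, 0 <= f x) ->
  \int[distribution P X]_x f x <= \int[P]_w f (X w).
Proof.
move=> f0; rewrite ge0_integralTE//; apply: ge_ereal_sup => _ [h hf <-].
rewrite -integralT_nnsfun.
have mh : measurable_fun setT (EFin \o h) by exact/measurable_EFinP.
have h0 x : 0 <= (h x)%:E by rewrite lee_fin.
have -> : \int[distribution P X]_x (h x)%:E = \int[P]_w (h (X w))%:E.
  exact: (ge0_integral_distribution _ mh h0).
by apply: ge0_le_integral_nomeas.
Qed.

End transfer.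

Theorem proposition4p2 (R : realType) :
  exists c : R, 0 < c /\
    forall (n : nat), (0 < n)%N ->
    forall (d : measure_display) (Omega : measurableType d)
           (P : probability Omega R) (G : Omega -> 'M[R[i]]_n),
      complex_ginibre P G ->
      ((c * n%:R ^+ 2)%:E <=
        'E_P[(fun w => \sum_(i < n)
               eigencond (G w) (eigenvalues (G w))`_i ^+ 2)%R])%E.
Proof.
pose r := spectral_radius R / 2.
have r0 : 0 < r by apply: divr_gt0 => //; exact: spectral_radius_gt0.
exists (expR (- 1) / 4 * r ^+ 2 * pivot_const R); split.
  by rewrite mulr_gt0 ?pivot_const_gt0// mulr_gt0 ?exprn_gt0// divr_gt0 ?expR_gt0.
move=> n n0 d Omega P G [X [GE X_law X_indep]].
case: n n0 G X GE X_law X_indep => // n' _ G X GE X_law X_indep.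
(* Each real and imaginary part has variance sigma^2 = 1 / (2 n), so a complex entry has variance 2
   sigma^2 = 1 / n. *)
set sigma := Num.sqrt _ in X_law.
have s0 : 0 < (2 * n'.+1%:R)^-1 :> R by rewrite invr_gt0 mulr_gt0.
have sigma_gt0 : 0 < sigma by rewrite sqrtr_gt0.
have sigmaE : 2 * sigma ^+ 2 = n'.+1%:R^-1.
  by rewrite sqr_sqrtr ?(ltW s0)// invfM mulrA divff ?mul1r.
pose K : finType := ('I_n'.+1 * 'I_n'.+1)%type.
have RS := resampling_joint X_law X_indep.
have r_le : 2 * r <= spectral_radius R by rewrite /r mulrC divfK.
have main := expected_sqr_eigencond_ge (phi := @id K) (@inj_id _) sigma_gt0 sigmaE
  RS r0 (box_small r0) (box_full r0) r_le.
rewrite unlock; apply: le_trans main _.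
apply: le_trans (ge0_integral_distribution_le _ _ _) _.
  by move=> t; rewrite lee_fin sumr_ge0// => i _; exact: sqr_ge0.
rewrite le_eqVlt; apply/orP; left; apply/eqP; apply: eq_integral => w _.
have -> : subm id (joint X w) = G w; last by [].
by apply/matrixP => i j; rewrite GE !mxE.
Qed.
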